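(* Let $n$ be a positive integer, $\lambda\in\mathbb R$ (possibly depending on $n$), $k$ an integer, $a=k/n^{2/3}$, and let $v$ be any vertex of the Erdős–Rényi graph $G(n,p_{n,\lambda})$ with $p_{n,\lambda}=n^{-1}+\lambda n^{-4/3}$ and law $\mathbb P_{n,\lambda}$. Let $|\mathcal C(v)|$ be the number of vertices of the connected component containing $v$. (a) If $|\lambda| \le n^{1/12}$ and $n^{2/3}\le k \le n^{3/4}$, then $\displaystyle \mathbb P_{n,\lambda}(|\mathcal C(v)|=k) = \frac{k^{3/2}}{(8\pi)^{1/2}n^2} e^{-G_\lambda(a)} (1+O(E_1))$. (b) If $-n^{1/12}\le\lambda \le \frac15 n^{1/12}$ and $(3\lambda\vee 1)n^{2/3}\le k\le n^{3/4}$, then $\displaystyle \mathbb P_{n,\lambda}(|\mathcal C(v)|\ge k) = \frac{a^{3/2}}{(8\pi)^{1/2}n^{1/3} G'_\lambda(a)} e^{-G_\lambda(a)} (1+O(E_1)) + O(E_2)$. Here $E_1=E_1(k,n,\lambda) = \frac{k^4}{n^3} + \frac{|\lambda|}{n^{1/12}} + \frac{|\lambda|^3 k}{n} + \frac{n^{2/3}}{k} + \frac{1}{n^{1/10}}$ and $E_2=n^{1/4}e^{-n^{1/4}/80}$.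
   Context: $G(n,p)$ is the random graph on $n$ labelled vertices with each pair joined independently with probability $p$. $G_\lambda(x) = \frac{x}{8}(x-2\lambda)^2=\frac{x^3}{8} - \frac{\lambda x^2}{2} + \frac{\lambda^2 x}{2}$, $G'_\lambda$ its derivative. $x\vee y=\max(x,y)$. Asymptotic notation: $f=g(1+O(h))+O(h')$ means there is an absolute constant $C$ (independent of $n,k,\lambda$) with $|f-g|\le C|g|h+Ch'$ for all sufficiently large $n$ and all parameters satisfying the hypotheses. *)

(* Defs.v *)
From HB Require Import structures.
From mathcomp Require Import all_boot all_order all_algebra.
From mathcomp Require Import all_classical all_reals all_analysis.
Set Implicit Arguments. Unset Strict Implicit. Unset Printing Implicit Defensive.
Import Order.TTheory GRing.Theory Num.Theory.
Local Open Scope ring_scope.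

(* Erdos-Renyi random graph G(n,p) on vertex set 'I_n.
   A graph is a set of pairs (i,j) with i < j (each unordered pair coded once). *)
Definition pairs (n : nat) : {set 'I_n * 'I_n} := [set e : 'I_n * 'I_n | (val e.1 < val e.2)%N].

Definition gnp_weight (R : ringType) (n : nat) (p : R) (G : {set 'I_n * 'I_n}) : R :=
  p ^+ #|G| * (1 - p) ^+ (#|pairs n| - #|G|).

Definition gnp_prob (R : ringType) (n : nat) (p : R) (A : pred {set 'I_n * 'I_n}) : R :=
  \sum_(G in powerset (pairs n) | A G) gnp_weight p G.

Definition adjG (n : nat) (G : {set 'I_n * 'I_n}) : rel 'I_n :=
  fun x y => ((x, y) \in G) || ((y, x) \in G).

Definition comp_size (n : nat) (G : {set 'I_n * 'I_n}) (v : 'I_n) : nat :=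
  #|[set w | connect (adjG G) v w]|.

Definition p_nl (R : realType) (n : nat) (lam : R) : R :=
  (n%:R)^-1 + lam * (n%:R `^ (- (4 / 3))).

Definition Glam (R : realType) (lam x : R) : R := x / 8 * (x - 2 * lam) ^+ 2.
Definition dGlam (R : realType) (lam x : R) : R :=
  3 * x ^+ 2 / 8 - lam * x + lam ^+ 2 / 2.

Definition E1 (R : realType) (k n : nat) (lam : R) : R :=
  k%:R ^+ 4 / n%:R ^+ 3 + `|lam| / n%:R `^ (1 / 12)
  + `|lam| ^+ 3 * k%:R / n%:R + n%:R `^ (2 / 3) / k%:R + 1 / n%:R `^ (1 / 10).

Definition E2 (R : realType) (n : nat) : R :=
  n%:R `^ (1 / 4) * expR (- (n%:R `^ (1 / 4)) / 80).

(* Main.v *)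
Require Import Defs.
From HB Require Import structures.
From mathcomp Require Import all_boot all_order all_algebra.
From mathcomp Require Import all_classical all_reals all_analysis.
From mathcomp Require Import ring lra zify.
Import Order.TTheory GRing.Theory Num.Theory.
Import numFieldNormedType.Exports.
Local Open Scope ring_scope.

(* Exploring the component of v vertex by vertex gives the exact formula
     P(|C(v)| = k) = C(n-1,k-1) q^(k(n-k)) B(k,k-1),   q = 1 - p,
   where B solves the linear recursion of thinned undiscovered vertices, killed
   when the queue runs empty.  Without killing B(N,j) would be (1-q^N)^j, and
   (1 - g q^N)^j is harmonic for every g; comparing B with combinations of these
   functions along the diagonal j = N shows that the killing costs a factor
   (k^2 p^2 / 2)(1 + o(1)), the analogue of the ballot factor.  Stirling's
   formula for the remaining factors yields k^(3/2) e^(-G(a)) / (sqrt(8 pi) n^2).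
   For the tail, G is convex on [a, oo) when a >= 3 lambda, so the terms after k
   decay geometrically at rate n^(-2/3) G'(a), with relative corrections O(1/a);
   sizes above n^(3/4) are negligible by a Chernoff bound. *)

(** * Derivatives and Taylor bounds *)

Section RealAnalysis.
Context {R : realType}.
Implicit Types (f g : R -> R) (x y a b t : R).

(** The difficulty sits on the killing diagonal [j = N]. Put [q = expR (- tau)] and [y = N * tau]:
    at [(N, N)] the first-order solution keeps, relative to the unkilled one, the value [mu y],
    about [y / 2], where the true value is 0. Exponential harmonic functions repair this: relative
    to the unkilled solution they are [tilt ^ j], hence [exp (Lam B y / tau)] on the diagonal, and
    [B = (exp z - 1) ^ 2] places the peak of [Lam B] at [y = z]. With [z] near [c = k * tau] the
    correction acts near the top, where it must cancel [mu c]. Passing from [(k, k)] to [(k, k - 1)]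
    then releases [mu c * (1 - 1 / tilt)], about [(c / 2) * c], and this is the factor
    [k^2 p^2 / 2]. The exponents vary on the scale [c ^ 3 / tau = k c ^ 2], about the cube of
    [k / n^(2/3)], so that moving [z] off [c] by a relative amount of order [n^(2/3) / k] is enough
    to win the comparison on the diagonal; this is one source of the term [n^(2/3) / k] in [E1]. *)

Lemma is_derive_addf f g x a b : is_derive x 1 f a -> is_derive x 1 g b ->
  is_derive x (1 : R) (fun y => f y + g y) (a + b).
Proof. by move=> fa gb; apply: is_deriveD. Qed.

Lemma is_derive_subf f g x a b : is_derive x 1 f a -> is_derive x 1 g b ->
  is_derive x (1 : R) (fun y => f y - g y) (a - b).
Proof. by move=> fa gb; apply: is_deriveB. Qed.

Lemma is_derive_mulf f g x a b : is_derive x 1 f a -> is_derive x 1 g b ->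
  is_derive x (1 : R) (fun y => f y * g y) (a * g x + f x * b).
Proof.
move=> fa gb; have := is_deriveM fa gb; congr is_derive.
by rewrite /GRing.scale /=; ring.
Qed.

Lemma is_derive_compf f g x a b :
  is_derive (g x) 1 f a -> is_derive x 1 g b ->
  is_derive x (1 : R) (fun y => f (g y)) (a * b).
Proof. exact: is_derive1_comp. Qed.

Lemma is_derive_expf f x n a : is_derive x 1 f a ->
  is_derive x (1 : R) (fun y => f y ^+ n) (n%:R * f x ^+ n.-1 * a).
Proof.
move=> fa; have := is_deriveX n fa; congr is_derive.
by apply/funext => y; rewrite exprfctE.
Qed.

Lemma is_derive_invf f x a : f x != 0 -> is_derive x 1 f a ->
  is_derive x (1 : R) (fun y => (f y)^-1) (- (f x) ^- 2 * a).
Proof. by move=> f0 fa; have := is_deriveV f0 fa. Qed.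

Lemma is_derive_idf x : is_derive x (1 : R) (fun y : R => y) 1.
Proof. exact: is_derive_id. Qed.

Lemma is_derive_cstf x a : is_derive x (1 : R) (fun=> a) 0.
Proof. exact: is_derive_cst. Qed.

Lemma is_derive_continuous f x a : is_derive x (1 : R) f a -> {for x, continuous f}.
Proof.
by move=> fa; apply: differentiable_continuous; apply/derivable1_diffP; case: fa.
Qed.

Lemma MVT_le f (df : R -> R) x y : x <= y ->
  (forall t, x <= t <= y -> is_derive t 1 f (df t)) ->
  exists2 t, x <= t <= y & f y - f x = df t * (y - x).
Proof.
move=> xy fdf; have [||t] := @MVT_segment R f df x y xy.
- by move=> t; rewrite in_itv /= => /andP[xt ty]; apply: fdf; rewrite !ltW.
- apply: continuous_in_subspaceT => t; rewrite inE /= in_itv /= => xty.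
  exact: is_derive_continuous (fdf t xty).
- by rewrite in_itv /= => xty ->; exists t.
Qed.

(** The source of most one-variable inequalities below: it is applied to the difference of the two
    sides, from a point where that difference is known. *)
Lemma derive_ge0_le f (df : R -> R) x y : x <= y ->
  (forall t, x <= t <= y -> is_derive t 1 f (df t)) ->
  (forall t, x <= t <= y -> 0 <= df t) -> f x <= f y.
Proof.
move=> xy fdf df0; have [t xty e] := MVT_le _ _ _ _ xy fdf.
by rewrite -subr_ge0 e mulr_ge0 ?subr_ge0 // df0.
Qed.

Lemma is_derive_oppf f x a : is_derive x 1 f a ->
  is_derive x (1 : R) (fun y => - f y) (- a).
Proof. by move=> fa; have := is_deriveN fa. Qed.

Lemma is_derive_expRf f x a : is_derive x 1 f a ->
  is_derive x (1 : R) (fun y => expR (f y)) (expR (f x) * a).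
Proof. by move=> fa; apply: is_derive_compf. Qed.

Lemma is_derive_lnf f x a : 0 < f x -> is_derive x 1 f a ->
  is_derive x (1 : R) (fun y => ln (f y)) ((f x)^-1 * a).
Proof. by move=> f0 fa; apply: is_derive_compf; first exact: is_derive1_ln. Qed.

Lemma is_derive_sinf f x a : is_derive x 1 f a ->
  is_derive x (1 : R) (fun y => sin (f y)) (cos (f x) * a).
Proof. by move=> fa; apply: is_derive_compf. Qed.

Lemma is_derive_cosf f x a : is_derive x 1 f a ->
  is_derive x (1 : R) (fun y => cos (f y)) (- sin (f x) * a).
Proof. by move=> fa; apply: is_derive_compf. Qed.

End RealAnalysis.

(** The rules above are stated for explicit [fun y => ...], so that these patterns can read the rule
    off the body; positivity and nonvanishing conditions are left as goals. *)
Ltac derive_step := first [eapply is_derive_idf | eapply is_derive_cstf |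
  lazymatch goal with
  | |- is_derive _ _ (fun y => @?f y + @?g y) _ => eapply (@is_derive_addf _ f g)
  | |- is_derive _ _ (fun y => - @?f y) _ => eapply (@is_derive_oppf _ f)
  | |- is_derive _ _ (fun y => @?f y * @?g y) _ => eapply (@is_derive_mulf _ f g)
  | |- is_derive _ _ (fun y => @?f y ^+ ?n) _ => eapply (@is_derive_expf _ f _ n)
  | |- is_derive _ _ (fun y => (@?f y)^-1) _ => eapply (@is_derive_invf _ f)
  | |- is_derive _ _ (fun y => expR (@?f y)) _ => eapply (@is_derive_expRf _ f)
  | |- is_derive _ _ (fun y => ln (@?f y)) _ => eapply (@is_derive_lnf _ f)
  | |- is_derive _ _ (fun y => sin (@?f y)) _ => eapply (@is_derive_sinf _ f)
  | |- is_derive _ _ (fun y => cos (@?f y)) _ => eapply (@is_derive_cosf _ f)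
  end].
Ltac derive_auto := eapply is_derive_eq; [repeat derive_step | ]; cbv beta.

(** * Taylor polynomials enclosing [expR (- x)] *)

Section Taylor.
Context {R : realType}.
Implicit Types (x y a b t : R).

Lemma expRN_le x : 0 <= x -> expR (- x) <= 1 - x + x ^+ 2 / 2.
Proof.
move=> x0; rewrite -subr_ge0.
have := @derive_ge0_le R (fun x => 1 - x + x ^+ 2 / 2 - expR (- x))
  (fun x => - 1 + x + expR (- x)) 0 x x0.
rewrite oppr0 expR0 expr0n /= => H; apply: le_trans (H _ _); first lra.
- by move=> t tx; derive_auto; rewrite /=; field.
- by move=> t tx; have := expR_ge1Dx (- t); lra.
Qed.

Lemma expRN_ge x : 0 <= x -> 1 - x + x ^+ 2 / 2 - x ^+ 3 / 6 <= expR (- x).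
Proof.
move=> x0; rewrite -subr_ge0.
have := @derive_ge0_le R (fun x => expR (- x) - (1 - x + x ^+ 2 / 2 - x ^+ 3 / 6))
  (fun x => 1 - x + x ^+ 2 / 2 - expR (- x)) 0 x x0.
rewrite oppr0 expR0 !expr0n /= => H; apply: le_trans (H _ _); first (clear -R; lra).
- by move=> t tx; derive_auto; rewrite /=; field.
- by move=> t /andP[t0 _]; have := expRN_le t t0; lra.
Qed.

End Taylor.

(** * The exploration recursion and its product martingales *)

Section BallsInBoxes.
Context {R : realFieldType}.
Variable q : R.
Hypothesis q01 : 0 < q < 1.
Implicit Types (U : nat -> nat -> R) (N j : nat).

(** Mean of [U N] at a binomial argument with parameters [j] and [q], the number of vertices that
    one exploration step leaves undiscovered. *)
Definition thin U N j : R :=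
  \sum_(i < j.+1) ('C(j, i))%:R * (1 - q) ^+ (j - i) * q ^+ i * U N i.

(* [N] vertices of the component are not yet explored and [j] of these are not
   yet discovered; the exploration queue is nonempty exactly when [j < N]. Each
   step discovers every undiscovered vertex independently with probability
   [1 - q]. *)
Fixpoint boxes N j : R :=
  if N is N'.+1 then (if (j <= N')%N then thin boxes N' j else 0) else (j == 0%N)%:R.

(** The recursion of [boxes] without its killing condition. Asking for it at all [j] is what makes
    explicit solutions available. *)
Definition harmonic U := forall N j, U N.+1 j = thin U N j.

Lemma thin_le U U' N j : (forall i, (i <= j)%N -> U N i <= U' N i) ->
  thin U N j <= thin U' N j.
Proof.
case/andP: q01 => q0 q1 UU'; apply: ler_sum => i _; apply: ler_wpM2l.
  by rewrite !mulr_ge0 ?exprn_ge0 // ltW // subr_gt0.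
by apply: UU'; rewrite -ltnS.
Qed.

Lemma boxes_eq0 N : boxes N.+1 N.+1 = 0.
Proof. by rewrite /= ltnn. Qed.

(** Comparison principle: [thin] is monotone because its weights are nonnegative, and [boxes]
    vanishes on the diagonal, so a harmonic function only needs control at the bottom level [s] and
    on the diagonal above it. *)
Lemma boxes_ge U s k : harmonic U ->
  (forall j, (j <= s)%N -> U s j <= boxes s j) ->
  (forall N, (s < N <= k)%N -> U N N <= 0) ->
  forall N j, (s <= N <= k)%N -> (j <= N)%N -> U N j <= boxes N j.
Proof.
move=> hU Us UN; elim=> [|N IH] j.
  by rewrite leqn0 => /andP[/eqP s0 _]; move: (Us); rewrite s0; apply.
rewrite leq_eqVlt => /andP[/orP[/eqP s0 _|sN Nk]]; first by rewrite -s0; apply: Us.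
rewrite leq_eqVlt => /orP[/eqP ->|]; first by rewrite boxes_eq0 UN ?sN.
rewrite ltnS => jN; rewrite hU /= jN; apply: thin_le => i ij.
by apply: IH; [rewrite -ltnS sN ltnW|exact: leq_trans ij jN].
Qed.

Lemma boxes_le U s k : harmonic U ->
  (forall j, (j <= s)%N -> boxes s j <= U s j) ->
  (forall N, (s < N <= k)%N -> 0 <= U N N) ->
  forall N j, (s <= N <= k)%N -> (j <= N)%N -> boxes N j <= U N j.
Proof.
move=> hU Us UN; elim=> [|N IH] j.
  by rewrite leqn0 => /andP[/eqP s0 _]; move: (Us); rewrite s0; apply.
rewrite leq_eqVlt => /andP[/orP[/eqP s0 _|sN Nk]]; first by rewrite -s0; apply: Us.
rewrite leq_eqVlt => /orP[/eqP ->|]; first by rewrite boxes_eq0 UN ?sN.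
rewrite ltnS => jN; rewrite hU /= jN; apply: thin_le => i ij.
by apply: IH; [rewrite -ltnS sN ltnW|exact: leq_trans ij jN].
Qed.

Lemma binomial_thin (z : R) j :
  \sum_(i < j.+1) ('C(j, i))%:R * (1 - q) ^+ (j - i) * q ^+ i * z ^+ i
  = (1 - q + q * z) ^+ j.
Proof.
rewrite exprDn; apply: eq_bigr => i _.
by rewrite exprMn -mulr_natl; ring.
Qed.

(** [thin] sends [z ^ j] to [(1 - q + q z) ^ j] by the binomial theorem, and this carries
    [z = 1 - g q ^ N] to [1 - g q ^ N.+1]. *)
Lemma harmonic_exp (g : R) : harmonic (fun N j => (1 - g * q ^+ N) ^+ j).
Proof.
move=> N j; rewrite /thin binomial_thin; congr (_ ^+ _).
by rewrite exprS; ring.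
Qed.

Lemma binomial_thin_mean (z : R) j :
  \sum_(i < j.+1) ('C(j, i))%:R * (1 - q) ^+ (j - i) * q ^+ i * (i%:R * z ^+ i.-1)
  = j%:R * q * (1 - q + q * z) ^+ j.-1.
Proof.
case: j => [|j]; first by rewrite big_ord_recl big_ord0 /= !(mul0r, mulr0, addr0).
rewrite big_ord_recl /= !(mul0r, mulr0) add0r.
under eq_bigr => i _ do rewrite /bump /= add1n subSS.
rewrite -binomial_thin mulr_sumr; apply: eq_bigr => i _.
have := congr1 (fun m => m%:R : R) (mul_bin_diag j.+1 i).
rewrite !natrM /= => e.
transitivity (j.+1%:R * 'C(j, i)%:R * (1 - q) ^+ (j - i) * q ^+ i.+1 * z ^+ i).
  by rewrite e; ring.
by rewrite exprS; ring.
Qed.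

(** Up to sign, the derivative at [g = 1] of the family in [harmonic_exp]. *)
Lemma harmonic_lin :
  harmonic (fun N j => j%:R * q ^+ N * (1 - q ^+ N) ^+ j.-1).
Proof.
move=> N j; rewrite /thin.
have -> : 1 - q ^+ N.+1 = 1 - q + q * (1 - q ^+ N) by rewrite exprS; ring.
transitivity (q ^+ N * (j%:R * q * (1 - q + q * (1 - q ^+ N)) ^+ j.-1)).
  by rewrite exprS; ring.
by rewrite -binomial_thin_mean mulr_sumr; apply: eq_bigr => i _; ring.
Qed.

Lemma harmonic_add U U' : harmonic U -> harmonic U' ->
  harmonic (fun N j => U N j + U' N j).
Proof.
move=> hU hU' N j; rewrite hU hU' /thin -big_split /=.
by apply: eq_bigr => i _; rewrite -mulrDr.
Qed.

Lemma harmonic_scale U (a : R) : harmonic U -> harmonic (fun N j => a * U N j).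
Proof.
move=> hU N j; rewrite hU /thin mulr_sumr.
by apply: eq_bigr => i _; ring.
Qed.

Lemma one_sub_expr_gt0 N : (0 < N)%N -> 0 < 1 - q ^+ N.
Proof. by case/andP: q01 => q0 q1 N0; rewrite subr_gt0 exprn_ilt1 // ?ltW // -lt0n. Qed.

Lemma bernoulli N : 1 - N%:R * (1 - q) <= q ^+ N.
Proof.
case/andP: q01 => q0 q1; elim: N => [|N IH]; first by rewrite expr0; lra.
rewrite exprS -natr1; have : 0 <= N%:R :> R by [].
have : q * (1 - N%:R * (1 - q)) <= q * q ^+ N by rewrite ler_pM2l.
move=> h n0; apply: le_trans h; rewrite -subr_ge0.
have -> : q * (1 - N%:R * (1 - q)) - (1 - (N%:R + 1) * (1 - q)) = N%:R * (1 - q) ^+ 2.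
  by ring.
by rewrite mulr_ge0 // sqr_ge0.
Qed.

(** [1 - j / N] is the exact ballot factor (cycle lemma) when the discovery step of each vertex is
    uniform over the [N] steps. Here earlier steps are likelier, which only helps the queue; in the
    induction this becomes Bernoulli's inequality. *)
Lemma boxes_ge_ballot N j : (0 < N)%N -> (j <= N)%N ->
  (1 - q ^+ N) ^+ j * (1 - j%:R / N%:R) <= boxes N j.
Proof.
case/andP: (q01) => q0 q1.
elim: N j => [//|N IH] j _.
rewrite leq_eqVlt => /orP[/eqP ->|]; first by rewrite boxes_eq0 divff ?subrr ?mulr0.
rewrite ltnS => jN; rewrite /= jN.
case: N => [|N] in IH jN *.
  move: jN; rewrite leqn0 => /eqP ->.
  by rewrite /thin big_ord_recl big_ord0 /= mul0r subr0 ?expr0 ?bin0; lra.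
apply: le_trans (_ : thin (fun N j => (1 - q ^+ N) ^+ j * (1 - j%:R / N%:R)) N.+1 j <= _).
  set z := 1 - q ^+ N.+1.
  have z0 : 0 < z by exact: one_sub_expr_gt0.
  have zE : 1 - q ^+ N.+2 = 1 - q + q * z by rewrite /z exprS; ring.
  have -> : thin (fun N j => (1 - q ^+ N) ^+ j * (1 - j%:R / N%:R)) N.+1 j =
    (1 - q + q * z) ^+ j - z / N.+1%:R * (j%:R * q * (1 - q + q * z) ^+ j.-1).
    rewrite -binomial_thin -binomial_thin_mean mulr_sumr -sumrB.
    apply: eq_bigr => i _; rewrite -/z.
    have -> : z ^+ i * (1 - i%:R / N.+1%:R) = z ^+ i - z / N.+1%:R * (i%:R * z ^+ i.-1).
      by case: (nat_of_ord i) => [|i'] /=; rewrite ?exprS; ring.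
    by ring.
  rewrite zE; case: j jN => [|j] jN /=; first by rewrite !(mul0r, mulr0, subr0, mulr1).
  rewrite exprS mulrBr mulr1 lerD2l lerN2.
  set w := 1 - q + q * z; have w0 : 0 < w by rewrite /w -zE; exact: one_sub_expr_gt0.
  have -> : z / N.+1%:R * (j.+1%:R * q * w ^+ j) = (w ^+ j * j.+1%:R) * (q * z / N.+1%:R).
    by ring.
  have -> : w * w ^+ j * (j.+1%:R / N.+2%:R) = (w ^+ j * j.+1%:R) * (w / N.+2%:R).
    by ring.
  apply: ler_wpM2l; first by rewrite mulr_ge0 // exprn_ge0 // ltW.
  (* Clearing denominators in [q z / N.+1 <= w / N.+2] leaves exactly Bernoulli's inequality for
     [q ^ N.+2]. *)
  rewrite ler_pdivrMr // mulrAC ler_pdivlMr //.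
  have := bernoulli N.+2; rewrite [q ^+ _]exprS /w /z -[N.+2%:R]natr1.
  set t := q ^+ N.+1; set n := N.+1%:R => b.
  have -> : q * (1 - t) * (n + 1) = (1 - q + q * (1 - t)) * n
    + (1 - (n + 1) * (1 - q) - q * t) by ring.
  by rewrite gerDl subr_le0.
by apply: thin_le => i ij; apply: IH => //; exact: leq_trans ij jN.
Qed.

(** The right side is harmonic and agrees with [boxes] at level 0; the hypothesis on [kap] is its
    nonnegativity on the diagonal. *)
Lemma boxes_le_lin (kap : R) N j :
  (forall N, (0 < N)%N -> N%:R * kap * q ^+ N <= 1 - q ^+ N) ->
  (j <= N)%N ->
  boxes N j <= (1 - q ^+ N) ^+ j - kap * (j%:R * q ^+ N * (1 - q ^+ N) ^+ j.-1).
Proof.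
move=> hk jN.
have hU : harmonic (fun N j => (1 - 1 * q ^+ N) ^+ j +
    - kap * (j%:R * q ^+ N * (1 - q ^+ N) ^+ j.-1)).
  by apply: harmonic_add; [exact: harmonic_exp|exact/harmonic_scale/harmonic_lin].
apply: le_trans (boxes_le _ 0%N N hU _ _ N j _ jN) _ => //; last by rewrite mul1r mulNr.
- by move=> i; rewrite leqn0 => /eqP -> /=; rewrite ?expr0 mul0r; lra.
- move=> [//|n] _; rewrite mul1r mulNr.
  have n0 := one_sub_expr_gt0 n.+1 isT.
  rewrite subr_ge0 /= mulrA [leRHS]exprS ler_pM2r ?exprn_gt0 //.
  by have := hk n.+1 isT; lra.
- by rewrite leqnn.
Qed.

(* [tilt] and [lin] are the harmonic functions of [harmonic_exp] (with
   [g = 1 - B]) and [harmonic_lin], divided by [(1 - q ^+ N) ^+ j], the solution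
   without the constraint [j < N]. *)
Definition tilt (B : R) N : R := 1 + B * (q ^+ N / (1 - q ^+ N)).

Definition lin (kap : R) N j : R := 1 - kap * j%:R * (q ^+ N / (1 - q ^+ N)).

Lemma tiltE B N j : (0 < N)%N ->
  (1 - q ^+ N) ^+ j * tilt B N ^+ j = (1 - (1 - B) * q ^+ N) ^+ j.
Proof.
move=> N0; rewrite -exprMn; congr (_ ^+ _); rewrite /tilt.
by have := one_sub_expr_gt0 N N0; set z := q ^+ N => z0; field; rewrite gt_eqF.
Qed.

Lemma linE kap N j : (0 < N)%N ->
  (1 - q ^+ N) ^+ j * lin kap N j =
  (1 - q ^+ N) ^+ j - kap * (j%:R * q ^+ N * (1 - q ^+ N) ^+ j.-1).
Proof.
move=> N0; rewrite /lin; have := one_sub_expr_gt0 N N0; set z := q ^+ N => z0.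
by case: j => [|j] /=; rewrite ?exprS; field; rewrite gt_eqF.
Qed.

Lemma tilt_ge1 B N : (0 < N)%N -> 0 <= B -> 1 <= tilt B N.
Proof.
move=> N0 B0; rewrite /tilt lerDl mulr_ge0 // divr_ge0 ?exprn_ge0 //.
  by case/andP: q01 => /ltW.
by rewrite ltW // one_sub_expr_gt0.
Qed.

(* The first-order main term [lin - lin k k * tilt ^ j / tilt k ^ k] vanishes at
   [(k, k)] and stays nonnegative on the diagonal; below level [s] the crude
   bound by [lin] is absorbed by [eps]. *)
Lemma boxes_upper (kap B eps : R) s k : (0 < s < k)%N -> 0 <= B -> 0 <= kap -> 0 <= eps ->
  (forall N, (0 < N)%N -> N%:R * kap * q ^+ N <= 1 - q ^+ N) ->
  (forall N, (s < N <= k)%N -> lin kap k k * tilt B N ^+ N <= lin kap N N * tilt B k ^+ k) ->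
  (1 + eps) * (lin kap k k * tilt B s ^+ s) <= eps * lin kap s s * tilt B k ^+ k ->
  boxes k k.-1 <= (1 - q ^+ k) ^+ k.-1 *
     ((1 + eps) * (lin kap k k.-1 - lin kap k k / tilt B k)).
Proof.
move=> /andP[s0 sk] B0 kap0 eps0 hkap h1 h2.
have k0 : (0 < k)%N by exact: leq_ltn_trans sk.
set X := tilt B k ^+ k; have tk := tilt_ge1 B k k0 B0.
have X0 : 0 < X by rewrite exprn_gt0 // (lt_le_trans ltr01).
pose U N j := (1 + eps) * (((1 - 1 * q ^+ N) ^+ j +
    - kap * (j%:R * q ^+ N * (1 - q ^+ N) ^+ j.-1)) + - (lin kap k k / X) *
   (1 - (1 - B) * q ^+ N) ^+ j).
have hU : harmonic U.
  apply/harmonic_scale/harmonic_add; last exact/harmonic_scale/harmonic_exp.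
  by apply: harmonic_add; [exact: harmonic_exp|exact/harmonic_scale/harmonic_lin].
have UE N j : (0 < N)%N -> U N j = (1 - q ^+ N) ^+ j *
    ((1 + eps) * (lin kap N j - lin kap k k / X * tilt B N ^+ j)).
  move=> N0; rewrite /U -tiltE // mul1r.
  have -> : (1 - q ^+ N) ^+ j * ((1 + eps) * (lin kap N j - lin kap k k / X * tilt B N ^+ j))
    = (1 + eps) * ((1 - q ^+ N) ^+ j * lin kap N j -
        lin kap k k / X * ((1 - q ^+ N) ^+ j * tilt B N ^+ j)) by ring.
  by rewrite linE //; ring.
have linge N i : (0 < N)%N -> (i <= N)%N -> 0 <= lin kap N N <= lin kap N i.
  move=> N0 iN; have n0 := one_sub_expr_gt0 N N0.
  have qn0 : 0 <= q ^+ N / (1 - q ^+ N).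
    by rewrite divr_ge0 ?exprn_ge0 // ?(ltW n0) //; case/andP: q01 => /ltW.
  rewrite /lin; apply/andP; split.
    by rewrite subr_ge0 mulrA ler_pdivrMr // mul1r; have := hkap N N0; lra.
  by rewrite lerD2l lerN2 ler_wpM2r // ler_wpM2l // ler_nat.
have -> : (1 - q ^+ k) ^+ k.-1 * ((1 + eps) * (lin kap k k.-1 - lin kap k k / tilt B k)) =
    U k k.-1.
  rewrite UE //; congr (_ * (_ * (_ - _))).
  have -> : X = tilt B k * tilt B k ^+ k.-1 by rewrite -exprS prednK.
  by field; rewrite expf_eq0 gt_eqF ?andbF // (lt_le_trans ltr01).
apply: (@boxes_le U s k) => //; last 2 first.
- by rewrite (ltnW sk) leqnn.
- by rewrite leq_pred.
- move=> j js; rewrite UE //.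
  apply: le_trans (boxes_le_lin kap s j hkap js) _; rewrite -linE //.
  apply: ler_wpM2l; first by rewrite exprn_ge0 // ltW // one_sub_expr_gt0.
  have /andP[l0 l1] := linge s j s0 js.
  have : tilt B s ^+ j <= tilt B s ^+ s by rewrite ler_weXn2l // tilt_ge1.
  have /andP[m0 _] := linge k k k0 (leqnn k) => tt.
  have : lin kap k k * tilt B s ^+ j <= lin kap k k * tilt B s ^+ s by exact: ler_wpM2l.
  move=> tt'.
  rewrite mulrBr.
  have : (1 + eps) * (lin kap k k / X * tilt B s ^+ j) <= eps * lin kap s s.
    rewrite [lin kap k k / X * _]mulrAC mulrA ler_pdivrMr //.
    apply: le_trans h2; rewrite ler_wpM2l //; lra.
  have : eps * lin kap s s <= eps * lin kap s j by rewrite ler_wpM2l.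
  lra.
- move=> N /andP[sN Nk]; have N0 : (0 < N)%N by exact: leq_ltn_trans sN.
  rewrite UE // mulr_ge0 ?exprn_ge0 //; first by rewrite ltW // one_sub_expr_gt0.
  rewrite mulr_ge0 //; first lra.
  by rewrite subr_ge0 mulrAC ler_pdivrMr // h1 // sN.
Qed.

(* Here the comparison function must be nonpositive on the whole diagonal, so a
   multiple [K] of a second difference of exponentials is subtracted to correct
   the single exponential near the bottom level [s]. *)
Lemma boxes_lower (kap B B1 B2 K : R) s k : (0 < s < k)%N ->
  0 <= B -> 0 <= B1 <= B2 -> 0 <= K -> 0 <= kap -> kap * s%:R * q ^+ s = 1 - q ^+ s ->
  (forall N, (s < N <= k)%N -> lin kap N N <= lin kap k k) -> 0 <= lin kap k k ->
  (forall N, (s <= N <= k)%N ->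
    tilt B2 N ^+ N / tilt B2 k ^+ k <= tilt B1 N ^+ N / tilt B1 k ^+ k) ->
  (forall N, (s < N <= k)%N -> 1 <= tilt B N ^+ N / tilt B k ^+ k +
    K * (tilt B1 N ^+ N / tilt B1 k ^+ k - tilt B2 N ^+ N / tilt B2 k ^+ k)) ->
  (1 - q ^+ k) ^+ k.-1 *
     (lin kap k k * (1 - (tilt B k)^-1 - K * (1 - (tilt B2 k)^-1))) <= boxes k k.-1.
Proof.
move=> /andP[s0 sk] B0 /andP[B10 B12] K0 kap0 hkap hm m0 h12 h1.
have B20 : 0 <= B2 by exact: le_trans B12.
have k0 : (0 < k)%N by exact: leq_ltn_trans sk.
have tX B' N n : (0 < N)%N -> 0 <= B' -> 0 < tilt B' N ^+ n.
  by move=> N0 B'0; rewrite exprn_gt0 // (lt_le_trans ltr01) // tilt_ge1.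
set X := tilt B k ^+ k in h1 *; have X0 : 0 < X by exact: tX.
set X1 := tilt B1 k ^+ k in h1 h12 *; have X10 : 0 < X1 by exact: tX.
set X2 := tilt B2 k ^+ k in h1 h12 *; have X20 : 0 < X2 by exact: tX.
set m := lin kap k k in hm m0 *.
pose U N j := ((1 - 1 * q ^+ N) ^+ j +
    - kap * (j%:R * q ^+ N * (1 - q ^+ N) ^+ j.-1)) +
  - m * (X^-1 * (1 - (1 - B) * q ^+ N) ^+ j + K * (
     X1^-1 * (1 - (1 - B1) * q ^+ N) ^+ j + - X2^-1 * (1 - (1 - B2) * q ^+ N) ^+ j)).
have hU : harmonic U.
  apply: harmonic_add.
    by apply: harmonic_add; [exact: harmonic_exp|exact/harmonic_scale/harmonic_lin].
  apply/harmonic_scale/harmonic_add; first exact/harmonic_scale/harmonic_exp.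
  apply/harmonic_scale/harmonic_add; exact/harmonic_scale/harmonic_exp.
pose D N j := tilt B N ^+ j / X + K * (tilt B1 N ^+ j / X1 - tilt B2 N ^+ j / X2).
have UE N j : (0 < N)%N -> U N j = (1 - q ^+ N) ^+ j * (lin kap N j - m * D N j).
  move=> N0; rewrite /U -!tiltE // mul1r mulrBr linE // /D.
  by ring.
apply: le_trans (_ : U k k.-1 <= _).
  rewrite UE //; apply: ler_wpM2l; first by rewrite exprn_ge0 // ltW // one_sub_expr_gt0.
  have tV B' : 0 <= B' -> tilt B' k ^+ k.-1 / tilt B' k ^+ k = (tilt B' k)^-1.
    move=> B'0; have -> : tilt B' k ^+ k = tilt B' k * tilt B' k ^+ k.-1.
      by rewrite -exprS prednK.
    by field; rewrite expf_eq0 gt_eqF ?andbF // (lt_le_trans ltr01) // tilt_ge1.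
  rewrite /D /X /X1 /X2 !tV //.
  have lk : m <= lin kap k k.-1.
    rewrite /m /lin lerD2l lerN2 ler_wpM2r //.
      rewrite divr_ge0 ?exprn_ge0 //; first by case/andP: q01 => /ltW.
      by rewrite ltW // one_sub_expr_gt0.
    by rewrite ler_wpM2l // ler_nat leq_pred.
  have : (tilt B1 k)^-1 <= 1 by rewrite invf_le1 ?tilt_ge1 // (lt_le_trans ltr01) // tilt_ge1.
  move=> t1.
  have : 0 <= m * (K * (1 - (tilt B1 k)^-1)) by rewrite !mulr_ge0 // subr_ge0.
  lra.
apply: (@boxes_ge U s k) => //; last 2 first.
- by rewrite (ltnW sk) leqnn.
- by rewrite leq_pred.
- move=> j js; rewrite UE //.
  apply: le_trans (boxes_ge_ballot s j s0 js).
  apply: ler_wpM2l; first by rewrite exprn_ge0 // ltW // one_sub_expr_gt0.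
  (* The normalisation of [kap] makes [lin] at level [s] coincide with the ballot factor, so that
     [boxes_ge_ballot] covers the bottom level. *)
  have -> : lin kap s j = 1 - j%:R / s%:R.
    rewrite /lin; congr (1 - _); have s00 := one_sub_expr_gt0 s s0.
    have sR : s%:R != 0 :> R by rewrite pnatr_eq0 -lt0n.
    transitivity (j%:R / s%:R * (kap * s%:R * q ^+ s) / (1 - q ^+ s)).
      by field; rewrite sR gt_eqF.
    by rewrite hkap mulfK // gt_eqF.
  rewrite lerBlDr lerDl mulr_ge0 // /D addr_ge0 //.
    by rewrite divr_ge0 // ltW // tX.
  rewrite mulr_ge0 // subr_ge0.
  (* The two exponentials are compared only at exponent [s]; since [tilt B1 s <= tilt B2 s],
     dividing out the power [s - j] carries the comparison over to exponent [j]. *)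
  have := h12 s; rewrite leqnn (ltnW sk) => /(_ isT).
  have e x : x ^+ s = x ^+ (s - j) * x ^+ j :> R by rewrite -exprD subnK.
  rewrite (e (tilt B1 s)) (e (tilt B2 s)) -!mulrA => hs.
  have t12 : tilt B1 s <= tilt B2 s.
    rewrite /tilt lerD2l ler_wpM2r // divr_ge0 ?exprn_ge0 //; first by case/andP: q01 => /ltW.
    by rewrite ltW // one_sub_expr_gt0.
  have t12' : tilt B1 s ^+ (s - j) <= tilt B2 s ^+ (s - j).
    by rewrite lerXn2r // nnegrE (le_trans ler01) // tilt_ge1.
  have a0 := tX B1 s (s - j)%N s0 B10.
  rewrite -(ler_pM2l a0); apply: le_trans hs.
  by apply: ler_wpM2r => //; rewrite divr_ge0 // ltW // tX.
- move=> N /andP[sN Nk]; have N0 : (0 < N)%N by exact: leq_ltn_trans sN.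
  rewrite UE // mulr_ge0_le0 ?exprn_ge0 //; first by rewrite ltW // one_sub_expr_gt0.
  rewrite subr_le0.
  have hN : (s < N <= k)%N by rewrite sN.
  have := hm N hN; have := h1 N hN; rewrite -/(D N N) => D1 lm.
  by apply: le_trans lm _; rewrite ler_peMr.
Qed.

End BallsInBoxes.

(** * Asymptotics of the recursion *)

Section TiltExponent.
Context {R : realType}.
Implicit Types (B y z t c : R).

Lemma expR_ge2 y : 0 <= y -> 1 + y + y ^+ 2 / 2 <= expR y.
Proof.
move=> y0; rewrite -subr_ge0.
have := @derive_ge0_le R (fun x => expR x - (1 + x + x ^+ 2 / 2))
  (fun x => expR x - (1 + x)) 0 y y0.
rewrite expR0 !expr0n /= => H; apply: le_trans (H _ _); first (clear -R; lra).
- by move=> t tx; derive_auto; rewrite /=; field.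
- by move=> t _; have := expR_ge1Dx t; lra.
Qed.

Lemma expR_le2 y : 0 <= y <= 1 -> expR y <= 1 + y + y ^+ 2.
Proof.
move=> /andP[y0 y1].
have h := expRN_ge y y0.
have e : expR y * expR (- y) = 1 by rewrite expRxMexpNx_1.
have e0 := expR_gt0 y.
have : expR y * (1 - y + y ^+ 2 / 2 - y ^+ 3 / 6) <= 1.
  by rewrite -[leRHS]e ler_pM2l.
have d0 : 0 < 1 - y + y ^+ 2 / 2 - y ^+ 3 / 6 by nra.
rewrite -ler_pdivlMr // => /le_trans; apply.
rewrite ler_pdivrMr //.
rewrite -subr_ge0.
have -> : (1 + y + y ^+ 2) * (1 - y + y ^+ 2 / 2 - y ^+ 3 / 6) - 1 =
  y ^+ 2 * (1 / 2 - 2 / 3 * y + y ^+ 2 / 3 - y ^+ 3 / 6) by field.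
rewrite mulr_ge0 ?sqr_ge0 //; nra.
Qed.

Lemma expR_sub1_ge y : y <= expR y - 1.
Proof. by have := expR_ge1Dx y; lra. Qed.

Lemma expR_sub1_gt0 y : 0 < y -> 0 < expR y - 1.
Proof. by have := expR_sub1_ge y; lra. Qed.

(** Generating function of the Bernoulli numbers, [1 + t / 2 + t ^ 2 / 12 - ...]. Its slope governs
    both [mu] and the sign of the derivative of [Lam]. *)
Definition Psi t := t / (1 - expR (- t)).

Lemma one_sub_expRN_gt0 t : 0 < t -> 0 < 1 - expR (- t).
Proof. by move=> t0; rewrite subr_gt0 expR_lt1 oppr_lt0. Qed.

Lemma Psi_derive t : 0 < t -> is_derive t 1 Psi
  ((1 - expR (- t) - t * expR (- t)) / (1 - expR (- t)) ^+ 2).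
Proof.
move=> t0; rewrite /Psi; have := one_sub_expRN_gt0 t t0 => d0.
derive_auto; first by rewrite gt_eqF.
by field; rewrite gt_eqF.
Qed.

Lemma Psi_slope_ge y t : 0 < y <= t -> (t - y) / 2 <= Psi t - Psi y.
Proof.
move=> /andP[y0 yt].
have := @derive_ge0_le R (fun t => Psi t - t / 2)
  (fun t => (1 - expR (- t) - t * expR (- t)) / (1 - expR (- t)) ^+ 2 - 1 / 2) y t yt.
move=> H; suff : Psi y - y / 2 <= Psi t - t / 2 by lra.
apply: H => s /andP[ys _]; have s0 : 0 < s by lra.
  eapply is_derive_eq; first eapply is_derive_subf; first exact: Psi_derive.
    repeat derive_step.
  by cbv beta; field; rewrite gt_eqF // one_sub_expRN_gt0.
rewrite subr_ge0 ler_pdivlMr ?exprn_gt0 ?one_sub_expRN_gt0 //.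
suff : 0 <= 1 - 2 * s * expR (- s) - expR (- s) ^+ 2 by move: (expR _) => e; nra.
have := @derive_ge0_le R (fun s => 1 - 2 * s * expR (- s) - expR (- s) ^+ 2)
  (fun s => 2 * expR (- s) * (s - 1 + expR (- s))) 0 s (ltW s0).
rewrite oppr0 expR0 mulr0 mul0r => K; apply: le_trans (K _ _); first lra.
  by move=> r _; derive_auto; rewrite /=; ring.
move=> r _; rewrite !mulr_ge0 ?expR_ge0 //; have := expR_ge1Dx (- r); lra.
Qed.

(** The slope of [Psi] tends to 1/2 at 0; the bound 6/10 on [(0, 8/100]] leaves slope at least 4/10
    for [mu y = 1 + y - Psi y]. *)
Lemma Psi_slope_le y t : 0 < y <= t -> t <= 8 / 100 -> Psi t - Psi y <= 6 / 10 * (t - y).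
Proof.
move=> /andP[y0 yt] t1.
have := @derive_ge0_le R (fun t => 6 / 10 * t - Psi t)
  (fun t => 6 / 10 - (1 - expR (- t) - t * expR (- t)) / (1 - expR (- t)) ^+ 2) y t yt.
move=> H; suff : 6 / 10 * y - Psi y <= 6 / 10 * t - Psi t by lra.
apply: H => s /andP[ys st]; have s0 : 0 < s by clear -y0 ys; lra.
  have := is_derive_subf _ _ _ _ _ (is_derive_mulf (fun=> 6 / 10) (fun x => x) _ _ _
    (is_derive_cstf s (6 / 10)) (is_derive_idf s)) (Psi_derive s s0).
  by congr is_derive; ring.
rewrite subr_ge0 ler_pdivrMr ?exprn_gt0 ?one_sub_expRN_gt0 //.
have h1 := expRN_ge s (ltW s0); have h2 := expRN_le s (ltW s0).
move: (expR _) h1 h2 => e h1 h2.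
have : (s - s ^+ 2 / 2) ^+ 2 <= (1 - e) ^+ 2 by apply: lerXn2r; rewrite ?nnegrE; nra.
have : s * (1 - s + s ^+ 2 / 2 - s ^+ 3 / 6) <= s * e by rewrite ler_pM2l.
move=> h3 h4.
have : 0 <= s ^+ 2 * (6 / 10 * (1 - s / 2) ^+ 2 - 1 / 2 + s / 3 - s ^+ 2 / 6).
  rewrite mulr_ge0 ?sqr_ge0 //; nra.
nra.
Qed.

(* For [q = expR (- tau)] and [y = N * tau], [mu y] is [lin q tau N N] and
   [Lam B y / tau] (below) is the logarithm of [tilt q B N ^+ N]. *)
Definition mu y := 1 - y / (expR y - 1).

Lemma muE y : 0 < y -> mu y = 1 + y - Psi y.
Proof.
move=> y0; rewrite /mu /Psi expRN.
have e0 := expR_gt0 y; have := expR_sub1_gt0 y y0; move: (expR y) e0 => e e0 e1.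
by field; rewrite !gt_eqF.
Qed.

Lemma mu_slope_ge y t : 0 < y <= t -> t <= 8 / 100 -> 4 / 10 * (t - y) <= mu t - mu y.
Proof.
move=> /[dup] h /andP[y0 yt] t1; have := Psi_slope_le y t h t1.
by rewrite !muE; lra.
Qed.

Definition Lam B y := y * ln (1 + B / (expR y - 1)).

Lemma mu_ge0 y : 0 < y -> 0 <= mu y.
Proof.
move=> y0; rewrite /mu subr_ge0 ler_pdivrMr ?expR_sub1_gt0 // mul1r.
exact: expR_sub1_ge.
Qed.

Lemma mu_le y : 0 < y -> mu y <= y / 2.
Proof.
move=> y0; rewrite muE //; have e0 := one_sub_expRN_gt0 y y0.
suff : 1 + y / 2 <= Psi y by lra.
rewrite /Psi ler_pdivlMr //.
have := @derive_ge0_le R (fun y => y - (1 + y / 2) * (1 - expR (- y)))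
  (fun y => (1 - (1 + y) * expR (- y)) / 2) 0 y (ltW y0).
rewrite oppr0 expR0 subrr mulr0 subr0 => H; rewrite -subr_ge0; apply: H => t /andP[t0 _].
  by derive_auto; rewrite /=; field.
have : (1 + t) * expR (- t) <= 1.
  by rewrite -[leRHS](expRxMexpNx_1 t) ler_pM2r ?expR_gt0 // expR_ge1Dx.
lra.
Qed.

Lemma mu_ge y : 0 < y -> y / 2 - y ^+ 2 / 4 <= mu y.
Proof.
move=> y0; have e0 := expR_sub1_gt0 y y0; have := expR_ge2 y (ltW y0) => h.
rewrite /mu; suff : y / (expR y - 1) <= 1 - y / 2 + y ^+ 2 / 4 by lra.
rewrite ler_pdivrMr //.
have h' : y + y ^+ 2 / 2 <= expR y - 1 by lra.
have d0 : 0 < 1 - y / 2 + y ^+ 2 / 4 by have := sqr_ge0 (y / 2 - 1 / 2); nra.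
apply: le_trans (_ : (1 - y / 2 + y ^+ 2 / 4) * (y + y ^+ 2 / 2) <= _).
  rewrite -subr_ge0.
  have -> : (1 - y / 2 + y ^+ 2 / 4) * (y + y ^+ 2 / 2) - y = y ^+ 4 / 8 by field.
  by rewrite mulr_ge0 // exprn_ge0 // ltW.
by rewrite ler_pM2l.
Qed.

(** [mu y / y = 1 / y - 1 / (expR y - 1)], and its monotonicity reduces to
    [s <= expR (s / 2) - expR (- s / 2)]. *)
Lemma mu_over_id_decr y t : 0 < y <= t -> y / t * mu t <= mu y.
Proof.
move=> /andP[y0 yt]; have t0 : 0 < t by lra.
suff : mu t / t <= mu y / y.
  by rewrite [mu y / _]mulrC -ler_pdivrMl ?invr_gt0 // invrK mulrA [y * _ * _]mulrAC.
have muE' s : 0 < s -> mu s / s = s^-1 - (expR s - 1)^-1.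
  by move=> s0; rewrite /mu; field; rewrite !gt_eqF // expR_sub1_gt0.
rewrite !muE' //.
have := @derive_ge0_le R (fun s => (expR s - 1)^-1 - s^-1)
  (fun s => s ^- 2 - expR s / (expR s - 1) ^+ 2) y t yt.
move=> H; rewrite -subr_ge0.
have -> : y^-1 - (expR y - 1)^-1 - (t^-1 - (expR t - 1)^-1) =
  ((expR t - 1)^-1 - t^-1) - ((expR y - 1)^-1 - y^-1) by ring.
rewrite subr_ge0; apply: H => s /andP[ys _]; have s0 : 0 < s by lra.
  have := expR_sub1_gt0 s s0 => e0.
  by derive_auto; rewrite ?gt_eqF //; field; rewrite !gt_eqF.
have := expR_sub1_gt0 s s0 => e0.
rewrite subr_ge0 ler_pdivrMr ?exprn_gt0 // mulrC ler_pdivlMr ?exprn_gt0 //.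
set w := expR (s / 2).
have w0 : 0 < w by exact: expR_gt0.
have eE : expR s = w ^+ 2 by rewrite /w -expRM_natl; congr expR; field.
have wv : s * w <= w ^+ 2 - 1.
  rewrite -subr_ge0 /w.
  have := @derive_ge0_le R (fun s => expR (s / 2) ^+ 2 - 1 - s * expR (s / 2))
    (fun s => expR (s / 2) * (expR (s / 2) - 1 - s / 2)) 0 s (ltW s0).
  rewrite mul0r expR0 mul0r expr1n subrr subr0 => K; apply: K => r _.
    by derive_auto; rewrite /=; field.
  by rewrite mulr_ge0 ?expR_ge0 //; have := expR_ge1Dx (r / 2); lra.
rewrite eE -exprMn mulrC; apply: lerXn2r; rewrite ?nnegrE //.
- by rewrite mulr_ge0 // ltW.
- by rewrite -eE ltW.
Qed.

Lemma ratio_ge0 B y : 0 <= B -> 0 < y -> 0 <= B / (expR y - 1).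
Proof. by move=> B0 y0; rewrite divr_ge0 // ltW // expR_sub1_gt0. Qed.

(** Since [Psi] is increasing, [Lam B] increases or decreases at [y] according to whether the
    logarithm of the tilt [x] lies above or below [y]. *)
Lemma Lam_derive B y : 0 < B -> 0 < y ->
  let x := 1 + B / (expR y - 1) in
  is_derive y 1 (Lam B) ((1 - x^-1) * (Psi (ln x) - Psi y)).
Proof.
move=> B0 y0 x; rewrite /Lam.
have e0 := expR_sub1_gt0 y y0.
have b0 : 0 < B / (expR y - 1) by rewrite divr_gt0.
have x1 : 1 < x by rewrite /x; lra.
have xp : 0 < x by lra.
derive_auto.
- by rewrite -/x; lra.
- by rewrite gt_eqF.
rewrite -/x /Psi !expRN lnK ?posrE //.
have d1 : 1 - x^-1 != 0 by rewrite gt_eqF // subr_gt0 invf_lt1.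
rewrite [X in _ = _ * (X - _)](_ : _ = ln x * (1 - x^-1)^-1) // mulrBr.
rewrite [_ * (ln x * _)]mulrCA mulfV // mulr1 mul1r.
have ey : 0 < expR y by exact: expR_gt0.
have xE : x = (expR y - 1 + B) / (expR y - 1) by rewrite /x; field; rewrite gt_eqF.
rewrite xE; move: (ln _) => l; field.
by rewrite !gt_eqF //; lra.
Qed.

Lemma Lam_MVT B y t : 0 < B -> 0 < y <= t ->
  exists2 s, y <= s <= t & let x := 1 + B / (expR s - 1) in
    Lam B t - Lam B y = (1 - x^-1) * (Psi (ln x) - Psi s) * (t - y).
Proof.
move=> B0 /andP[y0 yt].
by apply: (MVT_le _ _ _ _ yt) => s /andP[ys _]; apply: Lam_derive => //; lra.
Qed.

(** For [B = (expR z - 1) ^ 2] the tilt [1 + B / (expR y - 1)] decreases in [y] and equals [expR z]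
    at [y = z]. *)
Lemma ratio_ge z y : 0 < y <= z -> expR z <= 1 + (expR z - 1) ^+ 2 / (expR y - 1).
Proof.
move=> /andP[y0 yz]; have ey := expR_sub1_gt0 y y0.
suff : expR z - 1 <= (expR z - 1) ^+ 2 / (expR y - 1) by lra.
rewrite ler_pdivlMr // expr2; apply: ler_wpM2l.
  by have := expR_ge1Dx z; lra.
by rewrite lerB // ler_expR.
Qed.

Lemma ratio_le z y : 0 < z <= y -> 1 + (expR z - 1) ^+ 2 / (expR y - 1) <= expR z.
Proof.
move=> /andP[z0 zy]; have ey := expR_sub1_gt0 y (lt_le_trans z0 zy).
suff : (expR z - 1) ^+ 2 / (expR y - 1) <= expR z - 1 by lra.
rewrite ler_pdivrMr // expr2; apply: ler_wpM2l.
  by have := expR_ge1Dx z; lra.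
by rewrite lerB // ler_expR.
Qed.

(** With this [B], [Lam B] peaks exactly at [z]: to the left of [z] the logarithm of the tilt is at
    least [z], hence at least the argument; to the right both inequalities are reversed. *)
Lemma Lam_incr z y t : 0 < y <= t -> t <= z ->
  Lam ((expR z - 1) ^+ 2) y <= Lam ((expR z - 1) ^+ 2) t.
Proof.
move=> /[dup] h /andP[y0 yt] tz; set B := _ ^+ 2.
have B0 : 0 < B by rewrite exprn_gt0 // expR_sub1_gt0 //; lra.
have [s /andP[ys st] /=] := Lam_MVT B y t B0 h.
have rz : expR z <= 1 + B / (expR s - 1) by apply: ratio_ge; lra.
set x := 1 + _ in rz *.
have x1 : 1 <= x by rewrite (le_trans _ rz) // -[leLHS]expR0 ler_expR; lra.
have lx : z <= ln x by rewrite -[leLHS]expRK ler_ln ?posrE ?expR_gt0 //; lra.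
move=> e; rewrite -subr_ge0 e mulr_ge0 ?subr_ge0 // mulr_ge0 //.
  by rewrite subr_ge0 invf_le1 //; lra.
by rewrite -subr_ge0 subr0; have := Psi_slope_ge s (ln x); lra.
Qed.

Lemma Lam_decr z y t : 0 < z <= y -> y <= t ->
  Lam ((expR z - 1) ^+ 2) t <= Lam ((expR z - 1) ^+ 2) y.
Proof.
move=> /andP[z0 zy] yt; set B := _ ^+ 2.
have B0 : 0 < B by rewrite exprn_gt0 // expR_sub1_gt0 //; lra.
have h : 0 < y <= t by lra.
have [s /andP[ys st] /=] := Lam_MVT B y t B0 h.
have rz : 1 + B / (expR s - 1) <= expR z by apply: ratio_le; lra.
have b0 : 0 < B / (expR s - 1) by rewrite divr_gt0 // expR_sub1_gt0; lra.
set x := 1 + _ in rz *.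
have x1 : 1 < x by rewrite /x; lra.
have lx : ln x <= z by rewrite -[leRHS]expRK ler_ln ?posrE ?expR_gt0 //; lra.
have lx0 : 0 < ln x by exact: ln_gt0.
move=> e; rewrite -subr_le0 e mulr_le0_ge0 ?subr_ge0 // mulr_ge0_le0 //.
  by rewrite subr_ge0 invf_le1 //; clear -x1; lra.
by have := Psi_slope_ge (ln x) s; lra.
Qed.

(** Quantitative form: [1 - x^-1 >= c / 2] because [x >= expR z], and
    [Psi (ln x) - Psi s >= (z - c) / 2] because [Psi] has slope at least 1/2. *)
Lemma Lam_incr_gap z c y : 0 < y <= c -> c <= z -> z <= 1 ->
  c / 2 * ((z - c) / 2) * (c - y) <= Lam ((expR z - 1) ^+ 2) c - Lam ((expR z - 1) ^+ 2) y.
Proof.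
move=> /[dup] h /andP[y0 yc] cz z1; set B := _ ^+ 2.
have B0 : 0 < B by rewrite exprn_gt0 // expR_sub1_gt0 //; lra.
have [s /andP[ys st] /= ->] := Lam_MVT B y c B0 h.
have rz : expR z <= 1 + B / (expR s - 1) by apply: ratio_ge; lra.
set x := 1 + _ in rz *.
have x1 : 1 <= x by rewrite (le_trans _ rz) // -[leLHS]expR0 ler_expR; lra.
have lx : z <= ln x by rewrite -[leLHS]expRK ler_ln ?posrE ?expR_gt0 //; lra.
apply: ler_wpM2r; first lra.
apply: ler_pM; [lra|lra| |]; last by have := Psi_slope_ge s (ln x); lra.
have : x^-1 <= expR (- z) by rewrite expRN lef_pV2 ?posrE ?expR_gt0 //; lra.
have := expRN_le z; nra.
Qed.

Lemma ln_ge_quad t : 0 <= t -> t - t ^+ 2 / 2 <= ln (1 + t).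
Proof.
move=> t0.
have := @derive_ge0_le R (fun t => ln (1 + t) - (t - t ^+ 2 / 2))
  (fun t => t ^+ 2 / (1 + t)) 0 t t0.
rewrite addr0 ln1 expr0n /= => H; rewrite -subr_ge0; apply: le_trans (H _ _); first lra.
  by move=> s /andP[s0 _]; derive_auto; [lra|rewrite /=; field; lra].
by move=> s /andP[s0 _]; rewrite divr_ge0 ?sqr_ge0 //; lra.
Qed.

(** Uses [t - t ^ 2 / 2 <= ln (1 + t) <= t] and [y / (expR y - 1) = 1 - mu y]: a gain linear in [B]
    at a quadratic cost, suited to small [B]. *)
Lemma Lam_gap_direct B c y : 0 < B -> 0 < y <= c ->
  B * (mu c - mu y) - B ^+ 2 / (2 * y) <= Lam B y - Lam B c.
Proof.
move=> B0 /andP[y0 yc].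
have c0 : 0 < c by lra.
have ey := expR_sub1_gt0 y y0; have ec := expR_sub1_gt0 c c0.
have hc : Lam B c <= B * (1 - mu c).
  have -> : B * (1 - mu c) = c * (B / (expR c - 1)).
    by rewrite /mu; field; rewrite gt_eqF.
  by rewrite /Lam ler_pM2l // le_ln1Dx //; have := divr_gt0 B0 ec; lra.
have hy : B * (1 - mu y) - B ^+ 2 / (2 * y) <= Lam B y.
  apply: le_trans (_ : y * (B / (expR y - 1) - (B / (expR y - 1)) ^+ 2 / 2) <= _); last first.
    by rewrite /Lam ler_pM2l // ln_ge_quad // divr_ge0 // ltW.
  have -> : y * (B / (expR y - 1) - (B / (expR y - 1)) ^+ 2 / 2) =
    B * (1 - mu y) - B ^+ 2 * (y / (2 * (expR y - 1) ^+ 2)).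
    by rewrite /mu; field; rewrite gt_eqF.
  rewrite lerD2l lerN2; apply: ler_wpM2l; first exact: sqr_ge0.
  rewrite ler_pdivrMr ?mulr_gt0 ?exprn_gt0 //.
  have -> : (2 * y)^-1 * (2 * (expR y - 1) ^+ 2) = (expR y - 1) ^+ 2 / y.
    by field; rewrite gt_eqF.
  rewrite ler_pdivlMr // -expr2.
  by apply: lerXn2r; rewrite ?nnegrE ?expR_sub1_ge // ltW.
lra.
Qed.

End TiltExponent.

Lemma half_bounds k : (2 * k./2 <= k <= (2 * k./2).+1)%N.
Proof.
by have := odd_double_half k; case: (odd k); lia.
Qed.

Lemma upper_poly_bound {R : realFieldType} (al c : R) : 0 < al -> al <= 1 -> 0 < c ->
  c <= 1 / 100 ->
  (1 + 4 * al) * ((1 + 32 * al) ^+ 2 * (1 + 77 * c) + 4 * al) <= 1 + 9700 * (al + c).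
Proof.
move=> al0 al1 c0 c1.
have aa : al * al <= al by rewrite ler_piMl // ltW.
have ac0 : 0 <= al * c by rewrite mulr_ge0 // ltW.
have ac1 : al * c <= al / 100.
  have : al * c <= al * (1 / 100) by rewrite ler_pM2l.
  lra.
have b1 : (1 + 32 * al) ^+ 2 <= 1 + 1088 * al by lra.
have b2 : (1 + 32 * al) ^+ 2 * (1 + 77 * c) <= (1 + 1088 * al) * (1 + 77 * c).
  by apply: ler_wpM2r => //; clear -c0; lra.
have b3 : (1 + 1088 * al) * (1 + 77 * c) + 4 * al <= 1 + 1931 * al + 77 * c by clear -ac0 ac1; lra.
apply: le_trans (_ : (1 + 4 * al) * (1 + 1931 * al + 77 * c) <= _).
  by apply: ler_wpM2l; clear -ac0 b3 b2; lra.
clear -c0 ac0 b1 b3; lra.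
Qed.

(** * Upper bound for [boxes] at [(k, k - 1)] *)

Section BoxesAsymptotics.
Context {R : realType}.
(** For [tau] about [1 / n], [k c ^ 2] is about the cube of [k / n^(2/3)]; so [A] stands for a
    quantity of order [k / n^(2/3)], and [A^-1] is the relative error. *)
Variables (tau : R) (k : nat) (A : R).
Hypotheses (tau0 : 0 < tau) (A1 : 1 <= A).
Let q := expR (- tau).
Let c := k%:R * tau.
Hypotheses (c1 : c <= 1 / 100) (Ac : A ^+ 3 <= 2 * (k%:R * c ^+ 2)).

Lemma expRN_tau01 : 0 < q < 1.
Proof. by rewrite /q expR_gt0 expR_lt1 oppr_lt0. Qed.

Lemma expRN_tauX N : q ^+ N = expR (- (N%:R * tau)).
Proof. by rewrite /q -expRM_natl mulrN. Qed.

Lemma expRN_tau_ratio N : (0 < N)%N -> q ^+ N / (1 - q ^+ N) = (expR (N%:R * tau) - 1)^-1.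
Proof.
move=> N0; rewrite expRN_tauX expRN.
have y0 : 0 < N%:R * tau by rewrite mulr_gt0 // ltr0n.
have := expR_sub1_gt0 _ y0; have := expR_gt0 (N%:R * tau).
move: (expR _) => e e0 e1; field.
by rewrite !gt_eqF.
Qed.

Lemma tilt_pow B N : 0 <= B -> (0 < N)%N ->
  tilt q B N ^+ N = expR (Lam B (N%:R * tau) / tau).
Proof.
move=> B0 N0; rewrite /tilt expRN_tau_ratio // /Lam.
have y0 : 0 < N%:R * tau by rewrite mulr_gt0 // ltr0n.
have := ratio_ge0 B (N%:R * tau) B0 y0; set x := B / _ => x0.
have -> : N%:R * tau * ln (1 + x) / tau = N%:R * ln (1 + x) by field; rewrite gt_eqF.
by rewrite expRM_natl lnK // posrE; lra.
Qed.

Lemma tilt_ratio B N : 0 <= B -> (0 < N)%N -> (0 < k)%N ->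
  tilt q B N ^+ N / tilt q B k ^+ k = expR ((Lam B (N%:R * tau) - Lam B c) / tau).
Proof. by move=> B0 N0 k0; rewrite !tilt_pow // -expRN -expRD -mulNr -mulrDl. Qed.

Lemma k_size : 0 < c /\ 100 <= k%:R :> R.
Proof.
have A3 : 1 <= A ^+ 3 by rewrite exprn_ege1.
have k0 : 0 <= k%:R :> R by [].
have c0 : 0 <= c by rewrite mulr_ge0 // ltW.
have h : 1 <= 2 * (k%:R * c ^+ 2) by exact: le_trans Ac.
have c0' : 0 < c.
  by rewrite lt_neqAle c0 andbT; apply/eqP => e; move: h; rewrite -e expr0n !mulr0; lra.
split=> //.
have : k%:R * c ^+ 2 <= k%:R * (1 / 100) ^+ 2.
  by apply: ler_wpM2l => //; apply: lerXn2r; rewrite ?nnegrE //; lra.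
lra.
Qed.

(** The diagonal condition of [boxes_le_lin] for [kap = tau]; it amounts to [1 + y <= expR y] at
    [y = N * tau]. *)
Lemma kap_admissible N : (0 < N)%N -> N%:R * tau * q ^+ N <= 1 - q ^+ N.
Proof.
move=> N0; rewrite expRN_tauX; set y := N%:R * tau.
have := expR_ge1Dx y => h; have := expRxMexpNx_1 y.
have := expR_gt0 (- y); have := expR_gt0 y; nra.
Qed.

Lemma lin_kk : (0 < k)%N -> lin q tau k k = mu c.
Proof. by move=> k0; rewrite /lin expRN_tau_ratio // /mu /c [tau * _]mulrC. Qed.

Lemma lin_NN N : (0 < N)%N -> lin q tau N N = mu (N%:R * tau).
Proof. by move=> N0; rewrite /lin expRN_tau_ratio // /mu [tau * _]mulrC. Qed.

(** [boxes_upper] with [s] half of [k], [kap = tau] and [eps = 4 / A]. The value at [(k, k - 1)] is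
    [mu c * (1 - 1 / tilt)], with [mu c] about [c / 2] and [tilt - 1] about [z ^ 2 / c], plus a term
    of relative order [1 / A]. *)
Lemma boxes_upper_asymp :
  boxes q k k.-1 <= (1 - q ^+ k) ^+ k.-1 * (c ^+ 2 / 2) * (1 + 9700 * (A^-1 + c)).
Proof.
have [c0 k4] := k_size.
have k0 : (0 < k)%N by rewrite -(ltr0n R); lra.
have A1x := A1; have c1x := c1; have A0 : 0 < A by lra.
set al := A^-1; have al0 : 0 < al by rewrite invr_gt0.
have al1 : al <= 1 by rewrite invf_le1.
have aA : A * al = 1 by rewrite mulfV // gt_eqF.
(* The peak lies slightly above [c], so that [Lam B] still increases on [(0, c]] with a slope of
   order at least [c * (z - c)]; the excess [32 / A] makes the exponential fall off fast enough down
   the diagonal. *)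
pose z := (1 + 32 * al) * c; pose B := (expR z - 1) ^+ 2.
have ac0 : 0 <= al * c by rewrite mulr_ge0 // ltW.
have ac1 : al * c <= c by rewrite ler_piMl // ltW.
have zE : z = c + 32 * (al * c) by rewrite /z; ring.
have z1 : z <= 1 by lra.
have cz : c <= z by lra.
have zc : z - c = 32 * al * c by rewrite /z; ring.
have B0 : 0 <= B by exact: sqr_ge0.
pose s := k./2.
have sk2 : 2 * s%:R <= (k%:R : R) <= 2 * s%:R + 1.
  by rewrite -natrM natr1 !ler_nat; exact: half_bounds.
have s0 : (0 < s)%N by rewrite -(ltr0n R); lra.
have sk : (s < k)%N by rewrite -(ltr_nat R); lra.
(* [w] is the relative distance to the top. By [Ac] the exponent drops by at least [4 A ^ 2 w], and
   [exp (- t) <= 1 / (1 + t)] makes this a rational bound. It beats [N / k = 1 - w] as long as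
   [w <= 3/4], whence the cut at half of [k]. *)
have gap N : (s <= N <= k)%N -> let w := 1 - N%:R / k%:R in
    [/\ 0 <= w, w <= 51 / 100 & tilt q B N ^+ N / tilt q B k ^+ k <= (1 + 4 * A ^+ 2 * w)^-1].
  move=> /andP[sN Nk] w; have N0 : (0 < N)%N by exact: leq_trans sN.
  have kR : 0 < k%:R :> R by clear -k4 tau0 A1 c1 Ac; lra.
  have NR : s%:R <= (N%:R : R) <= k%:R by rewrite !ler_nat sN.
  have w0 : 0 <= w by rewrite subr_ge0 ler_pdivrMr // mul1r; clear -NR tau0 A1 c1 Ac; lra.
  have w1 : w <= 51 / 100.
    have : 49 / 100 <= N%:R / k%:R :> R by rewrite ler_pdivlMr //; clear -k4 sk2 NR tau0 A1 c1 Ac; lra.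
    by rewrite /w; move: (N%:R / k%:R) => u; clear -tau0 A1 c1 Ac; lra.
  split=> //; rewrite tilt_ratio //.
  set y := N%:R * tau.
  have yE : c - y = c * w by rewrite /w /c /y; field; rewrite gt_eqF.
  have y0 : 0 < y by rewrite mulr_gt0 // ltr0n.
  have yc : y <= c by rewrite -subr_ge0 yE mulr_ge0 // ltW.
  have := Lam_incr_gap z c y; rewrite y0 yc => /(_ isT cz z1); rewrite -/B zc yE => h.
  have h2 : 4 * A ^+ 2 * w <= (Lam B c - Lam B y) / tau.
    apply: le_trans (_ : (c / 2 * (32 * al * c / 2) * (c * w)) / tau <= _); last first.
      by rewrite ler_pM2r // invr_gt0.
    have -> : c / 2 * (32 * al * c / 2) * (c * w) / tau = 4 * w * al * (2 * (k%:R * c ^+ 2)).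
      by rewrite /c; field; rewrite gt_eqF.
    have -> : 4 * A ^+ 2 * w = 4 * w * al * A ^+ 3.
      by rewrite exprS; transitivity (4 * w * A ^+ 2 * (A * al)); [rewrite aA|]; ring.
    by rewrite ler_wpM2l // mulr_ge0 ?(ltW al0) //; clear -w0 tau0 A1 c1 Ac; lra.
  have -> : (Lam B y - Lam B c) / tau = - ((Lam B c - Lam B y) / tau) by ring.
  rewrite expRN lef_pV2 ?posrE ?expR_gt0 //.
    by apply: le_trans (expR_ge1Dx _); clear -h2 tau0 A1 c1 Ac; lra.
  have : 0 <= A ^+ 2 * w by rewrite mulr_ge0 // sqr_ge0.
  clear -tau0 A1 c1 Ac; lra.
have mc0 := mu_ge0 c c0.
have muN N : (s <= N <= k)%N -> N%:R / k%:R * mu c <= mu (N%:R * tau).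
  move=> /andP[sN Nk]; have N0 : (0 < N)%N by exact: leq_trans sN.
  have := mu_over_id_decr (N%:R * tau) c.
  have -> : N%:R * tau / c = N%:R / k%:R by rewrite /c; field; rewrite !gt_eqF // ltr0n.
  by apply; rewrite mulr_gt0 ?ltr0n //= /c ler_pM2r // ler_nat.
have Xk0 : 0 < tilt q B k ^+ k by rewrite tilt_pow // expR_gt0.
have A2 : 1 <= A ^+ 2 by rewrite exprn_ege1.
apply: le_trans (boxes_upper q expRN_tau01 _ B (4 * al) s k _ B0 (ltW tau0) _ kap_admissible _ _) _.
- by rewrite s0.
- (clear -al0 tau0 A1 c1 Ac; lra).
- move=> N /andP[sN Nk]; have sNk : (s <= N <= k)%N by rewrite ltnW.
  have N0 : (0 < N)%N by exact: leq_ltn_trans sN.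
  rewrite lin_kk // lin_NN //.
  rewrite -ler_pdivrMr // -mulrA; apply: le_trans (muN N sNk); rewrite mulrC.
  apply: ler_wpM2r => //.
  have [w0 w1 h] := gap N sNk; apply: le_trans h _.
  move: w0 w1; set w := 1 - _ => w0 w1.
  have -> : N%:R / k%:R = 1 - w :> R by rewrite /w; ring.
  have d0 : 1 + 4 * w <= 1 + 4 * A ^+ 2 * w by clear -A2 w0 tau0 A1 c1 Ac; nra.
  have d1 : 0 < 1 + 4 * A ^+ 2 * w by clear -w0 d0 tau0 A1 c1 Ac; lra.
  rewrite -[leLHS]mul1r ler_pdivrMr //; clear -w0 w1 d0 tau0 A1 c1 Ac; nra.
- have sNk : (s <= s <= k)%N by rewrite leqnn ltnW.
  rewrite lin_kk // lin_NN // mulrA -ler_pdivrMr // -mulrA.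
  have [w0 w1 h] := gap s sNk.
  have sw : 5 / 10 <= 1 - s%:R / k%:R :> R.
    have : s%:R / k%:R <= 5 / 10 :> R by rewrite ler_pdivrMr; clear -sk2 k4 tau0 A1 c1 Ac; lra.
    by move: (s%:R / k%:R) => u; clear -tau0 A1 c1 Ac; lra.
  have X1 : tilt q B s ^+ s / tilt q B k ^+ k <= al / 3.
    apply: le_trans h _.
    have -> : al / 3 = (3 * A)^-1 by rewrite /al invfM mulrC.
    rewrite lef_pV2 ?posrE //; [(clear -A1x sw tau0 A1 c1 Ac; nra)|(clear -sw tau0 A1 c1 Ac; nra)|(clear -A0 tau0 A1 c1 Ac; lra)].
  have hm := muN s sNk.
  have t0 : 0 <= tilt q B s ^+ s / tilt q B k ^+ k.
    by rewrite divr_ge0 // ltW // tilt_pow // expR_gt0.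
  have : (1 + 4 * al) * mu c * (tilt q B s ^+ s / tilt q B k ^+ k) <=
    (1 + 4 * al) * mu c * (al / 3).
    by rewrite ler_wpM2l // mulr_ge0 //; clear -X1 t0 tau0 A1 c1 Ac; lra.
  have : 4 * al * (49 / 100 * mu c) <= 4 * al * mu (s%:R * tau).
    rewrite ler_wpM2l //; first (clear -X1 t0 tau0 A1 c1 Ac; lra).
    by apply: le_trans hm; rewrite ler_wpM2r //; clear -w1 tau0 A1 c1 Ac; lra.
  have : 0 <= mu c * al by rewrite mulr_ge0 // ltW.
  have : 0 <= mu c * al * (1 - al) by rewrite !mulr_ge0 // ?(ltW al0) //; clear -al1 tau0 A1 c1 Ac; lra.
  clear -tau0 A1 c1 Ac; lra.
have w0 := one_sub_expr_gt0 q expRN_tau01 k k0.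
rewrite -mulrA; apply: ler_wpM2l; first by rewrite exprn_ge0 // ltW.
rewrite lin_kk //.
(* One step off the diagonal adds [tau / (expR c - 1) <= 1 / k], which is at most [2 c ^ 2 / A]
   because [A <= A ^ 3 <= 2 k c ^ 2]. *)
have -> : lin q tau k k.-1 = mu c + tau / (expR c - 1).
  rewrite /lin expRN_tau_ratio // /mu -/c.
  have -> : k.-1%:R = k%:R - 1 :> R by rewrite -[in RHS](prednK k0) -natr1 addrK.
  have -> : tau * (k%:R - 1) = c - tau by rewrite /c; ring.
  by ring.
have ec := expR_sub1_ge c.
have e1 : tau / (expR c - 1) <= 2 * c ^+ 2 * al.
  apply: le_trans (_ : tau / c <= _).
    by rewrite ler_pM2l // lef_pV2 ?posrE //; clear -c0 ec tau0 A1 c1 Ac; lra.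
  rewrite ler_pdivrMr // /c.
  have : tau * A <= tau * (2 * (k%:R * c ^+ 2)).
    rewrite ler_pM2l //; apply: le_trans Ac.
    by rewrite -[leLHS]expr1 ler_weXn2l.
  have -> : 2 * (k%:R * tau) ^+ 2 * al * (k%:R * tau) = al * (tau * (2 * (k%:R * c ^+ 2))).
    by rewrite /c; ring.
  move=> h; have : al * (tau * A) <= al * (tau * (2 * (k%:R * c ^+ 2))) by rewrite ler_pM2l.
  by rewrite mulrCA [al * A]mulrC aA mulr1.
(* The main term: [mu c <= c / 2] times [1 - 1 / tilt <= B / (expR c - 1)], which is [c] up to
   factors [1 + O(1 / A + c)]. *)
have e2 : mu c - mu c / tilt q B k <= c ^+ 2 / 2 * ((1 + 32 * al) ^+ 2 * (1 + 77 * c)).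
  set x := tilt q B k.
  have xE : x = 1 + B / (expR c - 1) by rewrite /x /tilt expRN_tau_ratio.
  have r0 : 0 <= B / (expR c - 1) by exact: ratio_ge0.
  have x0 : 0 < x by rewrite xE; clear -r0 tau0 A1 c1 Ac; lra.
  have : 1 - x^-1 <= x - 1.
    have : x * x^-1 = 1 by rewrite mulfV // gt_eqF.
    have : 0 < x^-1 by rewrite invr_gt0.
    by clear -xE x0 tau0 A1 c1 Ac; nra.
  move=> hx.
  have rz : B / (expR c - 1) <= (1 + 32 * al) ^+ 2 * (1 + z) ^+ 2 * c.
    rewrite ler_pdivrMr; last (clear -c0 ec tau0 A1 c1 Ac; lra).
    have hz : expR z - 1 <= z * (1 + z).
      have /expR_le2 : 0 <= z <= 1 by rewrite z1 andbT; clear -ac1 cz zc tau0 A1 c1 Ac; lra.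
      by clear -tau0 A1 c1 Ac; lra.
    apply: le_trans (_ : (z * (1 + z)) ^+ 2 <= _).
      apply: lerXn2r; rewrite ?nnegrE //; last by clear -ac1 cz zc tau0 A1 c1 Ac; nra.
      by have := expR_sub1_ge z; clear -ac1 cz zc tau0 A1 c1 Ac; lra.
    have -> : (z * (1 + z)) ^+ 2 = (1 + 32 * al) ^+ 2 * (1 + z) ^+ 2 * c * c.
      by rewrite {1}/z; ring.
    apply: ler_wpM2l => //.
    by apply: mulr_ge0 (ltW c0); apply: mulr_ge0; exact: sqr_ge0.
  have z37 : (1 + z) ^+ 2 <= 1 + 77 * c.
    have z0 : 0 <= z by clear -ac1 cz zc tau0 A1 c1 Ac; lra.
    have : z * z <= z * (33 / 100) by apply: ler_wpM2l => //; clear -c1x ac1 zc tau0 A1 c1 Ac; lra.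
    have -> : (1 + z) ^+ 2 = 1 + 2 * z + z * z by ring.
    clear -ac1 zc z0 tau0 A1 c1 Ac; lra.
  have : mu c * (1 - x^-1) <= c / 2 * ((1 + 32 * al) ^+ 2 * (1 + 77 * c) * c).
    apply: ler_pM => //.
    - by rewrite subr_ge0 invf_le1 // xE; clear -r0 tau0 A1 c1 Ac; lra.
    - exact: mu_le.
    apply: le_trans hx _; rewrite xE addrAC subrr add0r.
    apply: le_trans rz _; rewrite ler_wpM2r ?(ltW c0) // ler_wpM2l ?sqr_ge0 //.
  rewrite mulrBr mulr1; clear -tau0 A1 c1 Ac; lra.
have : (1 + 4 * al) * (mu c + tau / (expR c - 1) - mu c / tilt q B k) <=
   (1 + 4 * al) * (c ^+ 2 / 2 * ((1 + 32 * al) ^+ 2 * (1 + 77 * c) + 4 * al)).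
  by apply: ler_wpM2l; clear -al0 e1 e2 tau0 A1 c1 Ac; lra.
move/le_trans; apply.
rewrite mulrCA ler_pM2l ?divr_gt0 ?exprn_gt0 //.
exact: upper_poly_bound.
Qed.

End BoxesAsymptotics.

(** * Matching lower bound for [boxes] at [(k, k - 1)] *)

Section BoxesLower.
Context {R : realType}.
Implicit Types (tau A : R) (k : nat).

(** [B] has the size belonging to a peak near [sqrt al * c / 2]. Then [B / (2 y)], the loss in
    [Lam_gap_direct] per unit of [B], stays below the gain [4/10 * (c - y)] down to [y = c * al],
    with [c * al / 10] to spare. *)
Lemma Lam_gap_low (B c al y : R) : 0 < al <= 1 / 100 -> 0 < c <= 1 / 100 ->
  al * c ^+ 2 / 4 <= B -> B <= 11 / 40 * (al * c ^+ 2) -> c * al <= y <= c - c * al ->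
  al / 40 * c ^+ 3 * al <= Lam B y - Lam B c.
Proof.
move=> /andP[al0 al1] /andP[c0 c1] Bl Br /andP[yl yr].
have ac0 : 0 < c * al by rewrite mulr_gt0.
have yp : 0 < y by lra.
have yc : y <= c by lra.
have hy : 0 < y <= c by rewrite yp.
have B0 : 0 < B by apply: lt_le_trans Bl; rewrite divr_gt0 ?mulr_gt0 ?exprn_gt0.
apply: le_trans (Lam_gap_direct B c y B0 hy).
have ms : 4 / 10 * (c - y) <= mu c - mu y by apply: mu_slope_ge => //; lra.
apply: le_trans (_ : B * (c * al / 10) <= _).
  have -> : al / 40 * c ^+ 3 * al = (al * c ^+ 2 / 4) * (c * al / 10) by field.
  by apply: ler_wpM2r => //; lra.
have -> : B * (mu c - mu y) - B ^+ 2 / (2 * y) = B * ((mu c - mu y) - B / (2 * y)).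
  by field; rewrite gt_eqF.
rewrite ler_pM2l //.
suff : B / (2 * y) <= 4 / 10 * (c - y) - c * al / 10 by lra.
rewrite ler_pdivrMr; last lra.
apply: le_trans Br _.
have h : 0 <= (y - c * al) * (c - c * al - y) by rewrite mulr_ge0; clear -ms yl yr; lra.
have h' : (c - y) * y = (y - c * al) * (c - c * al - y) + c * (c * al) - (c * al) ^+ 2.
  by ring.
have h1 : c * al * y <= c * al * c by rewrite ler_pM2l.
have h2 : (c * al) ^+ 2 <= c * (c * al) / 100.
  have -> : c * (c * al) / 100 = c * al * (c / 100) by ring.
  rewrite expr2 ler_pM2l // mulrC; have : al * c <= 1 / 100 * c by rewrite ler_pM2r.
  lra.
have -> : (4 / 10 * (c - y) - c * al / 10) * (2 * y) = 8 / 10 * ((c - y) * y) - c * al * y / 5.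
  by field.
have h3 : 0 <= c * (c * al) by rewrite mulr_ge0 // ltW.
rewrite h'; have -> : al * c ^+ 2 = c * (c * al) by ring.
have h4 : c * al * c = c * (c * al) by ring.
lra.
Qed.

(** The peak at [(1 - al) c] costs a factor [(1 - al) ^ 2] in [tilt - 1]; passing from [tilt - 1] to
    [1 - 1 / tilt] costs a further [1 - O(c)]. *)
Lemma survival_low (c al : R) : 0 < al <= 1 / 100 -> 0 < c <= 1 / 100 ->
  c * (1 - 2 * al - 2 * c) <=
  1 - (1 + (expR ((1 - al) * c) - 1) ^+ 2 / (expR c - 1))^-1.
Proof.
move=> /andP[al0 al1] /andP[c0 c1]; set z := (1 - al) * c; set B := _ ^+ 2.
have ec := expR_sub1_gt0 c c0.
have z0 : 0 <= z by rewrite mulr_ge0; lra.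
set rr := B / _.
have d1 : 0 < 1 + c by lra.
have e1 : expR c - 1 <= c * (1 + c).
  have /expR_le2 h : 0 <= c <= 1 by lra.
  by lra.
have zB : z ^+ 2 <= B.
  apply: lerXn2r; rewrite ?nnegrE ?expR_sub1_ge //.
  by have := expR_sub1_ge z; lra.
have rr1 : c * (1 - al) ^+ 2 / (1 + c) <= rr.
  rewrite /rr ler_pdivlMr // mulrAC ler_pdivrMr //.
  apply: le_trans (_ : z ^+ 2 * (1 + c) <= _); last by apply: ler_wpM2r => //; lra.
  have -> : z ^+ 2 * (1 + c) = c * (1 - al) ^+ 2 * (c * (1 + c)) by rewrite /z; ring.
  by apply: ler_wpM2l => //; rewrite mulr_ge0 ?sqr_ge0 // ltW.
move: rr rr1 => rr rr1.
have f0 : 0 <= c * (1 - al) ^+ 2 / (1 + c).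
  by apply: divr_ge0; [apply: mulr_ge0; [lra|exact: sqr_ge0]|lra].
have a1 : (1 - al) ^+ 2 <= 1 by nra.
have f1 : c * (1 - al) ^+ 2 / (1 + c) <= c.
  by rewrite ler_pdivrMr // ler_wpM2l ?(ltW c0) //; lra.
have f2 : c * (1 - 2 * al - c) <= c * (1 - al) ^+ 2 / (1 + c).
  by rewrite ler_pdivlMr // -mulrA ler_wpM2l ?(ltW c0) //; nra.
move: f0 f1 f2 rr1; set f := _ / (1 + c) => f0 f1 f2 rr1.
apply: le_trans (_ : f - f ^+ 2 <= _).
  have : f ^+ 2 <= c * c by rewrite expr2; apply: ler_pM.
  have -> : c * (1 - 2 * al - 2 * c) = c * (1 - 2 * al - c) - c * c by ring.
  lra.
have i1 : (1 + rr)^-1 <= (1 + f)^-1 by rewrite lef_pV2 ?posrE; clear -rr1 f0; lra.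
have i2 : (1 + f)^-1 <= 1 - f + f ^+ 2.
  rewrite -[leLHS]mul1r ler_pdivrMr; last lra.
  have -> : (1 - f + f ^+ 2) * (1 + f) = 1 + f ^+ 3 by ring.
  by rewrite lerDl exprn_ge0.
lra.
Qed.

Lemma lower_poly_bound (al c : R) : 0 < al <= 1 / 100 -> 0 < c <= 1 / 100 ->
  1 - 50 * (al + c) <= (1 - c / 2 - 4 * al) * (1 - 42 * al - 2 * c).
Proof.
move=> /andP[al0 al1] /andP[c0 c1].
have h1 : 0 <= al * c by rewrite mulr_ge0 // ltW.
have h2 : 0 <= al * al by rewrite mulr_ge0 // ltW.
have h3 : 0 <= c * c by rewrite mulr_ge0 // ltW.
lra.
Qed.

Lemma lin_low (y0 c al : R) : 0 < al <= 1 / 100 -> 0 < c <= 1 / 100 ->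
  0 < y0 <= 2 * (c * al) ->
  c / 2 * (1 - c / 2 - 4 * al) <= 1 - (expR y0 - 1) / y0 * (1 - mu c).
Proof.
move=> /andP[al0 al1] /andP[c0 c1] /andP[y00 y0r].
have ac1 : c * al <= 1 / 100 * (1 / 100) by apply: ler_pM; lra.
have h1 : (expR y0 - 1) / y0 <= 1 + y0.
  rewrite ler_pdivrMr //; have /expR_le2 : 0 <= y0 <= 1 by lra.
  by lra.
have h2 := mu_ge c c0; have h3 := mu_le c c0; have h5 := mu_ge0 c c0.
have : (expR y0 - 1) / y0 * (1 - mu c) <= (1 + y0) * (1 - mu c).
  by apply: ler_wpM2r => //; lra.
have h4 : y0 * (1 - mu c) <= y0 by apply: ler_piMr; lra.
have -> : c / 2 * (1 - c / 2 - 4 * al) = c / 2 - c ^+ 2 / 4 - 2 * (c * al) by field.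
lra.
Qed.

Lemma lower_final (m c al t t2 : R) : 0 < al <= 1 / 100 -> 0 < c <= 1 / 100 ->
  c / 2 * (1 - c / 2 - 4 * al) <= m -> c * (1 - 2 * al - 2 * c) <= 1 - t -> 1 - t2 <= c ->
  c ^+ 2 / 2 * (1 - 50 * (al + c)) <= m * (1 - t - 40 * al * (1 - t2)).
Proof.
move=> /andP[al0 al1] /andP[c0 c1] hm ht ht2.
have -> : c ^+ 2 / 2 * (1 - 50 * (al + c)) = (c / 2) * (c * (1 - 50 * (al + c))) by field.
apply: le_trans (_ : c / 2 * (1 - c / 2 - 4 * al) * (c * (1 - 42 * al - 2 * c)) <= _).
  have -> : c / 2 * (1 - c / 2 - 4 * al) * (c * (1 - 42 * al - 2 * c)) =
    c / 2 * (c * ((1 - c / 2 - 4 * al) * (1 - 42 * al - 2 * c))) by ring.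
  apply: ler_wpM2l; first lra.
  apply: ler_wpM2l; first lra.
  by apply: lower_poly_bound; rewrite ?al0 ?c0.
have h : 40 * al * (1 - t2) <= 40 * al * c by apply: ler_wpM2l; lra.
apply: ler_pM => //; [by rewrite mulr_ge0; (clear -h c0 al1 c1; lra)|by rewrite mulr_ge0; (clear -h c0 al1 c1; lra)|].
lra.
Qed.

(** The single exponential peaks at [z] slightly below [c], so it dominates on [[z, c]]; further
    down, to level [s] of about [k / A], a difference of two exponentials with coefficient [40 / A]
    takes over. At [(k, k - 1)] that difference costs at most [40 / A] times [c]. *)
Lemma boxes_lower_asymp tau k A : 0 < tau -> 100 <= A ->
  let q := expR (- tau) in let c := k%:R * tau in
  c <= 1 / 100 -> A ^+ 3 <= k%:R * c ^+ 2 ->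
  (1 - q ^+ k) ^+ k.-1 * (c ^+ 2 / 2) * (1 - 50 * (A^-1 + c)) <= boxes q k k.-1.
Proof.
move=> tau0 A100 q c c1 Ac.
have A1 : 1 <= A by lra.
have Ac2 : A ^+ 3 <= 2 * (k%:R * c ^+ 2).
  have : 0 <= k%:R * c ^+ 2 by rewrite mulr_ge0 ?sqr_ge0.
  lra.
have [c0 _] : 0 < c /\ 100 <= k%:R :> R := k_size tau k A tau0 A1 c1 Ac2.
have cE : c = k%:R * tau by [].
clearbody c.
have A0 : 0 < A by lra.
set al := A^-1; have al0 : 0 < al by rewrite invr_gt0.
have aA : A * al = 1 by rewrite mulfV // gt_eqF.
have al1 : al <= 1 / 100 by rewrite /al invf_ple ?posrE; lra.
have kA : A ^+ 3 <= k%:R.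
  apply: le_trans Ac _; rewrite -[leRHS]mulr1; apply: ler_wpM2l => //.
  by rewrite expr2; apply: mulr_ile1; lra.
have kA1 : 100 * A <= k%:R.
  apply: le_trans kA; rewrite exprSr; apply: ler_wpM2r; first lra.
  by rewrite expr2 -[leLHS]mulr1; apply: ler_pM; clear -A100 A1; lra.
have kR : 0 < k%:R :> R by lra.
have k0 : (0 < k)%N by rewrite -(ltr0n R).
have tau_small : tau <= c * al / 100.
  have -> : c * al / 100 = tau * (k%:R * al / 100) by rewrite cE; ring.
  rewrite ler_peMr // ?(ltW tau0) //.
  have : 100 * A * al <= k%:R * al by rewrite ler_pM2r.
  by rewrite -mulrA aA; lra.
have ac0 : 0 < c * al by rewrite mulr_gt0.
have ac1 : c * al <= c / 100 by nra.
(* The bottom level is the integer just above [k / A]: low enough that [lin] at [(k, k)], with the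
   [kap] tied to [s], is still [c / 2] up to a relative [O(1 / A + c)]. *)
have [s /andP[s1 s2]] : exists s : nat, k%:R * al <= s%:R <= k%:R * al + 1.
  exists (Num.truncn (k%:R * al)).+1.
  have h0 : 0 <= k%:R * al by rewrite mulr_ge0 // ltW.
  have /andP[h1 h2] := truncn_itv h0.
  by rewrite (ltW h2) -natr1 lerD2r h1.
have [y0 y0E] : exists y0, y0 = s%:R * tau by exists (s%:R * tau).
have y0l : c * al <= y0.
  have -> : c * al = k%:R * al * tau by rewrite cE; ring.
  by rewrite y0E ler_pM2r.
have y0r : y0 <= 2 * (c * al).
  apply: le_trans (_ : (k%:R * al + 1) * tau <= _); first by rewrite y0E ler_pM2r.
  have -> : (k%:R * al + 1) * tau = c * al + tau by rewrite cE; ring.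
  clear -tau_small ac0; lra.
have y00 : 0 < y0 by clear -ac0 y0l; lra.
have s0 : (0 < s)%N by rewrite lt0n; apply/eqP => e; move: y00; rewrite y0E e mul0r ltxx.
have sk : (s < k)%N.
  rewrite -(ltr_nat R) -(ltr_pM2r tau0) -y0E -cE; clear -ac1 y0r y00; lra.
(* Three peaks: [z] just below [c]; [z1], half the geometric mean of [c * al] and [c]; and [c]
   itself for [B2], so that the [B2] exponential never exceeds its value at the top. *)
pose z := (1 - al) * c; pose z1 := Num.sqrt al / 2 * c.
set r := Num.sqrt al in z1.
have r2 : r ^+ 2 = al by rewrite sqr_sqrtr // ltW.
have r0 : 0 < r by rewrite sqrtr_gt0.
have r1 : r <= 1 / 10 by clear -al1 r2; nra.
have zc : z = c - c * al by rewrite /z; ring.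
have z0 : 0 < z by clear -ac1 y0r y00 zc; lra.
have rc0 : 0 < r * c by rewrite mulr_gt0.
have rc1 : r * c <= c / 10 by clear -r0 r1 rc0; nra.
have z1E : z1 = r * c / 2 by rewrite /z1; ring.
have z10 : 0 < z1 by clear -rc0 z1E; lra.
have z1z : z1 <= z by clear -ac1 zc rc1 z1E z10; lra.
pose B := (expR z - 1) ^+ 2; pose B1 := (expR z1 - 1) ^+ 2; pose B2 := (expR c - 1) ^+ 2.
have B1l : al * c ^+ 2 / 4 <= B1.
  have -> : al * c ^+ 2 / 4 = z1 ^+ 2 by rewrite z1E -r2; field.
  apply: lerXn2r; rewrite ?nnegrE ?expR_sub1_ge //; first (clear -z10; lra).
  by have := expR_sub1_ge z1; clear -z10; lra.
have B1r : B1 <= 11 / 40 * (al * c ^+ 2).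
  apply: le_trans (_ : (z1 * (1 + z1)) ^+ 2 <= _).
    apply: lerXn2r; rewrite ?nnegrE //; last first.
      have /expR_le2 : 0 <= z1 <= 1 by clear -c1 rc1 z1E z10; lra.
      by rewrite -[z1 * _]/(z1 * (1 + z1)); clear -R; lra.
    - by rewrite mulr_ge0; clear -B1l z10; lra.
    - by have := expR_sub1_ge z1; clear -z10; lra.
  have -> : (z1 * (1 + z1)) ^+ 2 = (al * c ^+ 2) * ((1 + z1) ^+ 2 / 4).
    by rewrite exprMn {1}z1E -r2; field.
  rewrite mulrC; apply: ler_wpM2r; first by rewrite mulr_ge0 ?sqr_ge0 // ltW.
  clear -c1 rc1 z1E z10; nra.
have B10 : 0 < B1 by rewrite exprn_gt0 // expR_sub1_gt0.
have B12 : B1 <= B2.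
  apply: lerXn2r; rewrite ?nnegrE; first by have := expR_sub1_ge z1; clear -z10; lra.
    by have := expR_sub1_ge c; clear -rc1 z1E z10; lra.
  by rewrite lerD2r ler_expR; clear -rc1 z1E z10; lra.
pose kap := (expR y0 - 1) / s%:R.
have sR : 0 < s%:R :> R by rewrite ltr0n.
have kap0 : 0 <= kap.
  by rewrite divr_ge0 ?ltW //; have := expR_sub1_gt0 y0 y00; clear -R; lra.
have q01 : 0 < q < 1 := expRN_tau01 tau tau0.
have kaps : kap * s%:R * q ^+ s = 1 - q ^+ s.
  rewrite expRN_tauX -y0E /kap divfK ?gt_eqF //.
  by rewrite mulrBl mul1r expRxMexpNx_1.
have linN N : (0 < N)%N -> lin q kap N N = 1 - (expR y0 - 1) / y0 * (1 - mu (N%:R * tau)).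
  move=> N0; rewrite /lin expRN_tau_ratio // /mu /kap y0E.
  have y0N : 0 < N%:R * tau by rewrite mulr_gt0 // ltr0n.
  have := expR_sub1_gt0 _ y0N; move: (expR (N%:R * tau)) => e e0.
  by field; rewrite !gt_eqF.
have BE : B = (expR ((1 - al) * c) - 1) ^+ 2 by [].
have B1E : B1 = (expR z1 - 1) ^+ 2 by [].
have B2E : B2 = (expR c - 1) ^+ 2 by [].
have Bz : B = (expR z - 1) ^+ 2 by [].
clear rc0 rc1 r0 r1 tau_small kA kA1 A100 s1 s2.
clearbody z B B1 B2 kap al.
have ey0 : 0 <= (expR y0 - 1) / y0 by rewrite divr_ge0 ?ltW // expR_sub1_gt0.
have ylt N : (s <= N <= k)%N -> y0 <= N%:R * tau <= c.
  by move=> /andP[sN Nk]; rewrite y0E cE !ler_pM2r // !ler_nat sN.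
have mu_incr y : 0 < y <= c -> mu y <= mu c.
  move=> h; have := mu_slope_ge y c h; have : c <= 8 / 100 by clear -c1; lra.
  by move=> -> /(_ isT); clear -h; lra.
have hm' : c / 2 * (1 - c / 2 - 4 * al) <= lin q kap k k.
  rewrite linN // -cE.
  by apply: lin_low; rewrite ?al0 ?c0 ?y00.
have m0 : 0 <= lin q kap k k.
  by apply: le_trans hm'; rewrite mulr_ge0; clear -ey0 y0r y00 zc z10 z1z c1 al1; lra.
have gap1 y : y0 <= y <= z -> al / 40 * c ^+ 3 * al <= Lam B1 y - Lam B1 c.
  move=> /andP[yl yr]; apply: Lam_gap_low; rewrite ?al0 ?c0 //.
  by rewrite -zc yr (le_trans y0l yl).
have Xge1 y : z <= y <= c -> 1 <= expR ((Lam B y - Lam B c) / tau).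
  move=> /andP[yl yr]; rewrite -[leLHS]expR0 ler_expR divr_ge0 ?(ltW tau0) // subr_ge0.
  by rewrite Bz; apply: Lam_decr; rewrite ?z0.
have X1ge1 y : y0 <= y <= c -> 1 <= expR ((Lam B1 y - Lam B1 c) / tau).
  move=> /andP[yl yr]; rewrite -[leLHS]expR0 ler_expR divr_ge0 ?(ltW tau0) //.
  have [yz|zy] := leP y z.
    by apply: le_trans (gap1 y _); rewrite ?yl // !mulr_ge0 ?exprn_ge0 // ltW.
  by rewrite subr_ge0 B1E; apply: Lam_decr; rewrite // z10 (le_trans z1z) // ltW.
have X2le1 y : 0 < y <= c -> expR ((Lam B2 y - Lam B2 c) / tau) <= 1.
  move=> h; rewrite -[leRHS]expR0 ler_expR pmulr_lle0 ?invr_gt0 // subr_le0 B2E.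
  exact: Lam_incr.
have B0' : 0 <= B by rewrite Bz sqr_ge0.
have B20 : 0 <= B2 by rewrite B2E sqr_ge0.
apply: le_trans (boxes_lower q q01 kap B B1 B2 (40 * al) s k _ B0' _ _ kap0 kaps _ m0 _ _).
- have w0 := one_sub_expr_gt0 q q01 k k0.
  rewrite -mulrA; apply: ler_wpM2l; first by rewrite exprn_ge0 // ltW.
  have tk B' : 0 <= B' -> tilt q B' k = 1 + B' / (expR c - 1).
    by move=> _; rewrite /tilt expRN_tau_ratio // -cE.
  have ec := expR_sub1_gt0 c c0.
  have b2 : 1 - (tilt q B2 k)^-1 <= c.
    rewrite tk // B2E expr2 mulfK ?gt_eqF // addrCA subrr addr0 -expRN.
    by have := expR_ge1Dx (- c); clear -R; lra.
  have b1 : c * (1 - 2 * al - 2 * c) <= 1 - (tilt q B k)^-1.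
    by rewrite tk // BE; apply: survival_low; rewrite ?al0 ?c0.
  by apply: lower_final; rewrite ?al0 ?c0.
- by rewrite s0.
- by rewrite (ltW B10).
- (clear -al0; lra).
- move=> N /andP[sN Nk]; have N0 : (0 < N)%N by exact: leq_ltn_trans sN.
  rewrite !linN // lerD2l lerN2; apply: ler_wpM2l => //.
  rewrite lerD2l lerN2 -cE; apply: mu_incr.
  have := ylt N; rewrite (ltnW sN) Nk => /(_ isT) /andP[y1 ->].
  by rewrite (lt_le_trans y00 y1).
- move=> N /[dup] h /andP[sN Nk]; have N0 : (0 < N)%N by exact: leq_trans sN.
  rewrite !tilt_ratio // ?(ltW B10) // -cE; have /andP[y1 y2] := ylt N h.
  by apply: le_trans (X2le1 _ _) (X1ge1 _ _); rewrite ?y1 ?y2 // (lt_le_trans y00 y1).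
- move=> N /andP[sN Nk]; have N0 : (0 < N)%N by exact: leq_ltn_trans sN.
  rewrite !tilt_ratio // ?(ltW B10) // -cE; have := ylt N; rewrite (ltnW sN) Nk => /(_ isT).
  move: (N%:R * tau) => y /andP[y1 y2].
  have yp : 0 < y <= c by rewrite (lt_le_trans y00 y1).
  have X2 := X2le1 y yp.
  have yc : y0 <= y <= c by rewrite y1.
  have X1 := X1ge1 y yc.
  (* Above [z] the first exponential is at least 1 and the difference is nonnegative. Up to [z] the
     [B1] ratio is at least [1 + A / 40] and the [B2] ratio at most 1, so the coefficient [40 / A]
     gives 1. *)
  have [yz|zy] := leP y z; last first.
    have := Xge1 y; rewrite y2 (ltW zy) => /(_ isT) /le_trans; apply.
    rewrite lerDl; apply: mulr_ge0; first by rewrite mulr_ge0 // ltW.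
    by rewrite subr_ge0 (le_trans X2).
  have g : A / 40 <= (Lam B1 y - Lam B1 c) / tau.
    apply: le_trans (_ : al / 40 * c ^+ 3 * al / tau <= _); last first.
      by rewrite ler_pM2r ?invr_gt0 // gap1 // y1.
    have -> : al / 40 * c ^+ 3 * al / tau = al ^+ 2 / 40 * (k%:R * c ^+ 2).
      by rewrite cE; field; rewrite gt_eqF.
    have -> : A / 40 = al ^+ 2 / 40 * A ^+ 3.
      transitivity (A / 40 * (A * al) ^+ 2); first by rewrite aA expr1n mulr1.
      by field.
    by apply: ler_wpM2l => //; rewrite divr_ge0 ?sqr_ge0.
  have e1 : 1 + A / 40 <= expR ((Lam B1 y - Lam B1 c) / tau).
    by apply: le_trans (expR_ge1Dx _); rewrite lerD2l.
  rewrite -[leLHS]add0r; apply: lerD; first exact: expR_ge0.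
  rewrite [leLHS](_ : 1 = 40 * al * (A / 40)); last by rewrite -[LHS]aA; field.
  apply: ler_wpM2l; first by rewrite mulr_ge0 // ltW.
  by rewrite lerBrDr addrC; apply: le_trans e1; rewrite lerD2r.
Qed.

End BoxesLower.

(** * The law of the component size *)

Section RandomSubset.
Context {R : comPzRingType} {T : finType}.
Implicit Types (p : R) (E G : {set T}) (F : {set T} -> R).

Definition subset_mean p E F : R :=
  \sum_(G in powerset E) p ^+ #|G| * (1 - p) ^+ (#|E| - #|G|) * F G.

Lemma eq_subset_mean p E F F' : (forall G, G \subset E -> F G = F' G) ->
  subset_mean p E F = subset_mean p E F'.
Proof. by move=> FF'; apply: eq_bigr => G; rewrite powersetE => /FF' ->. Qed.

Lemma subset_mean_card p E (f : nat -> R) :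
  subset_mean p E (fun G => f #|G|) =
  \sum_(b < #|E|.+1) ('C(#|E|, b))%:R * p ^+ b * (1 - p) ^+ (#|E| - b) * f b.
Proof.
rewrite /subset_mean.
rewrite (partition_big (fun G => inord #|G| : 'I_(#|E|.+1)) xpredT) //=.
apply: eq_bigr => b _.
rewrite (eq_bigr (fun=> p ^+ b * (1 - p) ^+ (#|E| - b) * f b)); last first.
  move=> G /andP[]; rewrite powersetE => GE /eqP <-.
  by rewrite inordK // ltnS subset_leq_card.
rewrite sumr_const -[LHS]mulr_natl -!mulrA; congr (_ * _); congr (_%:R).
rewrite -cards_draws; apply: eq_card => G; rewrite !inE unfold_in powersetE.
case: (boolP (G \subset E)) => //= GE.
by rewrite -val_eqE /= inordK // ltnS subset_leq_card.
Qed.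

Lemma subset_mean_cst p E (a : R) : subset_mean p E (fun=> a) = a.
Proof.
rewrite (subset_mean_card p E (fun=> a)) -mulr_suml.
rewrite [X in X * _ = _](_ : _ = 1) ?mul1r //.
rewrite -[RHS](expr1n _ #|E|) -[in RHS](subrK p 1) exprDn; apply: eq_bigr => b _.
by rewrite -[RHS]mulr_natl; ring.
Qed.

(** Disjoint blocks are sampled independently, so the mean is an iterated mean. *)
Lemma subset_mean_setU p (E1 E2 : {set T}) F : [disjoint E1 & E2] ->
  subset_mean p (E1 :|: E2) F =
  subset_mean p E1 (fun G1 => subset_mean p E2 (fun G2 => F (G1 :|: G2))).
Proof.
move=> dE; rewrite /subset_mean.
under [RHS]eq_bigr do rewrite mulr_sumr.
rewrite pair_big /=.
rewrite (reindex_onto (fun H : {set T} * {set T} => H.1 :|: H.2)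
  (fun G => (G :&: E1, G :&: E2))) /=; last first.
  by move=> G; rewrite powersetE => GE; rewrite -finset.setIUr; apply/finset.setIidPl.
have I12 : E1 :&: E2 = finset.set0 by apply/eqP; rewrite finset.setI_eq0.
have aux (H1 H2 : {set T}) : H1 \subset E1 -> H2 \subset E2 ->
    ((H1 :|: H2) :&: E1 = H1) * ((H1 :|: H2) :&: E2 = H2).
  move=> s1 s2; rewrite !finset.setIUl (finset.setIidPl s1) (finset.setIidPl s2); split.
    suff -> : H2 :&: E1 = finset.set0 by rewrite finset.setU0.
    by apply/eqP; rewrite -finset.subset0 -I12 finset.setIC finset.setIS.
  suff -> : H1 :&: E2 = finset.set0 by rewrite finset.set0U.
  by apply/eqP; rewrite -finset.subset0 -I12 finset.setSI.
apply: eq_big => [[H1 H2]|[H1 H2]] /=; rewrite !powersetE.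
  apply/andP/andP => [[_ /eqP[<- <-]]|[s1 s2]]; first by rewrite !finset.subsetIr.
  by rewrite finset.setUSS // !aux.
move=> /andP[_ /eqP[e1 e2]].
have s1 : H1 \subset E1 by rewrite -e1 finset.subsetIr.
have s2 : H2 \subset E2 by rewrite -e2 finset.subsetIr.
have dH : [disjoint H1 & H2].
  by apply: disjointWl s1 _; apply: disjointWr s2 _.
have cU (A B : {set T}) : [disjoint A & B] -> #|A :|: B| = (#|A| + #|B|)%N.
  by move=> dAB; have [_] := leq_card_setU A B; rewrite dAB => /eqP.
rewrite !cU //.
have -> : (#|E1| + #|E2| - (#|H1| + #|H2|) = (#|E1| - #|H1|) + (#|E2| - #|H2|))%N.
  have := subset_leq_card s1; have := subset_leq_card s2.
  move: (#|E1|) (#|E2|) (#|H1|) (#|H2|); clear; lia.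
by rewrite !exprD; ring.
Qed.

End RandomSubset.

Lemma subset_mean_imset {R : comPzRingType} {T T' : finType} (f : T -> T') (p : R)
    (E : {set T}) (F : {set T'} -> R) : injective f ->
  subset_mean p (f @: E) F = subset_mean p E (fun G => F (f @: G)).
Proof.
move=> fI; rewrite /subset_mean.
rewrite (reindex_onto (fun G : {set T} => f @: G) (fun H => f @^-1: H)) /=; last first.
  move=> H; rewrite powersetE => /fintype.subsetP HE.
  apply/setP => y; apply/imsetP/idP => [[x + ->]|yH]; first by rewrite inE.
  by have /imsetP[x xE e] := HE y yH; exists x; rewrite // inE -e.
have fK (G : {set T}) : f @^-1: (f @: G) = G.
  by apply/setP => x; rewrite inE mem_imset.
apply: eq_big => [G|G _]; last by rewrite !card_imset.
rewrite !powersetE fK eqxx andbT; apply/idP/idP => [s|]; last exact: imsetS.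
by have := finset.preimsetS f s; rewrite !fK.
Qed.

Lemma connect_closed (T : finType) (e : rel T) (S : {set T}) x y :
  (forall x y, x \in S -> e x y -> y \in S) -> connect e x y -> x \in S -> y \in S.
Proof.
move=> Se /connectP[s + ->]; elim: s x => [|z s IH] x //= /andP[exz ps] xS.
by apply: IH ps _; apply: Se exz.
Qed.

(** * Graph exploration and the exact law of the component size *)

Section Exploration.
Variable n : nat.
Implicit Types (x y u v : 'I_n) (A B C U V : {set 'I_n}) (G : {set 'I_n * 'I_n}).

(** The code of an unordered pair in [pairs n], smaller endpoint first. *)
Definition edge x y : 'I_n * 'I_n := if (x < y)%N then (x, y) else (y, x).

Lemma edge_inj x : injective (edge x).
Proof.
move=> y z; rewrite /edge; case: ifP => xy; case: ifP => xz [] //.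
- by move=> e1 e2; rewrite e2 -e1.
- by move=> e1 e2; rewrite e1 -e2.
Qed.

Lemma edgeC x y : edge x y = edge y x.
Proof. by rewrite /edge; case: ltngtP => // /val_inj ->. Qed.

Lemma edge_pairs x y : x != y -> edge x y \in pairs n.
Proof.
rewrite -val_eqE neq_ltn /edge inE; case: ifP => [-> //|xy] /=.
by [].
Qed.

Lemma pairs_edge (e : 'I_n * 'I_n) : e \in pairs n -> e = edge e.1 e.2.
Proof. by rewrite inE /edge; case: e => x y /= ->. Qed.

Lemma adjG_edge G x y : G \subset pairs n -> adjG G x y = (x != y) && (edge x y \in G).
Proof.
move=> /fintype.subsetP GE; rewrite /adjG.
have h a b : (a, b) \in G -> (a < b)%N by move/GE; rewrite inE.
rewrite /edge -val_eqE; case: (ltngtP x y) => //= xy.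
- by rewrite orbC; case: (boolP ((y, x) \in G)) => // /h /=; rewrite ltnNge ltnW.
- by case: (boolP ((x, y) \in G)) => // /h /=; rewrite ltnNge ltnW.
- by apply/norP; split; apply/negP => /h /=; rewrite xy ltnn.
Qed.

Definition pairs_in V : {set 'I_n * 'I_n} :=
  [set e in pairs n | (e.1 \in V) && (e.2 \in V)].

(** Only the endpoint of a step must lie in [U]: a path may start at an active vertex but then stays
    among the undiscovered ones. *)
Definition into U G : rel 'I_n := fun x y => adjG G x y && (y \in U).

Definition reached A U G : {set 'I_n} :=
  [set w in U | [exists a in A, connect (into U G) a w]].

Lemma reached0 U G : reached finset.set0 U G = finset.set0.
Proof.
by apply/setP => w; rewrite !inE; apply/negP => /andP[_ /existsP[a]]; rewrite inE.
Qed.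

Lemma pairs_inU1 x V : x \notin V -> pairs_in (x |: V) = edge x @: V :|: pairs_in V.
Proof.
move=> xV; apply/setP => e; rewrite finset.in_setU; apply/idP/orP.
  rewrite !inE => /andP[e12 /andP[]].
  have eE : e = edge e.1 e.2 by rewrite -pairs_edge // inE.
  case/predU1P => [e1|e1]; case/predU1P => [e2|e2].
  - by move: e12; rewrite e1 e2 ltnn.
  - by left; rewrite eE e1; apply: imset_f.
  - by left; rewrite eE edgeC e2; apply: imset_f.
  - by right; rewrite e12 e1 e2.
case=> [/imsetP[u uV ->]|].
  have xu : x != u by apply: contraNneq xV => ->.
  rewrite inE edge_pairs //= /edge; case: ifP => _ /=; by rewrite !inE uV eqxx ?orbT.
by rewrite !inE => /andP[-> /andP[-> ->]]; rewrite !orbT.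
Qed.

Lemma disjoint_star x V : x \notin V -> [disjoint edge x @: V & pairs_in V].
Proof.
move=> xV; rewrite disjoint_subset; apply/fintype.subsetP => e /imsetP[u uV ->].
rewrite !inE /edge; case: ifP => _ /=; by rewrite (negbTE xV) ?andbF.
Qed.

(** One exploration step: the edges from [x] to [U] make [B] active, the edges to [C] join vertices
    that are already active, and all other edges lie inside [A :|: U]. *)
Lemma reached_step x A U B C G : x \notin A -> x \notin U -> [disjoint A & U] ->
  B \subset U -> C \subset A -> G \subset pairs_in (A :|: U) ->
  reached (x |: A) U ((edge x @: B :|: edge x @: C) :|: G) =
  B :|: reached (A :|: B) (U :\: B) G.
Proof.
move=> xA xU dAU BU CA GV; set H := _ :|: G.
have GP : G \subset pairs n.
  by apply: fintype.subset_trans GV _; apply/fintype.subsetP => e; rewrite inE => /andP[].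
have UA u : u \in U -> u \notin A by move=> uU; apply: contraTN uU => uA; rewrite (disjointFr dAU).
have neU u : u \in U -> x != u by move=> uU; apply: contraNneq xU => ->.
have neA u : u \in A -> x != u by move=> uA; apply: contraNneq xA => ->.
have Bu u : u \in B -> u \in U by apply: (fintype.subsetP BU).
have Cu u : u \in C -> u \in A by apply: (fintype.subsetP CA).
have HP : H \subset pairs n.
  apply/fintype.subsetP => e; rewrite !finset.in_setU => /orP[/orP[]|].
  - by move=> /imsetP[u /Bu /neU xu ->]; exact: edge_pairs.
  - by move=> /imsetP[u /Cu /neA xu ->]; exact: edge_pairs.
  - exact: (fintype.subsetP GP).
have xG u : edge x u \notin G.
  apply/negP => /(fintype.subsetP GV); rewrite inE => /andP[_].
  by rewrite /edge; case: ifP => _ /= /andP[]; rewrite !inE (negbTE xA) (negbTE xU).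
have adjx u : u \in U -> adjG H x u = (u \in B).
  move=> uU; rewrite adjG_edge // neU //= !finset.in_setU (negbTE (xG u)) orbF.
  rewrite !(mem_imset _ _ (@edge_inj x)).
  by case: (boolP (u \in C)) => [/Cu|_]; rewrite ?orbF // (negbTE (UA u uU)).
have edge_neq y z u : y != x -> z != x -> edge y z != edge x u.
  rewrite /edge => yx zx; apply/negP => /eqP; case: ifP => _; case: ifP => _ [] e1 e2.
  - by rewrite e1 eqxx in yx.
  - by rewrite e2 eqxx in zx.
  - by rewrite e1 eqxx in zx.
  - by rewrite e2 eqxx in yx.
have adjn y z : y != x -> z != x -> adjG H y z = adjG G y z.
  move=> yx zx; rewrite !adjG_edge //; congr (_ && _); rewrite !finset.in_setU.
  rewrite [X in X || _](_ : _ = false) //; apply/negP => /orP[]/imsetP[u _ /eqP];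
    by rewrite (negbTE (edge_neq _ _ _ yx zx)).
have xU' u : u \in U -> u != x by rewrite eq_sym; exact: neU.
have xA' u : u \in A -> u != x by rewrite eq_sym; exact: neA.
have sub y z : y != x -> into (U :\: B) G y z -> into U H y z.
  rewrite /into !inE => yx /andP[yz /andP[_ zU]].
  by rewrite zU adjn // ?yz // xU'.
have subc y z : y != x -> connect (into (U :\: B) G) y z -> connect (into U H) y z.
  move=> + /connectP[s + ->]; elim: s y => [|w s IH] y yx //= /andP[yw ps].
  have e1 := sub _ _ yx yw.
  apply: connect_trans (connect1 e1) _; apply: IH ps.
  by apply: xU'; case/andP: e1.
apply/setP => w; apply/idP/idP; last first.
  rewrite finset.in_setU => /orP[wB|].
    rewrite inE Bu //=; apply/existsP; exists x; rewrite finset.setU11 /=.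
    by apply: connect1; rewrite /into adjx ?Bu // wB.
  rewrite !inE => /andP[/andP[wB wU] /existsP[a /andP[+ aw]]].
  rewrite wU inE => /orP[aA|aB].
    by apply/existsP; exists a; rewrite !inE aA orbT /= subc // xA'.
  apply/existsP; exists x; rewrite finset.setU11 /=.
  apply: connect_trans (_ : connect _ x a) _.
    by apply: connect1; rewrite /into adjx ?Bu // aB.
  by apply: subc aw; apply: xU'; apply: Bu.
rewrite inE => /andP[wU /existsP[a /andP[aA aw]]].
(* [S] joins the active vertices to the claimed reached set. It is closed under [into U H], so it
   contains [w], and [w] in [U] excludes the active part. *)
set S := (x |: A) :|: (B :|: reached (A :|: B) (U :\: B) G).
suff : w \in S.
  rewrite /S finset.in_setU => /orP[|//]; rewrite !inE => /orP[/eqP wx|].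
    by move: xU; rewrite -wx wU.
  by rewrite (negbTE (UA w wU)).
apply: connect_closed aw _; last by rewrite finset.in_setU aA.
move=> y z yS /andP[yz zU]; rewrite finset.in_setU; apply/orP; right; rewrite finset.in_setU.
case: (boolP (z \in B)) => //= zB.
have zx := xU' z zU.
have zUB : z \in U :\: B by rewrite inE zB.
have yx : y != x.
  by apply/negP => /eqP yx'; move: zB; rewrite -(adjx z zU) -yx' yz.
rewrite inE zUB /=.
have yzG : adjG G y z by rewrite -adjn.
have yzI : into (U :\: B) G y z by rewrite /into yzG.
move: yS; rewrite /S !finset.in_setU finset.in_set1 (negbTE yx) /= => /orP[yA|/orP[yB|]].
- by apply/existsP; exists y; rewrite finset.in_setU yA connect1.
- by apply/existsP; exists y; rewrite finset.in_setU yB orbT connect1.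
rewrite inE => /andP[_ /existsP[b /andP[bA bY]]].
by apply/existsP; exists b; rewrite bA (connect_trans bY) // connect1.
Qed.

Lemma comp_size_reached G v : comp_size G v = #|reached [set v] (~: [set v]) G|.+1.
Proof.
rewrite /comp_size.
suff -> : [set w | connect (adjG G) v w] = v |: reached [set v] (~: [set v]) G.
  by rewrite cardsU1 !inE eqxx.
apply/setP => w; rewrite inE; apply/idP/idP => [vw|].
  apply: connect_closed vw _; last exact: finset.setU11.
  move=> y z yS yz; rewrite finset.in_setU1; case: (eqVneq z v) => //= zv.
  have I : into (~: [set v]) G y z by rewrite /into yz !inE.
  rewrite !inE zv /=; apply/existsP; exists v; rewrite inE eqxx /=.
  move: yS; rewrite !inE => /predU1P[yv|]; first by rewrite yv in I; apply: connect1.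
  move=> /andP[_ /existsP[a /andP[]]]; rewrite inE => /eqP -> vy.
  by apply: connect_trans vy (connect1 I).
rewrite !inE => /predU1P[-> //|/andP[_ /existsP[a /andP[]]]]; rewrite inE => /eqP ->.
by apply: connect_sub => y z /andP[yz _]; apply: connect1.
Qed.

(** Double counting of a [b]-subset inside a [j]-subset; for [j > m] both sides vanish. *)
Lemma bin_mul_sub m j b : (b <= j)%N ->
  ('C(m, b) * 'C(m - b, j - b) = 'C(m, j) * 'C(j, b))%N.
Proof.
move=> bj; have [jm|mj] := leqP j m; last first.
  rewrite (bin_small mj) mul0n; have [mb|bm] := ltnP m b; first by rewrite bin_small.
  by rewrite ['C(m - b, _)]bin_small ?muln0 // ltn_sub2r // (leq_ltn_trans bm).
have bm := leq_trans bj jm.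
apply/eqP; rewrite -(@eqn_pmul2r (b`! * ((j - b)`! * (m - j)`!))); last first.
  by rewrite !muln_gt0 !fact_gt0.
have e1 := bin_fact (leq_sub2r b jm).
have e0 : (m - b - (j - b) = m - j)%N by rewrite subnBA // subnK.
rewrite e0 in e1.
have -> : ('C(m, b) * 'C(m - b, j - b) * (b`! * ((j - b)`! * (m - j)`!)) =
  'C(m, b) * (b`! * ('C(m - b, j - b) * ((j - b)`! * (m - j)`!))))%N.
  by rewrite -!mulnA; congr muln; rewrite mulnCA.
rewrite e1 bin_fact //.
have -> : ('C(m, j) * 'C(j, b) * (b`! * ((j - b)`! * (m - j)`!)) =
  'C(m, j) * ('C(j, b) * (b`! * (j - b)`!) * (m - j)`!))%N.
  by rewrite -!mulnA.
by rewrite bin_fact // bin_fact.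
Qed.

(** The induction step of [reached_law], summed over the number [b] of newly discovered vertices:
    [bin_mul_sub] pulls out [C(m, j)], the powers of [1 - p] combine, and what is left is [thin]. *)
Lemma exploration_sum {R : realFieldType} (p : R) (a m j : nat) :
  \sum_(b < m.+1) ('C(m, b))%:R * p ^+ b * (1 - p) ^+ (m - b) *
    (if (b <= j)%N then
      ('C(m - b, j - b))%:R * (1 - p) ^+ ((a + j) * (m - j)) * boxes (1 - p) (a + j) (j - b)
     else 0) =
  ('C(m, j))%:R * (1 - p) ^+ ((a.+1 + j) * (m - j)) * boxes (1 - p) (a.+1 + j) j.
Proof.
have [mj|jm] := ltnP m j.
  rewrite (bin_small mj) !mul0r; apply: big1 => b _; case: ifP => [bj|_]; last by rewrite mulr0.
  have := congr1 (fun w : nat => w%:R : R) (bin_mul_sub m j b bj).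
  rewrite (bin_small mj) mul0n natrM => e.
  transitivity (('C(m, b)%:R * 'C(m - b, j - b)%:R) * (p ^+ b * (1 - p) ^+ (m - b) *
    (1 - p) ^+ ((a + j) * (m - j)) * boxes (1 - p) (a + j) (j - b))); first by ring.
  by rewrite e mul0r.
rewrite addSn /= leq_addl /thin.
pose g b := ('C(m, b))%:R * p ^+ b * (1 - p) ^+ (m - b) * (if (b <= j)%N then
  ('C(m - b, j - b))%:R * (1 - p) ^+ ((a + j) * (m - j)) * boxes (1 - p) (a + j) (j - b)
  else 0).
rewrite (_ : \sum_(b < m.+1) _ = \sum_(0 <= b < m.+1) g b); last by rewrite big_mkord.
rewrite (big_cat_nat _ (n := j.+1)) //= [X in _ + X]big1_seq ?addr0; last first.
  by move=> b /andP[_]; rewrite mem_index_iota /g => /andP[jb _]; rewrite leqNgt jb /= mulr0.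
(* Reversing the sum counts by [i = j - b], the vertices still undiscovered, which is the index of
   [thin]. *)
rewrite big_mkord (reindex_inj rev_ord_inj) /= mulr_sumr.
apply: eq_bigr => i _; rewrite /g subSS leq_subr.
have ij : (i <= j)%N by rewrite -ltnS.
have e := congr1 (fun w : nat => w%:R : R) (bin_mul_sub m j (j - i) (leq_subr _ _)).
rewrite !natrM bin_sub // in e.
rewrite subKn // in e *.
have e2 : (m - (j - i) = (m - j) + i)%N by rewrite subnBA // addnBAC // addnC.
have e3 : ((a + j).+1 * (m - j) = (m - j) + (a + j) * (m - j))%N by rewrite mulSn.
rewrite [in X in _ * p ^+ _ * X]e2 e3 !exprD subKr.
transitivity (('C(m, j - i)%:R * 'C(m - (j - i), i)%:R) * (p ^+ (j - i) *
  ((1 - p) ^+ (m - j) * (1 - p) ^+ i) *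
  (1 - p) ^+ ((a + j) * (m - j)) * boxes (1 - p) (a + j) i)); first by ring.
by rewrite e; ring.
Qed.

(** The binomial coefficient chooses the reached set, the power of [1 - p] forbids edges from active
    or reached vertices to the rest of [U], and [boxes] is the probability that the exploration
    finds all [j] chosen vertices. Induction on the number of vertices, exploring one active vertex
    at a time. *)
Lemma reached_law {R : realFieldType} (p : R) A U j : [disjoint A & U] ->
  subset_mean p (pairs_in (A :|: U)) (fun G => (#|reached A U G| == j)%:R) =
  ('C(#|U|, j))%:R * (1 - p) ^+ ((#|A| + j) * (#|U| - j)) * boxes (1 - p) (#|A| + j) j.
Proof.
move sE: #|A :|: U| => s; elim: s A U j sE => [|s IH] A U j sE dAU.
  have : A :|: U == finset.set0 by rewrite -cards_eq0 sE.
  rewrite finset.setU_eq0 => /andP[/eqP -> /eqP ->].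
  under eq_subset_mean => G _ do rewrite reached0 cards0.
  rewrite subset_mean_cst !cards0 add0n sub0n muln0 expr0 mulr1.
  by case: j => [|j] /=; rewrite ?mul1r ?bin0n ?mul0r // ltnn mulr0.
have [A0|[x xA]] := set_0Vmem A.
  (* Without active vertices nothing is reached, in agreement with [boxes j j = 0] for positive
     [j]. *)
  rewrite A0; under eq_subset_mean => G _ do rewrite reached0 cards0.
  rewrite subset_mean_cst cards0 add0n.
  case: j => [|j]; first by rewrite mul0n expr0 bin0 /= !mulr1.
  by rewrite boxes_eq0 mulr0.
set A' := A :\ x.
have AE : A = x |: A' by rewrite finset.setD1K.
have xA' : x \notin A' by rewrite !inE eqxx.
have xU : x \notin U by rewrite (disjointFr dAU).
have dAU' : [disjoint A' & U] by apply: disjointWl dAU; rewrite finset.subD1set.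
have xV : x \notin A' :|: U by rewrite inE negb_or xA'.
have cA : #|A| = #|A'|.+1 by rewrite (cardsD1 x) xA.
have VE : A :|: U = x |: (A' :|: U) by rewrite AE finset.setUA.
have cV : #|A' :|: U| = s by move: sE; rewrite VE cardsU1 xV => -[].
(* The edges split into those from [x] to [U], those from [x] to [A'] and those among the other
   vertices; the three blocks are averaged in turn. *)
rewrite VE pairs_inU1 // subset_mean_setU ?disjoint_star //.
rewrite finset.imsetU [edge x @: A' :|: _]finset.setUC subset_mean_setU; last first.
  rewrite disjoint_sym disjoint_subset; apply/fintype.subsetP => e /imsetP[u uA ->].
  by rewrite inE (mem_imset _ _ (@edge_inj x)) (disjointFr dAU').
rewrite subset_mean_imset; last exact: edge_inj.
rewrite -[RHS](_ : subset_mean p U (fun B => (if (#|B| <= j)%N then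
   ('C(#|U| - #|B|, j - #|B|))%:R * (1 - p) ^+ ((#|A'| + j) * (#|U| - j)) *
     boxes (1 - p) (#|A'| + j) (j - #|B|) else 0)) = _); last first.
  rewrite (subset_mean_card p U (fun b => if (b <= j)%N then
    ('C(#|U| - b, j - b))%:R * (1 - p) ^+ ((#|A'| + j) * (#|U| - j)) *
     boxes (1 - p) (#|A'| + j) (j - b) else 0)).
  by rewrite exploration_sum cA.
apply: eq_subset_mean => B BU.
rewrite subset_mean_imset; last exact: edge_inj.
rewrite -[RHS](subset_mean_cst p A'); apply: eq_subset_mean => C CA.
have dAB : [disjoint A' & B] by apply: disjointWr dAU'.
have cAB : #|A' :|: B| = (#|A'| + #|B|)%N.
  by have [_] := leq_card_setU A' B; rewrite dAB => /eqP.
have cUB : #|U :\: B| = (#|U| - #|B|)%N by rewrite cardsD (finset.setIidPr BU).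
have V2 : A' :|: U = (A' :|: B) :|: (U :\: B).
  apply/setP => u; rewrite !inE.
  by case: (boolP (u \in B)) => [/(fintype.subsetP BU) ->|_]; rewrite ?orbT ?orbF.
have d2 : [disjoint A' :|: B & U :\: B].
  rewrite disjoint_subset; apply/fintype.subsetP => u; rewrite !inE.
  by case: (boolP (u \in B)) => //=; rewrite orbF => _ /andP[_ uA]; rewrite (disjointFr dAU uA).
rewrite (eq_subset_mean p _ _
  (fun G => (#|B| + #|reached (A' :|: B) (U :\: B) G| == j)%N%:R)); last first.
  move=> G GV; rewrite AE reached_step // (_ : #|_ :|: _| = #|B| + #|reached (A' :|: B) (U :\: B) G|)%N; last first.
    have [_] := leq_card_setU B (reached (A' :|: B) (U :\: B) G).
    rewrite (_ : [disjoint _ & _]) => [/eqP //|].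
    rewrite disjoint_sym disjoint_subset; apply/fintype.subsetP => u; rewrite !inE.
    by case/andP => /andP[].
  by [].
case: ifP => Bj; last first.
  rewrite (eq_subset_mean p _ _ (fun=> 0)) ?subset_mean_cst // => G _.
  by case: eqP => // e; move: Bj; rewrite -e leq_addr.
rewrite (eq_subset_mean p _ _
  (fun G => (#|reached (A' :|: B) (U :\: B) G| == j - #|B|)%N%:R)); last first.
  by move=> G _; rewrite -[X in (_ == X)%:R](subnKC Bj) eqn_add2l.
rewrite V2 IH ?cAB ?cUB -?V2 //.
have -> : (#|A'| + #|B| + (j - #|B|) = #|A'| + j)%N by rewrite -addnA subnKC.
have -> // : (#|U| - #|B| - (j - #|B|) = #|U| - j)%N by rewrite subnBA // subnK // subset_leq_card.
Qed.

Lemma pairs_in_setT : pairs_in finset.setT = pairs n.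
Proof. by apply/setP => e; rewrite [LHS]inE !finset.in_setT /= andbT. Qed.

Lemma comp_size_law {R : realFieldType} (p : R) v k : (0 < k)%N ->
  gnp_prob p (fun G => comp_size G v == k) =
  ('C(n.-1, k.-1))%:R * (1 - p) ^+ (k * (n - k)) * boxes (1 - p) k k.-1.
Proof.
move=> k0; have := reached_law p [set v] (~: [set v]) k.-1.
rewrite finset.setUCr pairs_in_setT cards1 add1n prednK // cardsC1 card_ord.
have -> : (n.-1 - k.-1 = n - k)%N by case: k k0 => // k _; rewrite subnS predn_sub.
move=> <-; last by rewrite finset.disjoints_subset finset.setCK.
rewrite /gnp_prob /subset_mean /gnp_weight big_mkcondr /=.
apply: eq_bigr => G _; rewrite comp_size_reached -[in LHS](prednK k0) eqSS.
by case: (_ == k.-1); rewrite ?mulr1 ?mulr0.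
Qed.

End Exploration.

(** * Stirling's formula and logarithmic estimates *)

Section Wallis.
Context {R : realType}.
Implicit Types (x h : R) (n m : nat).

(** Primitive of [cos ^ n] by the reduction formula, so that Wallis's integral over [[0, pi / 2]] is
    a difference of two values. *)
Fixpoint cos_prim n x : R :=
  if n is n1.+1 then
    if n1 is m.+1 then
      cos x ^+ n1 * sin x / n%:R + n1%:R / n%:R * cos_prim m x
    else sin x
  else x.

Lemma cos_prim_derive n x : is_derive x 1 (cos_prim n) (cos x ^+ n).
Proof.
suff : is_derive x 1 (cos_prim n) (cos x ^+ n) /\
       is_derive x 1 (cos_prim n.+1) (cos x ^+ n.+1) by case.
elim: n => [|n [IH1 IH2]].
  split; first by rewrite expr0; exact: is_derive_idf.
  by rewrite expr1; exact: is_derive_sin.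
split=> //.
have h1 : is_derive x 1 (fun x => cos x ^+ n.+1 * sin x / n.+2%:R)
  ((cos x ^+ n.+2 - n.+1%:R * cos x ^+ n * (sin x) ^+ 2) / n.+2%:R).
  derive_auto; rewrite /= mulr0 addr0 [cos x ^+ n.+2]exprS [cos x ^+ n.+1]exprS; ring.
have h2 := is_derive_mulf (fun=> n.+1%:R / n.+2%:R) _ _ _ _ (is_derive_cstf x _) IH1.
have := is_derive_addf _ _ _ _ _ h1 h2; congr is_derive.
rewrite mul0r add0r sin2cos2 -[n.+2%:R]natr1 ![cos x ^+ n.+2]exprS [cos x ^+ n.+1]exprS.
by field; rewrite nat1r natr1 pnatr_eq0.
Qed.

Definition wallis n : R := cos_prim n (pi / 2) - cos_prim n 0.

Lemma wallisSS n : wallis n.+2 = n.+1%:R / n.+2%:R * wallis n.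
Proof.
by rewrite /wallis /= cos_pihalf sin0 expr0n /= !(mul0r, mulr0) !add0r -mulrBr.
Qed.

Lemma wallis_decr n : wallis n.+1 <= wallis n.
Proof.
rewrite /wallis -subr_ge0.
have -> : cos_prim n (pi / 2) - cos_prim n 0 - (cos_prim n.+1 (pi / 2) - cos_prim n.+1 0)
  = (cos_prim n (pi / 2) - cos_prim n.+1 (pi / 2)) - (cos_prim n 0 - cos_prim n.+1 0) by ring.
have p2 : 0 <= pi / 2 :> R by rewrite divr_ge0 // pi_ge0.
rewrite subr_ge0; apply: (derive_ge0_le (fun x => cos_prim n x - cos_prim n.+1 x)
  (fun x => cos x ^+ n - cos x ^+ n.+1)) => // x /andP[x0 x1].
  exact: is_derive_subf (cos_prim_derive n x) (cos_prim_derive n.+1 x).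
have c0 : 0 <= cos x by apply: cos_ge0_pihalf; rewrite x1 andbT; lra.
rewrite subr_ge0 exprS ler_piMl ?exprn_ge0 // cos_le1.
Qed.

Lemma wallis0 : wallis 0 = pi / 2.
Proof. by rewrite /wallis /= subr0. Qed.

Lemma wallis1 : wallis 1 = 1.
Proof. by rewrite /wallis /= sin_pihalf sin0 subr0. Qed.

(** Wallis's invariant: the recursion [wallisSS] leaves the product unchanged when [n] grows by
    one. *)
Lemma wallis_prod n : n.+1%:R * wallis n * wallis n.+1 = pi / 2.
Proof.
elim: n => [|n IH]; first by rewrite wallis0 wallis1 mul1r mulr1.
rewrite wallisSS -[RHS]IH; field.
by have n0 : 0 <= n%:R :> R by []; rewrite gt_eqF //; lra.
Qed.

Lemma wallis_gt0 n : 0 < wallis n.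
Proof.
suff : 0 < wallis n /\ 0 < wallis n.+1 by case.
elim: n => [|n [IH1 IH2]].
  by rewrite wallis0 wallis1 divr_gt0 // pi_gt0.
by split=> //; rewrite wallisSS mulr_gt0 // divr_gt0.
Qed.

(** The normalised central binomial coefficient [C(2n, n) / 4 ^ n]. *)
Definition central n : R := (2 * n)`!%:R / (n`!%:R ^+ 2 * 4 ^+ n).

Lemma centralE n : central n = 2 / pi * wallis (2 * n).
Proof.
have p0 : pi != 0 :> R by rewrite gt_eqF // pi_gt0.
elim: n => [|n IH].
  rewrite /central muln0 fact0 expr0 wallis0 expr1n mulr1 divr1.
  by move: pi p0 => P p0; field.
have -> : (2 * n.+1 = (2 * n).+2)%N by rewrite mulnS.
rewrite wallisSS mulrCA -IH /central.
have -> : (2 * n.+1 = (2 * n).+2)%N by rewrite mulnS.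
rewrite !factS !natrM [4 ^+ n.+1]exprS -![_.+2%:R]natr1 -![_.+1%:R]natr1 natrM.
have f0 : n`!%:R != 0 :> R by rewrite pnatr_eq0 -lt0n fact_gt0.
have e0 : 4 ^+ n != 0 :> R by rewrite expf_neq0 // pnatr_eq0.
have n1 : n%:R + 1 != 0 :> R by rewrite natr1 pnatr_eq0.
have nR : 0 <= n%:R :> R by [].
move: (n`!%:R) f0 ((2 * n)`!%:R) (n%:R) n1 nR => f f0 g x x1 x0.
field; rewrite f0 x1 /= andbT; apply/andP; split; last by rewrite gt_eqF //; lra.
by apply: expf_neq0; rewrite gt_eqF //; lra.
Qed.

(** Monotonicity of [wallis] squeezes [wallis (2 * n) ^ 2] between the two neighbouring products of
    [wallis_prod]. *)
Lemma central_sqr n : (0 < n)%N ->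
  2 / (pi * (2 * n%:R + 1)) <= central n ^+ 2 <= 1 / (pi * n%:R) /\ 0 < central n.
Proof.
move=> n0; have p0 : 0 < pi :> R by exact: pi_gt0.
have nR : 0 < n%:R :> R by rewrite ltr0n.
have w0 := wallis_gt0 (2 * n).
split; last by rewrite centralE mulr_gt0 // divr_gt0.
have -> : central n ^+ 2 = 4 / pi ^+ 2 * wallis (2 * n) ^+ 2.
  by rewrite centralE; move: pi p0 => P p0; field; rewrite gt_eqF.
have h1 := wallis_prod (2 * n); have h2 := wallis_decr (2 * n).
have [m mE] : exists m, (2 * n = m.+1)%N by exists (2 * n).-1; rewrite prednK // muln_gt0.
have h3 := wallis_prod m; have h4 := wallis_decr m.
rewrite -mE in h3 h4.
have e1 : (2 * n).+1%:R = 2 * n%:R + 1 :> R by rewrite -natr1 natrM.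
have e2 : (2 * n)%:R = 2 * n%:R :> R by rewrite natrM.
rewrite e1 in h1; rewrite e2 in h3.
move: pi p0 h1 h3 => P p0 h1 h3.
have lo : P / 2 <= (2 * n%:R + 1) * wallis (2 * n) ^+ 2.
  by rewrite -h1 expr2 mulrA ler_wpM2l // mulr_ge0 ?ltW //; lra.
have hi : 2 * n%:R * wallis (2 * n) ^+ 2 <= P / 2.
  rewrite -h3 expr2 mulrA; apply: ler_wpM2r; first exact: ltW.
  by apply: ler_wpM2l => //; lra.
apply/andP; split.
  rewrite ler_pdivrMr; last by rewrite mulr_gt0 //; lra.
  have -> : 4 / P ^+ 2 * wallis (2 * n) ^+ 2 * (P * (2 * n%:R + 1)) =
    4 / P * ((2 * n%:R + 1) * wallis (2 * n) ^+ 2) by field; rewrite gt_eqF.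
  rewrite [leLHS](_ : 2 = 4 / P * (P / 2)); last by field; rewrite gt_eqF.
  by apply: ler_wpM2l => //; rewrite divr_ge0 // ltW.
rewrite ler_pdivlMr ?mulr_gt0 //.
have -> : 4 / P ^+ 2 * wallis (2 * n) ^+ 2 * (P * n%:R) =
  2 / P * (2 * n%:R * wallis (2 * n) ^+ 2) by field; rewrite gt_eqF.
rewrite [leRHS](_ : 1 = 2 / P * (P / 2)); last by field; rewrite gt_eqF.
by apply: ler_wpM2l => //; rewrite divr_ge0 // ltW.
Qed.

(** A Pade bound fitted to Stirling: for [x h = 1] the product [(x + 1 / 2) * (2 h / (2 + h))] is
    exactly 1, which makes [stirling_gap] nonincreasing. *)
Lemma ln_ratio_ge h : 0 <= h -> 2 * h / (2 + h) <= ln (1 + h).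
Proof.
move=> h0; rewrite -subr_ge0.
have := @derive_ge0_le R (fun h => ln (1 + h) - 2 * h / (2 + h))
  (fun h => h ^+ 2 / ((1 + h) * (2 + h) ^+ 2)) 0 h h0.
rewrite addr0 ln1 mulr0 mul0r subr0 => K; apply: K => t /andP[t0 _].
  have d1 : 0 < 1 + t by lra.
  have d2 : 0 < 2 + t by lra.
  by derive_auto; rewrite ?gt_eqF //; field; rewrite !gt_eqF.
by rewrite divr_ge0 ?sqr_ge0 // mulr_ge0 ?exprn_ge0 //; lra.
Qed.

Lemma ln_le_cubic h : 0 <= h -> ln (1 + h) <= h - h ^+ 2 / 2 + h ^+ 3 / 3.
Proof.
move=> h0; rewrite -subr_ge0.
have := @derive_ge0_le R (fun h => h - h ^+ 2 / 2 + h ^+ 3 / 3 - ln (1 + h))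
  (fun h => h ^+ 3 / (1 + h)) 0 h h0.
rewrite addr0 ln1 !expr0n /= => K; apply: le_trans (K _ _); first lra.
  move=> t /andP[t0 _]; have d1 : 0 < 1 + t by lra.
  by derive_auto; rewrite /= ?gt_eqF //; field; rewrite gt_eqF.
by move=> t /andP[t0 _]; rewrite divr_ge0 ?exprn_ge0 //; lra.
Qed.

Definition stirling_gap n : R := ln n`!%:R - ((n%:R + 1 / 2) * ln n%:R - n%:R).

Lemma stirling_gapS n : (0 < n)%N ->
  0 <= stirling_gap n - stirling_gap n.+1 <= 1 / 2 * (n%:R^-1 - n.+1%:R^-1).
Proof.
move=> n0; have nR : 0 < n%:R :> R by rewrite ltr0n.
have n1 : 1 <= n%:R :> R by rewrite ler1n.
set h := n%:R^-1.
have h0 : 0 < h by rewrite invr_gt0.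
have nh : n%:R * h = 1 by rewrite mulfV // gt_eqF.
have h1 : h <= 1 by rewrite invf_le1.
have e1 : ln n.+1%:R = ln n%:R + ln (1 + h) :> R.
  rewrite -lnM ?posrE //; last lra.
  by rewrite mulrDr mulr1 nh natr1.
have e2 : ln n.+1`!%:R = ln n`!%:R + ln n.+1%:R :> R.
  by rewrite factS natrM mulrC lnM ?posrE ?ltr0n ?fact_gt0.
have -> : stirling_gap n - stirling_gap n.+1 = (n%:R + 1 / 2) * ln (1 + h) - 1.
  by rewrite /stirling_gap e2 e1 -natr1; ring.
have e3 : n.+1%:R^-1 = h / (1 + h).
  rewrite -natr1 /h; have : 0 < n%:R + 1 :> R by lra.
  by move=> ?; field; rewrite !gt_eqF.
rewrite e3; move: (n%:R) nR n1 h h0 nh h1 {e1 e2 e3} => x x0 x1 h h0 xh h1.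
apply/andP; split.
  have : (x + 1 / 2) * (2 * h / (2 + h)) <= (x + 1 / 2) * ln (1 + h).
    by apply: ler_wpM2l; [lra|apply: ln_ratio_ge; lra].
  have -> : (x + 1 / 2) * (2 * h / (2 + h)) = (2 * (x * h) + h) / (2 + h).
    by field; rewrite gt_eqF //; lra.
  rewrite xh mulr1 divff ?gt_eqF //; last lra.
  lra.
have : (x + 1 / 2) * ln (1 + h) <= (x + 1 / 2) * (h - h ^+ 2 / 2 + h ^+ 3 / 3).
  by apply: ler_wpM2l; [lra|apply: ln_le_cubic; lra].
have -> : (x + 1 / 2) * (h - h ^+ 2 / 2 + h ^+ 3 / 3) =
  x * h * (1 - h / 2 + h ^+ 2 / 3) + h / 2 - h ^+ 2 / 4 + h ^+ 3 / 6 by field.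
rewrite xh.
have : h ^+ 2 / 4 <= 1 / 2 * (h - h / (1 + h)).
  have -> : 1 / 2 * (h - h / (1 + h)) = h ^+ 2 / (2 * (1 + h)).
    by field; rewrite gt_eqF //; lra.
  rewrite ler_wpM2l ?sqr_ge0 // lef_pV2 ?posrE; lra.
have : h ^+ 3 <= h ^+ 2 by rewrite exprS ler_piMl ?sqr_ge0.
lra.
Qed.

Lemma stirling_gap_diff n m : (0 < n <= m)%N ->
  0 <= stirling_gap n - stirling_gap m <= 1 / 2 * (n%:R^-1 - m%:R^-1).
Proof.
move=> /andP[n0]; elim: m => [|m IH]; first by rewrite leqNgt n0.
rewrite leq_eqVlt => /orP[/eqP <-|]; first by rewrite !subrr mulr0 lexx.
rewrite ltnS => nm; have := IH nm; have := stirling_gapS m (leq_trans n0 nm).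
move: (m%:R^-1) (m.+1%:R^-1) (n%:R^-1) => u v w /andP[a1 a2] /andP[b1 b2].
by apply/andP; split; lra.
Qed.

Lemma lnX n x : 0 < x -> ln (x ^+ n) = n%:R * ln x.
Proof. by move=> x0; rewrite lnXn // mulr_natl. Qed.

Lemma stirling m : (0 < m)%N ->
  `|stirling_gap m - ln (2 * pi) / 2| <= 1 / (2 * m%:R).
Proof.
move=> m0; have mR : 0 < m%:R :> R by rewrite ltr0n.
have m1 : 1 <= m%:R :> R by rewrite ler1n.
have [/andP[cl cr] c0] := central_sqr m m0.
have p0 : 0 < pi :> R by exact: pi_gt0.
(* The constant is found at finite [m]: this combination depends only on the central binomial
   coefficient, known from Wallis, while [stirling_gap m - stirling_gap (2 * m)] is already
   bounded. *)
have e1 : 2 * stirling_gap m - stirling_gap (2 * m) =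
   - ln (central m) + ln 2 / 2 - ln m%:R / 2.
  rewrite /stirling_gap /central ln_div ?posrE; last first.
  - by rewrite mulr_gt0 ?exprn_gt0 // ltr0n fact_gt0.
  - by rewrite ltr0n fact_gt0.
  rewrite lnM ?posrE ?exprn_gt0 // ?ltr0n ?fact_gt0 // !lnX ?ltr0n ?fact_gt0 //.
  rewrite natrM lnM ?posrE //.
  have -> : ln 4 = 2 * ln 2 :> R.
    transitivity (ln (2 * 2) : R); first by congr ln; ring.
    by rewrite lnM ?posrE //; ring.
  by field.
have lc : 2 * ln (central m) = ln (central m ^+ 2) by rewrite lnX.
have up : 2 * ln (central m) <= - (ln pi + ln m%:R).
  rewrite lc -lnM ?posrE // -lnV ?posrE ?mulr_gt0 // ler_ln ?posrE ?exprn_gt0 //.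
  - by rewrite -div1r.
  - by rewrite invr_gt0 mulr_gt0.
have lo : ln 2 - (ln pi + ln (2 * m%:R + 1)) <= 2 * ln (central m).
  have d : 0 < 2 * m%:R + 1 :> R by lra.
  have d' : 0 < pi * (2 * m%:R + 1) :> R by rewrite mulr_gt0.
  rewrite lc -lnM ?posrE // -ln_div ?posrE //.
  by rewrite ler_ln ?posrE ?exprn_gt0 // divr_gt0.
have l2 : ln (2 * m%:R + 1) <= ln 2 + ln m%:R + 1 / (2 * m%:R) :> R.
  have -> : 2 * m%:R + 1 = 2 * m%:R * (1 + 1 / (2 * m%:R)) :> R by field; rewrite gt_eqF.
  have q0 : 0 < 1 / (2 * m%:R) :> R by rewrite divr_gt0 // mulr_gt0.
  have d1 : 0 < 1 + 1 / (2 * m%:R) :> R by lra.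
  have d2 : 0 < 2 * m%:R :> R by lra.
  rewrite lnM ?posrE // [ln (2 * _)]lnM ?posrE // lerD2l.
  by apply: le_ln1Dx; lra.
have e2 : ln (2 * pi) = ln 2 + ln pi :> R by rewrite lnM ?posrE.
have := stirling_gap_diff m (2 * m); rewrite m0 leq_pmull // => /(_ isT).
have e3 : m%:R^-1 - (2 * m)%:R^-1 = 1 / (2 * m%:R) :> R.
  by rewrite natrM; field; rewrite gt_eqF.
rewrite e3 e2; move: (1 / (2 * m%:R)) l2 => w l2 /andP[d1 d2].
rewrite ler_norml; lra.
Qed.

End Wallis.

(** * Logarithms of the survival factor, falling factorials and binomial coefficients *)

Section LogEstimates.
Context {R : realType}.
Implicit Types (x y c u : R) (n k : nat).

Lemma ln_1m_le x : 0 <= x < 1 -> ln (1 - x) <= - x - x ^+ 2 / 2.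
Proof.
move=> /andP[x0 x1]; rewrite -subr_ge0.
have := @derive_ge0_le R (fun x => - x - x ^+ 2 / 2 - ln (1 - x))
  (fun x => x ^+ 2 / (1 - x)) 0 x x0.
rewrite subr0 ln1 expr0n /= => K; apply: le_trans (K _ _); first lra.
  move=> t /andP[t0 t1]; have d : 0 < 1 - t by lra.
  by derive_auto; rewrite /= ?gt_eqF //; field; rewrite gt_eqF.
by move=> t /andP[t0 t1]; rewrite divr_ge0 ?sqr_ge0 //; lra.
Qed.

Lemma ln_1m_ge x : 0 <= x <= 1 / 2 -> - x - x ^+ 2 / 2 - x ^+ 3 <= ln (1 - x).
Proof.
move=> /andP[x0 x1]; rewrite -subr_ge0.
have := @derive_ge0_le R (fun x => ln (1 - x) - (- x - x ^+ 2 / 2 - x ^+ 3))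
  (fun x => x ^+ 2 * (2 - 3 * x) / (1 - x)) 0 x x0.
rewrite subr0 ln1 !expr0n /= => K; apply: le_trans (K _ _); first lra.
  move=> t /andP[t0 t1]; have d : 0 < 1 - t by lra.
  by derive_auto; rewrite /= ?gt_eqF //; field; rewrite gt_eqF.
by move=> t /andP[t0 t1]; rewrite divr_ge0 ?mulr_ge0 ?sqr_ge0 //; lra.
Qed.

Lemma ln_1D_cubic u : `|u| <= 1 / 2 -> `|ln (1 + u) - (u - u ^+ 2 / 2)| <= `|u| ^+ 3.
Proof.
have [u0|u0] := leP 0 u.
  rewrite ger0_norm // => u1; rewrite ler_norml.
  have h1 := ln_ge_quad u u0; have h2 := ln_le_cubic u u0.
  have : 0 <= u ^+ 3 by rewrite exprn_ge0.
  lra.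
rewrite ltr0_norm //; move: u0; rewrite -oppr_gt0.
have -> : u = - - u by ring.
move: (- u) => x; rewrite opprK => x0 x1; rewrite ler_norml.
have hx : 0 <= x <= 1 / 2 by rewrite ltW.
have h1 := ln_1m_ge x hx; have h2 : ln (1 - x) <= - x - x ^+ 2 / 2.
  by apply: ln_1m_le; lra.
rewrite sqrrN; have : 0 <= x ^+ 3 by rewrite exprn_ge0 // ltW.
lra.
Qed.

Lemma expRN_le4 x : 0 <= x -> expR (- x) <= 1 - x + x ^+ 2 / 2 - x ^+ 3 / 6 + x ^+ 4 / 24.
Proof.
move=> x0; rewrite -subr_ge0.
have := @derive_ge0_le R (fun x => 1 - x + x ^+ 2 / 2 - x ^+ 3 / 6 + x ^+ 4 / 24 - expR (- x))
  (fun x => expR (- x) - (1 - x + x ^+ 2 / 2 - x ^+ 3 / 6)) 0 x x0.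
rewrite oppr0 expR0 !expr0n /= => H; apply: le_trans (H _ _); first (clear -R; lra).
- by move=> t tx; derive_auto; rewrite /=; field.
- by move=> t /andP[t0 _]; have := expRN_ge t t0; lra.
Qed.

(** Write [1 - expR (- c) = c (1 - x)] with [x = c / 2 - c ^ 2 / 6 + O(c ^ 3)]; the last coefficient
    is [1/24 = 1/6 - 1/8]. *)
Lemma ln_survival c : 0 < c <= 1 / 2 ->
  `|ln (1 - expR (- c)) - (ln c - c / 2 + c ^+ 2 / 24)| <= c ^+ 3.
Proof.
move=> /andP[c0 c1].
have h1 := expRN_ge c (ltW c0); have h2 := expRN_le4 c (ltW c0).
set x := 1 - (1 - expR (- c)) / c.
have xE : 1 - expR (- c) = c * (1 - x) by rewrite /x; field; rewrite gt_eqF.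
have cx : c * x = c - (1 - expR (- c)) by rewrite /x; field; rewrite gt_eqF.
have xl : c / 2 - c ^+ 2 / 6 <= x.
  have : c * (c / 2 - c ^+ 2 / 6) <= c * x.
    by rewrite cx; lra.
  by rewrite ler_pM2l.
have xr : x <= c / 2 - c ^+ 2 / 6 + c ^+ 3 / 24.
  have : c * x <= c * (c / 2 - c ^+ 2 / 6 + c ^+ 3 / 24).
    by rewrite cx; lra.
  by rewrite ler_pM2l.
have c2 : 0 <= c ^+ 2 by exact: sqr_ge0.
have c2' : c ^+ 2 <= c / 2 by rewrite expr2 mulrC; have := ler_wpM2l (ltW c0) c1; lra.
have c3' : c ^+ 3 <= c ^+ 2 / 2.
  by rewrite exprSr; have := ler_wpM2l c2 c1; lra.
have x0 : 0 <= x by lra.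
have x1 : x <= c / 2 by lra.
have hx : 0 <= x <= 1 / 2 by rewrite x0; lra.
have l1 := ln_1m_ge x hx; have l2 : ln (1 - x) <= - x - x ^+ 2 / 2.
  by apply: ln_1m_le; lra.
have q1 : x ^+ 2 <= (c / 2) ^+ 2 by apply: lerXn2r; rewrite ?nnegrE //; lra.
have q2 : x ^+ 3 <= (c / 2) ^+ 3 by apply: lerXn2r; rewrite ?nnegrE //; clear -x1 hx; lra.
have q3 : (c / 2 - c ^+ 2 / 6) ^+ 2 <= x ^+ 2.
  by apply: lerXn2r; rewrite ?nnegrE //; clear -c2' x1 hx; lra.
rewrite xE lnM ?posrE //; last (clear -hx; lra).
have e3 : (c / 2 - c ^+ 2 / 6) ^+ 2 = c ^+ 2 / 4 - c ^+ 3 / 6 + c ^+ 4 / 36 by field.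
have c4 : 0 <= c ^+ 4 by rewrite exprn_ge0 // ltW.
have c3 : 0 <= c ^+ 3 by rewrite exprn_ge0 // ltW.
have e4 : (c / 2) ^+ 3 = c ^+ 3 / 8 by field.
have e5 : (c / 2) ^+ 2 = c ^+ 2 / 4 by field.
rewrite ler_norml; apply/andP; split; clear -xr c2 l1 q1 q2 c3 xl l2 q3 c4; lra.
Qed.

Lemma sum_ln_1m (N : R) k : 0 < N -> 2 * k%:R <= N ->
  let s := \sum_(i < k) ln (1 - i%:R / N) in let K := k%:R in
  - (K * (K - 1) / (2 * N) + (K - 1) * K * (2 * K - 1) / (12 * N ^+ 2)
     + (K * (K - 1) / 2) ^+ 2 / N ^+ 3) <= s /\
  s <= - (K * (K - 1) / (2 * N) + (K - 1) * K * (2 * K - 1) / (12 * N ^+ 2)).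
Proof.
move=> N0; elim: k => [|k IH] kN.
  by rewrite big_ord0 /= !(mul0r, mulr0, add0r, oppr0, expr0n) /=; split; rewrite ?mul0r ?oppr0.
have kN' : 2 * k%:R <= N by move: kN; rewrite -natr1; lra.
have {IH} [h1 h2] := IH kN'; rewrite big_ord_recr /=.
set s := \sum_(i < k) _ in h1 h2 *.
set x := k%:R / N.
have x0 : 0 <= x by rewrite divr_ge0 // ltW.
have x1 : x <= 1 / 2 by rewrite ler_pdivrMr //; lra.
have hx : 0 <= x <= 1 / 2 by rewrite x0.
have l1 := ln_1m_ge x hx; have l2 : ln (1 - x) <= - x - x ^+ 2 / 2.
  by apply: ln_1m_le; lra.
rewrite -natr1.
have eA : (k%:R + 1) * (k%:R + 1 - 1) / (2 * N) + (k%:R + 1 - 1) * (k%:R + 1) * (2 * (k%:R + 1) - 1) / (12 * N ^+ 2)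
  = k%:R * (k%:R - 1) / (2 * N) + (k%:R - 1) * k%:R * (2 * k%:R - 1) / (12 * N ^+ 2) + x + x ^+ 2 / 2.
  by rewrite /x; field; rewrite gt_eqF.
have eB : ((k%:R + 1) * (k%:R + 1 - 1) / 2) ^+ 2 / N ^+ 3 = (k%:R * (k%:R - 1) / 2) ^+ 2 / N ^+ 3 + x ^+ 3.
  by rewrite /x; field; rewrite gt_eqF.
rewrite eB eA.
move: (_ / (2 * N)) (_ / (12 * N ^+ 2)) (_ / N ^+ 3) h1 h2 => a b d h1 h2.
split; clear -l1 h1 l2 h2; lra.
Qed.

(** From [C(n - 1, k - 1) = (n - 1)...(n - k + 1) * k / k!]; the summand [i = 0] is [ln 1]. *)
Lemma ln_bin n k : (0 < k <= n)%N ->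
  ln ('C(n.-1, k.-1))%:R = (k%:R - 1) * ln n%:R + \sum_(i < k) ln (1 - i%:R / n%:R)
    + ln k%:R - ln k`!%:R :> R.
Proof.
move=> /andP[k0 kn].
have n0 : (0 < n)%N by exact: leq_trans kn.
have nR : 0 < n%:R :> R by rewrite ltr0n.
have C0 : (0 < 'C(n.-1, k.-1))%N by rewrite bin_gt0 -ltnS !prednK.
suff e : forall j, (j < n)%N -> ln ((n.-1) ^_ j)%:R =
    j%:R * ln n%:R + \sum_(i < j.+1) ln (1 - i%:R / n%:R) :> R.
  have := e k.-1; rewrite prednK // => /(_ kn); rewrite -bin_ffact natrM.
  rewrite lnM ?posrE ?ltr0n ?fact_gt0 //.
  have -> : k.-1%:R = k%:R - 1 :> R by rewrite -[in RHS](prednK k0) -natr1 addrK.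
  move=> <-.
  have -> : ln k`!%:R = ln k%:R + ln (k.-1)`!%:R :> R.
    rewrite -[in LHS](prednK k0) factS prednK // natrM lnM ?posrE ?ltr0n ?fact_gt0 //.
  by ring.
elim=> [|j IH] jn.
  by rewrite ffactn0 ln1 mul0r big_ord_recl big_ord0 /= mul0r subr0 ln1 !addr0.
have jn' : (j < n)%N by exact: ltnW.
rewrite ffactnSr natrM lnM ?posrE ?ltr0n ?ffact_gt0 ?subn_gt0 ?ltn_predRL //; last first.
  by rewrite -ltnS prednK.
rewrite IH // [in RHS]big_ord_recr /=.
have -> : (n.-1 - j)%:R = n%:R * (1 - j.+1%:R / n%:R) :> R.
  rewrite natrB; last by rewrite -ltnS prednK.
  rewrite -[in RHS](prednK n0) -!natr1.
  have : n.-1%:R + 1 != 0 :> R by rewrite natr1 prednK // gt_eqF.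
  by move=> ?; field.
rewrite lnM ?posrE //; last by rewrite subr_gt0 ltr_pdivrMr // mul1r ltr_nat.
rewrite -natr1; ring.
Qed.

End LogEstimates.

(** * The point probabilities *)

Section ExponentBound.
Context {R : realType}.
Implicit Types (w b mu th nu u t c lam : R) (n k : nat).

(** Bounds what [exponent_identity] leaves: [es] is the error of the falling factorial, [th] that of
    [- ln (1 - p)], and [r1], [r2] are scaled errors of two further logarithms. The cube of [mu]
    comes from [b * r1]. *)
Lemma exponent_bound w b mu th r1 r2 es :
  0 < w <= 1 / 100 -> 0 < b <= 1 -> `|mu| <= 1 -> 0 <= th <= 2 ->
  let nu := mu + th * w ^+ 9 in let u := w ^+ 3 * nu in let t := 1 + u in
  let c := b * w ^+ 3 * t in
  `|r1| <= `|nu| ^+ 3 -> `|r2| <= (b * t) ^+ 3 -> `|es| <= w ^+ 3 + b ^+ 4 ->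
  `|es + b ^+ 3 * (nu * (2 + u)) / 24 + b ^+ 2 * w ^+ 6 * th / 2
    - b * (2 * mu * th * w ^+ 6 + th ^+ 2 * w ^+ 15) / 2 + b * r1 + (b - w ^+ 9) * r2
    - (u - u ^+ 2 / 2 + w ^+ 9 * r1) + c / 2 - c ^+ 2 / 24|
  <= 30 * (b ^+ 4 + `|mu| + `|mu| ^+ 3 * b + w ^+ 2).
Proof.
move=> /andP[w0 w1] /andP[b0 b1] mu1 /andP[th0 th1] nu u t c hr1 hr2 hes.
have wX m : 0 <= w ^+ m by rewrite exprn_ge0 // ltW.
have wle m l : (l <= m)%N -> w ^+ m <= w ^+ l.
  by move=> lm; apply: ler_wiXn2l => //; lra.
have w2 : 0 <= w ^+ 2 by [].
have w2' : w ^+ 2 <= 1 / 100 * (1 / 100).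
  by rewrite expr2; apply: ler_pM; clear -w0 w1; lra.
have w3 : w ^+ 3 <= w ^+ 2 by exact: wle.
have w9 : w ^+ 9 <= w ^+ 3 by exact: wle.
have w6 : w ^+ 6 <= w ^+ 3 by exact: wle.
have w15 : w ^+ 15 <= w ^+ 6 by exact: wle.
have w18 : w ^+ 3 <= w ^+ 2 / 100.
  by rewrite exprS mulrC; have := ler_wpM2l w2 w1; clear -R; lra.
have m0 : 0 <= `|mu| by [].
have nu1 : `|nu| <= `|mu| + 2 * w ^+ 9.
  apply: le_trans (ler_normD _ _) _; rewrite lerD2l normrM ger0_norm // ger0_norm //.
  by apply: ler_wpM2r.
have nu0 : 0 <= `|nu| by [].
have nu2 : `|nu| <= 11 / 10 by clear -mu1 w2' w9 w18 nu1; lra.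
have u1 : `|u| <= w ^+ 3 * `|nu| by rewrite /u normrM ger0_norm.
have u2 : `|u| <= 2 / 100 * w ^+ 2.
  apply: le_trans u1 _; have := ler_wpM2l (wX 3%N) nu2.
  clear -w3 w18; lra.
have u0 : 0 <= `|u| by [].
have t1 : 0 <= t <= 11 / 10.
  have := ler_norm u; have := ler_norm (- u); rewrite normrN /t => h1 h2.
  by apply/andP; split; clear -w2' u2 h1 h2; lra.
have [t0 t2] := andP t1.
have bX m : 0 <= b ^+ m by rewrite exprn_ge0 // ltW.
have bX1 m : b ^+ m <= 1 by rewrite exprn_ile1 // ltW.
have nu3 : `|nu| ^+ 3 <= 4 * `|mu| ^+ 3 + 32 * w ^+ 9.
  have h : `|nu| ^+ 3 <= (`|mu| + 2 * w ^+ 9) ^+ 3 by apply: lerXn2r; rewrite ?nnegrE //; clear -nu1 nu0 nu2 u1; lra.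
  apply: le_trans h _; set y := 2 * w ^+ 9.
  have y0 : 0 <= y by rewrite mulr_ge0.
  have y1 : y ^+ 3 <= 8 * w ^+ 9.
    rewrite /y exprMn -exprM; have := wle 27%N 9%N isT.
    have -> : (2 : R) ^+ 3 = 8 by ring.
    by clear -R; lra.
  have : (`|mu| + y) ^+ 3 <= 4 * (`|mu| ^+ 3 + y ^+ 3).
    have -> : 4 * (`|mu| ^+ 3 + y ^+ 3) = (`|mu| + y) ^+ 3 + 3 * (`|mu| + y) * (`|mu| - y) ^+ 2.
      by ring.
    by rewrite lerDl mulr_ge0 ?sqr_ge0 // mulr_ge0 //; clear -m0 y0; lra.
  clear -y1; lra.
have r1b : `|b * r1| <= 4 * (`|mu| ^+ 3 * b) + 32 * w ^+ 3.
  rewrite normrM gtr0_norm //.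
  have h1 : b * `|r1| <= b * (4 * `|mu| ^+ 3 + 32 * w ^+ 9).
    by apply: ler_wpM2l; [exact: ltW|exact: le_trans nu3].
  have h2 : b * w ^+ 9 <= w ^+ 9 by rewrite ler_piMl.
  clear -w9 h1 h2; lra.
have r1c : `|w ^+ 9 * r1| <= 2 * w ^+ 3.
  rewrite normrM ger0_norm //.
  have h : `|r1| <= 2.
    apply: le_trans hr1 _; apply: le_trans (_ : (11 / 10) ^+ 3 <= _); last by clear -R; lra.
    by apply: lerXn2r; rewrite ?nnegrE //; lra.
  by have := ler_wpM2l (wX 9%N) h; clear -w9; lra.
have r2b : `|r2| <= 2 * b ^+ 3.
  apply: le_trans hr2 _; rewrite exprMn mulrC; apply: ler_wpM2r => //.
  apply: le_trans (_ : (11 / 10) ^+ 3 <= _); last by clear -R; lra.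
  by apply: lerXn2r; rewrite ?nnegrE //; lra.
have r2c : `|(b - w ^+ 9) * r2| <= 2 * b ^+ 4 + 2 * w ^+ 9.
  rewrite normrM; apply: le_trans (_ : (b + w ^+ 9) * (2 * b ^+ 3) <= _).
    apply: ler_pM => //; rewrite (le_trans (ler_normB _ _)) // gtr0_norm // ger0_norm //.
  have -> : (b + w ^+ 9) * (2 * b ^+ 3) = 2 * b ^+ 4 + 2 * (w ^+ 9 * b ^+ 3) by ring.
  have : w ^+ 9 * b ^+ 3 <= w ^+ 9 by rewrite ler_piMr.
  clear -R; lra.
have f1 : `|b ^+ 3 * (nu * (2 + u)) / 24| <= `|mu| + 2 * w ^+ 9.
  rewrite normrM [`|24^-1|]ger0_norm ?invr_ge0 // normrM ger0_norm // normrM.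
  have h1 : `|2 + u| <= 3.
    by rewrite (le_trans (ler_normD _ _)) // ger0_norm //; clear -w2' u2; lra.
  have h2 : `|nu| * `|2 + u| <= `|nu| * 3 by apply: ler_wpM2l.
  have h3 : b ^+ 3 * (`|nu| * `|2 + u|) <= `|nu| * `|2 + u|.
    by rewrite ler_piMl // mulr_ge0.
  clear -nu1 nu0 h2 h3; lra.
have f2 : `|b ^+ 2 * w ^+ 6 * th / 2| <= w ^+ 6.
  rewrite ger0_norm; last first.
    by apply: divr_ge0 => //; apply: mulr_ge0 => //; exact: mulr_ge0.
  have h1 : b ^+ 2 * w ^+ 6 <= w ^+ 6 by rewrite ler_piMl.
  have h2 : b ^+ 2 * w ^+ 6 * th <= w ^+ 6 * 2 by apply: ler_pM => //; rewrite mulr_ge0.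
  clear -h2; lra.
have f3 : `|b * (2 * mu * th * w ^+ 6 + th ^+ 2 * w ^+ 15) / 2| <= 4 * w ^+ 6.
  rewrite normrM [`|2^-1|]ger0_norm ?invr_ge0 // normrM gtr0_norm //.
  have h1 : `|2 * mu * th * w ^+ 6 + th ^+ 2 * w ^+ 15| <= 8 * w ^+ 6.
    apply: le_trans (ler_normD _ _) _.
    have -> : `|2 * mu * th * w ^+ 6| = 2 * (`|mu| * th * w ^+ 6).
      have -> : 2 * mu * th * w ^+ 6 = 2 * (mu * (th * w ^+ 6)) by ring.
      have h0 : 0 <= th * w ^+ 6 by exact: mulr_ge0.
      by rewrite normrM ger0_norm // normrM [`|th * _|]ger0_norm // !mulrA.
    rewrite [`|th ^+ 2 * _|]ger0_norm; last by apply: mulr_ge0 => //; exact: sqr_ge0.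
    have g1 : `|mu| * th <= 1 * 2 by apply: ler_pM.
    have g2 : `|mu| * th * w ^+ 6 <= 1 * 2 * w ^+ 6 by apply: ler_wpM2r.
    have g3 : th ^+ 2 <= 2 ^+ 2 by apply: lerXn2r; rewrite ?nnegrE.
    have g4 : th ^+ 2 * w ^+ 15 <= 2 ^+ 2 * w ^+ 6 by apply: ler_pM => //; exact: sqr_ge0.
    clear -g2 g4; lra.
  have h2 : b * `|2 * mu * th * w ^+ 6 + th ^+ 2 * w ^+ 15| <= 1 * (8 * w ^+ 6).
    by apply: ler_pM => //; exact: ltW.
  clear -h2; lra.
have f4 : `|u ^+ 2 / 2| <= w ^+ 2.
  rewrite normrM [`|2^-1|]ger0_norm ?invr_ge0 // normrX expr2.
  have h1 : `|u| * `|u| <= `|u| * 1 by apply: ler_wpM2l => //; clear -w2' u2; lra.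
  clear -u2 u0 h1; lra.
have c0 : 0 <= c by rewrite !mulr_ge0 // ltW.
have c1 : c <= 2 * w ^+ 3.
  have h1 : b * w ^+ 3 <= w ^+ 3 by rewrite ler_piMl.
  have h2 : b * w ^+ 3 * t <= w ^+ 3 * 2 by apply: ler_pM => //; [rewrite mulr_ge0 // ltW|(clear -t2; lra)].
  by rewrite /c; clear -h2; lra.
have c2 : c ^+ 2 <= c by rewrite expr2 ler_piMl //; clear -w2' w18 c1; lra.
have c3 : 0 <= c ^+ 2 by exact: sqr_ge0.
clearbody c u nu t.
have b4 : 0 <= b ^+ 4 by [].
have m3 : 0 <= `|mu| ^+ 3 * b by rewrite mulr_ge0 // ?exprn_ge0 // ltW.
move: f1 f2 f3 f4 r1b r1c r2c hes u2.
move: (b ^+ 3 * (nu * (2 + u)) / 24) (b ^+ 2 * w ^+ 6 * th / 2)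
  (b * (2 * mu * th * w ^+ 6 + th ^+ 2 * w ^+ 15) / 2) (u ^+ 2 / 2) (b * r1) (w ^+ 9 * r1)
  ((b - w ^+ 9) * r2) => e1 e2 e3 e4 e5 e6 e7.
rewrite !ler_norml => /andP[??] /andP[??] /andP[??] /andP[??] /andP[??] /andP[??] /andP[??] /andP[??] /andP[??].
apply/andP; split; lra.
Qed.

End ExponentBound.

(** * Expansion of the exponent of the point probability *)

Section PointExponent.
Context {R : realType}.
Implicit Types (w b mu th nu u t c lam : R) (n k : nat).

(* With [X = n ^ (1/12)] every power of [n] in the problem is an integral power
   of [X], and [lam = mu * X], [k = b * X ^ 9]. *)
Lemma exponent_identity (X b mu th r1 r2 es lK lN gap : R) : X != 0 ->
  let w := X^-1 in let K := b * X ^+ 9 in let N := X ^+ 12 in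
  let nu := mu + th * w ^+ 9 in let u := w ^+ 3 * nu in let t := 1 + u in
  let c := b * w ^+ 3 * t in
  let lt := u - u ^+ 2 / 2 + w ^+ 9 * r1 in
  (K - 1) * lN + (es - K ^+ 2 / (2 * N) - K ^+ 3 / (6 * N ^+ 2)) + lK
   - (gap + ((K + 1 / 2) * lK - K)) - t / N * (K * (N - K))
   + (K - 1) * (lK + lt - lN - c / 2 + c ^+ 2 / 24 + w ^+ 9 * r2)
  - (- lK / 2 - gap - Glam (mu * X) (K * w ^+ 8)) =
  es + b ^+ 3 * (nu * (2 + u)) / 24 + b ^+ 2 * w ^+ 6 * th / 2
    - b * (2 * mu * th * w ^+ 6 + th ^+ 2 * w ^+ 15) / 2 + b * r1 + (b - w ^+ 9) * r2
    - (u - u ^+ 2 / 2 + w ^+ 9 * r1) + c / 2 - c ^+ 2 / 24.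
Proof. by move=> X0 /=; rewrite /Glam; field. Qed.

(** [th] measures [- ln (1 - p) - p] in units of [w ^ 24], that is [n^(-2)]; it is at most 2 because
    [n * p] is close to 1. *)
Lemma tau_expand w lam n : 0 < w <= 1 / 100 -> `|lam * w| <= 1 -> n%:R * w ^+ 12 = 1 ->
  let p := n%:R^-1 + lam * w ^+ 16 in
  [/\ 0 < p < 1, 0 < - ln (1 - p) & exists2 th, 0 <= th <= 2 &
    n%:R * - ln (1 - p) = 1 + w ^+ 3 * (lam * w + th * w ^+ 9)].
Proof.
move=> /andP[w0 w1] mu1 nw p.
have w12 : 0 < w ^+ 12 by rewrite exprn_gt0.
have n0 : n%:R != 0 :> R.
  by apply/eqP => e; move: nw; rewrite e mul0r => /eqP; rewrite eq_sym oner_eq0.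
have nV : n%:R^-1 = w ^+ 12 :> R by apply: (mulfI n0); rewrite mulfV.
have pE : p = w ^+ 12 * (1 + w ^+ 3 * (lam * w)) by rewrite /p nV; ring.
have wle m l : (l <= m)%N -> w ^+ m <= w ^+ l.
  by move=> lm; apply: ler_wiXn2l => //; lra.
have w3 : w ^+ 3 <= 1 / 100 by exact: le_trans (wle 3%N 1%N isT) w1.
have w3' : 0 <= w ^+ 3 by rewrite exprn_ge0 // ltW.
set m := w ^+ 3 * (lam * w) in pE.
have m1 : `|m| <= 1 / 100.
  by rewrite normrM ger0_norm // -[1 / 100]mulr1; apply: ler_pM.
have {m1} [ma mb] : - (1 / 100) <= m /\ m <= 1 / 100 by apply/andP; rewrite -ler_norml.
have w12' : w ^+ 12 <= 1 / 100.
  exact: le_trans (wle 12%N 3%N isT) w3.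
have p0 : 0 < p by rewrite pE mulr_gt0 //; lra.
have p1 : p <= 2 / 100.
  have : w ^+ 12 * (1 + m) <= 1 / 100 * 2 by apply: ler_pM; clear -w12 ma w12' mb; lra.
  by rewrite -pE; lra.
have l1 : ln (1 - p) <= - p - p ^+ 2 / 2 by apply: ln_1m_le; lra.
have l2 : - p - p ^+ 2 / 2 - p ^+ 3 <= ln (1 - p) by apply: ln_1m_ge; clear -p0 p1; lra.
have p2 : 0 <= p ^+ 2 by exact: sqr_ge0.
have p3 : p ^+ 3 <= p ^+ 2 / 2.
  by rewrite exprSr; have := ler_wpM2l p2 p1; clear -p2; lra.
split; [(clear -p0 p1; lra)|(clear -p0 l1 p2; lra)|].
exists ((- ln (1 - p) - p) / (w ^+ 12) ^+ 2).
  apply/andP; split; first by rewrite divr_ge0 ?sqr_ge0 //; clear -l1 p2; lra.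
  rewrite ler_pdivrMr ?exprn_gt0 //.
  have : p ^+ 2 <= 2 * (w ^+ 12) ^+ 2.
    rewrite pE exprMn mulrC; apply: ler_wpM2r; first exact: sqr_ge0.
    clear -ma mb; nra.
  clear -l2 p3; lra.
have -> : 1 + w ^+ 3 * (lam * w + (- ln (1 - p) - p) / (w ^+ 12) ^+ 2 * w ^+ 9)
  = 1 + m + (- ln (1 - p) - p) / w ^+ 12 by rewrite /m; field; rewrite gt_eqF.
have -> : n%:R * - ln (1 - p) = n%:R * p + n%:R * (- ln (1 - p) - p) by ring.
rewrite -nV invrK pE mulrA nw mul1r; ring.
Qed.

(** The logarithm of the point probability without the killing factor [c ^ 2 / 2]. By
    [exponent_identity] the growing terms collapse to [Glam]; Stirling's error for [k!] raises the
    constant 30 of [exponent_bound] to 31. *)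
Lemma point_exponent w lam n k : 0 < w <= 1 / 100 -> `|lam * w| <= 1 ->
  n%:R * w ^+ 12 = 1 -> (0 < k)%N -> w <= k%:R * w ^+ 9 <= 1 ->
  let p := n%:R^-1 + lam * w ^+ 16 in let tau := - ln (1 - p) in
  `|ln ('C(n.-1, k.-1))%:R - tau * (k%:R * (n%:R - k%:R))
     + (k%:R - 1) * ln (1 - expR (- (k%:R * tau)))
    - (- ln k%:R / 2 - ln (2 * pi) / 2 - Glam lam (k%:R * w ^+ 8))|
  <= 31 * ((k%:R * w ^+ 9) ^+ 4 + `|lam * w| + `|lam * w| ^+ 3 * (k%:R * w ^+ 9) + w ^+ 2).
Proof.
move=> /[dup] hw /andP[w0 w1] mu1 nw k0 /andP[bw b1].
cbv zeta; set p := n%:R^-1 + lam * w ^+ 16; set tau := - ln (1 - p).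
have := tau_expand w lam n hw mu1 nw; rewrite /= -/p -/tau => -[_ tau0 [th hth tE]].
clearbody tau.
have KR : 0 < k%:R :> R by rewrite ltr0n.
have K1 : 1 <= k%:R :> R by rewrite ler1n.
have n0 : n%:R != 0 :> R.
  by apply/eqP => e; move: nw; rewrite e mul0r => /eqP; rewrite eq_sym oner_eq0.
have NR : 0 < n%:R :> R by rewrite lt_neqAle eq_sym n0 /=.
pose X := w^-1; have X0 : X != 0 by rewrite invr_eq0 gt_eqF.
have wX : w = X^-1 by rewrite /X invrK.
have NE : n%:R = X ^+ 12.
  by apply: (mulIf (x := w ^+ 12)); rewrite ?expf_neq0 ?gt_eqF // nw /X -exprMn mulVf ?expr1n // gt_eqF.
set b := k%:R * w ^+ 9 in bw b1 *; have b0 : 0 < b by lra.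
have KE : k%:R = b * X ^+ 9.
  by rewrite /b -mulrA /X -exprMn mulfV ?gt_eqF // expr1n mulr1.
set mu := lam * w in mu1 tE *.
have lE : lam = mu * X by rewrite /mu /X mulfK // gt_eqF.
set nu := mu + th * w ^+ 9 in tE; pose u := w ^+ 3 * nu; pose t := 1 + u.
pose c := b * w ^+ 3 * t.
have {}tE : n%:R * tau = t by [].
have tauE : tau = t / n%:R by rewrite -tE; field.
have t0 : 0 < t by rewrite -tE mulr_gt0.
have cE : k%:R * tau = c by rewrite tauE NE KE /c wX; field.
have [th0 th1] := andP hth.
have w3 : 0 <= w ^+ 3 by rewrite exprn_ge0 // ltW.
have w9 : 0 <= w ^+ 9 by rewrite exprn_ge0 // ltW.
have w1' : w <= 1 by clear -bw b1; lra.
have wle m l : (l <= m)%N -> w ^+ m <= w ^+ l.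
  by move=> lm; apply: ler_wiXn2l => //; clear -w0; lra.
have w3' : w ^+ 3 <= 1 / 100 by exact: le_trans (wle 3%N 1%N isT) w1.
have w9' : w ^+ 9 <= 1 / 100 by exact: le_trans (wle 9%N 1%N isT) w1.
have nu2 : `|nu| <= 2.
  apply: le_trans (ler_normD _ _) _.
  rewrite [`|th * _|]ger0_norm; last by exact: (mulr_ge0 th0 w9).
  have : th * w ^+ 9 <= 2 * (1 / 100) by exact: (ler_pM th0 w9 th1 w9').
  by clear -mu1 lE; lra.
have uu : `|u| <= 2 / 100.
  rewrite /u normrM ger0_norm //.
  have : w ^+ 3 * `|nu| <= 1 / 100 * 2 by exact: (ler_pM w3 (normr_ge0 nu) w3' nu2).
  clear -R; lra.
have uu' : u <= 2 / 100 by apply: le_trans uu; exact: ler_norm.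
have c0 : 0 < c by rewrite -cE mulr_gt0.
have c1 : c <= 1 / 2.
  have h1 : b * w ^+ 3 <= 1 * (1 / 100) by apply: ler_pM => //; exact: ltW.
  have : b * w ^+ 3 * t <= 1 * (1 / 100) * 2.
    by apply: ler_pM => //; [rewrite mulr_ge0 // ltW|exact: ltW|rewrite /t; (clear -uu'; lra)].
  by rewrite /c; clear -R; lra.
(* The errors are cubic in [w ^ 3 nu] and in [b w ^ 3 t]; the division by [w ^ 9] anticipates the
   multiplication by [k], which is [b] over [w ^ 9]. *)
pose r1 := (ln t - (u - u ^+ 2 / 2)) / w ^+ 9.
pose r2 := (ln (1 - expR (- c)) - (ln c - c / 2 + c ^+ 2 / 24)) / w ^+ 9.
have w90 : w ^+ 9 != 0 by rewrite expf_neq0 // gt_eqF.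
have lt1 : ln t = u - u ^+ 2 / 2 + w ^+ 9 * r1.
  by rewrite /r1 mulrCA mulfV // mulr1 addrC subrK.
have lt2 : ln (1 - expR (- c)) = ln c - c / 2 + c ^+ 2 / 24 + w ^+ 9 * r2.
  by rewrite /r2 mulrCA mulfV // mulr1; ring.
have r1b : `|r1| <= `|nu| ^+ 3.
  rewrite /r1 normrM [`|_^-1|]ger0_norm ?invr_ge0 // ler_pdivrMr ?exprn_gt0 //.
  apply: le_trans (ln_1D_cubic u _) _; first (clear -uu; lra).
  by rewrite /u normrM ger0_norm // exprMn -exprM mulrC.
have r2b : `|r2| <= (b * t) ^+ 3.
  rewrite /r2 normrM [`|_^-1|]ger0_norm ?invr_ge0 // ler_pdivrMr ?exprn_gt0 //.
  apply: le_trans (ln_survival c _) _; first by rewrite c0.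
  rewrite /c [(b * t) ^+ 3 * _](_ : _ = (b * w ^+ 3 * t) ^+ 3) //; ring.
have kn : (k <= n)%N.
  rewrite -(ler_nat R) NE KE.
  have -> : X ^+ 12 = X ^+ 3 * X ^+ 9 by ring.
  have X1 : 1 <= X by rewrite /X invf_ge1.
  have X9 : 0 < X ^+ 9 by rewrite exprn_gt0 // (lt_le_trans ltr01).
  rewrite ler_pM2r // (le_trans b1) //.
  exact: exprn_ege1.
pose s := \sum_(i < k) ln (1 - i%:R / n%:R : R).
pose es := s + k%:R ^+ 2 / (2 * n%:R) + k%:R ^+ 3 / (6 * n%:R ^+ 2).
have kN2 : 2 * k%:R <= n%:R :> R.
  have -> : k%:R = n%:R * (b * w ^+ 3) :> R by rewrite NE KE wX; field.
  rewrite mulrCA ler_piMr ?(ltW NR) //.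
  have : b * w ^+ 3 <= 1 * (1 / 100) by apply: ler_pM => //; exact: ltW.
  clear -R; lra.
have esb : `|es| <= w ^+ 3 + b ^+ 4.
  have [s1 s2] := sum_ln_1m n%:R k NR kN2; rewrite -/s in s1 s2.
  have e1 : k%:R * (k%:R - 1) / (2 * n%:R) + (k%:R - 1) * k%:R * (2 * k%:R - 1) / (12 * n%:R ^+ 2)
    = k%:R ^+ 2 / (2 * n%:R) + k%:R ^+ 3 / (6 * n%:R ^+ 2)
      - b * w ^+ 3 / 2 - (b * w ^+ 3) ^+ 2 / 4 + b * w ^+ 15 / 12 :> R.
    by rewrite KE NE wX; field.
  have e2 : (k%:R * (k%:R - 1) / 2) ^+ 2 / n%:R ^+ 3 <= b ^+ 4 / 4.
    have -> : b ^+ 4 / 4 = (k%:R * k%:R / 2) ^+ 2 / n%:R ^+ 3.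
      by rewrite KE NE; field.
    rewrite ler_pM2r ?invr_gt0 ?exprn_gt0 //; apply: lerXn2r; rewrite ?nnegrE.
    - by rewrite divr_ge0 // mulr_ge0 //; clear -K1; lra.
    - by rewrite divr_ge0 // mulr_ge0.
    - by rewrite ler_pM2r ?invr_gt0 // ler_pM2l //; clear -R; lra.
  rewrite e1 in s1 s2.
  have f1 : 0 <= b * w ^+ 3 by rewrite mulr_ge0 // ltW.
  have f2 : b * w ^+ 3 <= w ^+ 3 by rewrite ler_piMl.
  have f3 : (b * w ^+ 3) ^+ 2 <= b * w ^+ 3 by rewrite expr2 ler_piMl //; clear -w3' f2; lra.
  have f3' : 0 <= (b * w ^+ 3) ^+ 2 by exact: sqr_ge0.
  have f4 : 0 <= b * w ^+ 15 by rewrite mulr_ge0 ?exprn_ge0 // ltW.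
  have f5 : b * w ^+ 15 <= b * w ^+ 3.
    by rewrite ler_pM2l //; exact: wle.
  have f6 : 0 <= b ^+ 4 by rewrite exprn_ge0 // ltW.
  move: s1 s2; rewrite ler_norml /es => s1 s2.
  apply/andP; split; clear -e2 f2 f3' f4 f5 s1 s2 f3 f6; lra.
pose gap : R := stirling_gap k.
have gb : `|gap - ln (2 * pi) / 2| <= 1 / (2 * k%:R) by exact: stirling.
(* [b >= w] means that [k] is at least the inverse of [w ^ 8], so Stirling's error [1 / (2 k)] is
   well below [w ^ 2]. *)
have kV : 1 / (2 * k%:R) <= w ^+ 2 :> R.
  have -> : w ^+ 2 = (X ^+ 2)^-1 by rewrite wX exprVn.
  rewrite div1r lef_pV2 ?posrE ?mulr_gt0 ?exprn_gt0 ?invr_gt0 //.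
  rewrite KE.
  have X1 : 1 <= X by rewrite /X invf_ge1.
  have X9 : 0 < X ^+ 9 by rewrite exprn_gt0 // (lt_le_trans ltr01).
  have : w * X ^+ 9 <= b * X ^+ 9 by rewrite ler_pM2r.
  have -> : w * X ^+ 9 = X ^+ 8 by rewrite wX; field.
  have : X ^+ 2 <= X ^+ 8 by apply: ler_weXn2l.
  have : 0 <= X ^+ 8 by rewrite exprn_ge0 // (le_trans ler01).
  clear -R; lra.
rewrite ln_bin ?k0 // -/s.
have -> : ln k`!%:R = gap + ((k%:R + 1 / 2) * ln k%:R - k%:R) :> R by rewrite /gap /stirling_gap; ring.
rewrite cE lt2.
have -> : ln c = ln k%:R + ln t - ln n%:R.
  by rewrite -cE tauE mulrA ln_div ?posrE ?mulr_gt0 // lnM ?posrE.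
rewrite lt1 tauE.
have sE : s = es - k%:R ^+ 2 / (2 * n%:R) - k%:R ^+ 3 / (6 * n%:R ^+ 2) by rewrite /es; ring.
have := exponent_bound w b mu th r1 r2 es.
rewrite w0 b0 => /(_ w1 b1 mu1 hth r1b r2b esb).
have := exponent_identity X b mu th r1 r2 es (ln k%:R) (ln n%:R) gap X0.
rewrite /= -wX -KE -NE -lE -/nu -/u -/t -/c => <- hb.
have b40 : 0 <= b ^+ 4 by rewrite exprn_ge0 // ltW.
have m30 : 0 <= `|mu| ^+ 3 * b by rewrite mulr_ge0 ?exprn_ge0 // ltW.
have m0 : 0 <= `|mu| by [].
rewrite sE.
set L := (k%:R - 1) * ln n%:R + _ + _ - _ - _ + _ in hb.
have -> : forall y, y - (- ln k%:R / 2 - ln (2 * pi) / 2 - Glam lam (k%:R * w ^+ 8)) =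
  (y - (- ln k%:R / 2 - gap - Glam lam (k%:R * w ^+ 8))) - (gap - ln (2 * pi) / 2) by move=> y; ring.
apply: le_trans (ler_normB _ _) _.
apply: le_trans (lerD hb gb) _.
clear -kV b40 m30 m0; lra.
Qed.

End PointExponent.

(** * The point probabilities up to a relative error [err] *)

Section PointAsymptotics.
Context {R : realType}.
Implicit Types (w b mu t c lam e y v E D : R) (n k : nat).

Lemma expR_half_ln x : 0 < x -> expR (ln x / 2) = Num.sqrt x :> R.
Proof.
move=> x0; have h : expR (ln x / 2) ^+ 2 = x.
  rewrite -expRM_natl.
  have -> : 2%:R * (ln x / 2) = ln x :> R by field.
  by rewrite lnK // posrE.
by rewrite -[in RHS]h sqrtr_sqr ger0_norm // expR_ge0.
Qed.

Lemma expR_sub1_norm e : `|expR e - 1| <= `|e| * expR `|e|.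
Proof.
have [e0|e0] := leP 0 e.
  have h1 : 1 <= expR e by rewrite -[leLHS]expR0 ler_expR.
  rewrite !ger0_norm ?subr_ge0 //.
  have h : (1 - e) * expR e <= 1.
    rewrite -[leRHS](expRxMexpNx_1 e) mulrC ler_pM2l ?expR_gt0 //.
    by have := expR_ge1Dx (- e).
  have -> : e * expR e = expR e - (1 - e) * expR e by ring.
  lra.
have h1 : expR e <= 1 by rewrite -[leRHS]expR0 ler_expR ltW.
rewrite ler0_norm ?subr_le0 // ltr0_norm //.
have h2 := expR_ge1Dx e.
have h3 : 1 <= expR (- e) by rewrite -[leLHS]expR0 ler_expR oppr_ge0 ltW.
have : - e * 1 <= - e * expR (- e) by apply: ler_wpM2l => //; rewrite oppr_ge0 ltW.
lra.
Qed.

(** Three relative errors: [expR e] from the exponent, [y = (n * tau) ^ 2] from replacing [tau] by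
    [1 / n] in [c ^ 2 / 2], and [v] from [boxes]. Boundedness of [E] keeps their product linear in
    [E]. *)
Lemma relative_error e y v E D : 0 <= E <= 5 -> 0 <= D ->
  `|e| <= 31 * E -> `|y - 1| <= 3 * E -> `|v| <= D * E ->
  `|expR e * (y * (1 + v)) - 1| <=
    (31 * expR (31 * 5) * (16 * (1 + 5 * D)) + 3 * (1 + 5 * D) + D) * E.
Proof.
move=> /andP[E0 E5] D0 he hy hv.
have v5 : `|v| <= 5 * D by have := ler_wpM2l D0 E5; lra.
have h1v : `|1 + v| <= 1 + 5 * D.
  by apply: le_trans (ler_normD _ _) _; rewrite normr1; lra.
have hyy : `|y| <= 16.
  have -> : y = (y - 1) + 1 by ring.
  by apply: le_trans (ler_normD _ _) _; rewrite normr1; lra.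
have hY : `|y * (1 + v)| <= 16 * (1 + 5 * D) by rewrite normrM; apply: ler_pM.
have hE : `|expR e - 1| <= 31 * expR (31 * 5) * E.
  apply: le_trans (expR_sub1_norm e) _.
  have -> : 31 * expR (31 * 5) * E = 31 * E * expR (31 * 5) by ring.
  have he5 : expR `|e| <= expR (31 * 5) by rewrite ler_expR; lra.
  exact: (ler_pM (normr_ge0 _) (expR_ge0 _) he he5).
have hY1 : `|y * (1 + v) - 1| <= 3 * (1 + 5 * D) * E + D * E.
  have -> : y * (1 + v) - 1 = (y - 1) * (1 + v) + v by ring.
  apply: le_trans (ler_normD _ _) _; apply: lerD => //.
  rewrite normrM.
  have -> : 3 * (1 + 5 * D) * E = 3 * E * (1 + 5 * D) by ring.
  exact: ler_pM.
have -> : expR e * (y * (1 + v)) - 1 = (expR e - 1) * (y * (1 + v)) + (y * (1 + v) - 1) by ring.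
apply: le_trans (ler_normD _ _) _; rewrite normrM.
have : `|expR e - 1| * `|y * (1 + v)| <= 31 * expR (31 * 5) * E * (16 * (1 + 5 * D)).
  exact: ler_pM.
have -> : (31 * expR (31 * 5) * (16 * (1 + 5 * D)) + 3 * (1 + 5 * D) + D) * E =
  31 * expR (31 * 5) * E * (16 * (1 + 5 * D)) + (3 * (1 + 5 * D) * E + D * E) by ring.
move=> h; exact: lerD.
Qed.

Lemma boxes_ge0 (q : R) k : 0 < q < 1 -> (0 < k)%N -> 0 <= boxes q k k.-1.
Proof.
move=> q01 k0; apply: le_trans (boxes_ge_ballot q q01 k k.-1 k0 (leq_pred k)).
rewrite mulr_ge0 ?exprn_ge0 //; first by rewrite ltW // one_sub_expr_gt0.
by rewrite subr_ge0 ler_pdivrMr ?ltr0n // mul1r ler_nat leq_pred.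
Qed.

(* Throughout [w = n ^ (-1/12)], so that [b = k / n ^ (3/4)] and
   [w / b = n ^ (2/3) / k]. *)
Definition err w lam k : R :=
  let b := k%:R * w ^+ 9 in let mu := lam * w in
  b ^+ 4 + `|mu| + `|mu| ^+ 3 * b + w / b + w ^+ 2.

Definition point_main w lam n k : R :=
  k%:R * Num.sqrt k%:R / (Num.sqrt (8 * pi) * n%:R ^+ 2) * expR (- Glam lam (k%:R * w ^+ 8)).

Lemma boxes_relative w t tau k : 0 < w <= 1 / 100 -> 98 / 100 <= t <= 102 / 100 ->
  (0 < k)%N -> w <= k%:R * w ^+ 9 <= 1 -> tau = w ^+ 12 * t ->
  let q := expR (- tau) in
  `|boxes q k k.-1 - (1 - q ^+ k) ^+ k.-1 * ((k%:R * tau) ^+ 2 / 2)| <=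
   (1 - q ^+ k) ^+ k.-1 * ((k%:R * tau) ^+ 2 / 2) *
    (9700 * 3 * (w / (k%:R * w ^+ 9) + w ^+ 2)).
Proof.
move=> /andP[w0 w1] /andP[t1 t2] k0 /andP[bw b1] tauE; cbv zeta.
set q := expR (- tau); set c := k%:R * tau; set b := k%:R * w ^+ 9 in bw b1 *.
have b0 : 0 < b by lra.
have wX m : 0 < w ^+ m by rewrite exprn_gt0.
have tau0 : 0 < tau by rewrite tauE mulr_gt0 //; lra.
have q01 : 0 < q < 1 := expRN_tau01 tau tau0.
have KR : 0 < k%:R :> R by rewrite ltr0n.
have cE : c = b * w ^+ 3 * t by rewrite /c /b tauE; ring.
have w2 : w ^+ 2 <= 1 / 100 * (1 / 100) by rewrite expr2; apply: ler_pM; clear -w0 w1; lra.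
have c2 : c <= 2 * w ^+ 2.
  rewrite cE.
  have h1 : b * w ^+ 3 <= w ^+ 3 by rewrite ler_piMl // ltW.
  have h2 : w ^+ 3 <= w ^+ 2 by apply: ler_wiXn2l => //; clear -w0 bw b1; lra.
  have h3 : b * w ^+ 3 * t <= w ^+ 2 * 2.
    by apply: ler_pM; [rewrite mulr_ge0 // ltW|(clear -t1; lra)|(clear -h1 h2; lra)|(clear -t2; lra)].
  clear -h3; lra.
have c1 : c <= 1 / 100 by lra.
have c0 : 0 <= c by rewrite mulr_ge0 // ltW.
(* [A] is [k / n^(2/3)], and [k c ^ 2 = A ^ 3 t ^ 2] with [t] near 1; the factor 2 in the hypothesis
   of [boxes_upper_asymp] absorbs [t]. *)
pose A := b / w.
have A1 : 1 <= A by rewrite /A ler_pdivlMr // mul1r.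
have AV : A^-1 = w / b by rewrite /A invf_div.
have kc2 : k%:R * c ^+ 2 = A ^+ 3 * t ^+ 2.
  rewrite /A cE.
  have -> : k%:R = b / w ^+ 9 by rewrite /b mulfK // gt_eqF.
  by field; rewrite gt_eqF.
have t21 : 96 / 100 <= t ^+ 2.
  have h98 : 0 <= 98 / 100 :> R by clear -R; lra.
  by rewrite expr2; have := ler_pM h98 h98 t1 t1; clear -R; lra.
have A3 : 0 <= A ^+ 3 by rewrite exprn_ge0 //; clear -A1; lra.
have hA : A ^+ 3 <= 2 * (k%:R * c ^+ 2).
  rewrite kc2; have : A ^+ 3 * (96 / 100) <= A ^+ 3 * t ^+ 2 by apply: ler_wpM2l.
  clear -A3; lra.
set W := (1 - q ^+ k) ^+ k.-1 * (c ^+ 2 / 2).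
have W0 : 0 <= W.
  rewrite mulr_ge0 ?divr_ge0 ?sqr_ge0 // exprn_ge0 // ltW //.
  exact: (one_sub_expr_gt0 q q01 k k0).
have al0 : 0 < w / b by rewrite divr_gt0.
have up : boxes q k k.-1 <= W * (1 + 9700 * (w / b + c)).
  by rewrite -AV; exact: (boxes_upper_asymp tau k A tau0 A1 c1 hA).
have lo : W * (1 - 9700 * (w / b + c)) <= boxes q k k.-1.
  (* [boxes_lower_asymp] has no such factor 2 and asks for a parameter of at least 100, hence
     [A / 2]. For [A < 200] the claimed lower bound is nonpositive, as [9700 / 200 > 1]. *)
  have [A200|A200] := leP 200 A.
    have h100 : 100 <= A / 2 by clear -A200; lra.
    have h3 : (A / 2) ^+ 3 <= k%:R * c ^+ 2.
      have -> : (A / 2) ^+ 3 = A ^+ 3 / 8 by field.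
      by clear -hA A3; lra.
    apply: le_trans (boxes_lower_asymp tau k (A / 2) tau0 h100 c1 h3).
    rewrite -/c -/q -/W; apply: ler_wpM2l => //.
    have -> : (A / 2)^-1 = 2 * (w / b) by rewrite -AV; field; rewrite gt_eqF // (lt_le_trans ltr01).
    by clear -al0 c0; lra.
  apply: le_trans (boxes_ge0 q k q01 k0).
  have h200 : 1 / 200 <= w / b.
    rewrite -AV div1r lef_pV2 ?posrE //; first exact: ltW.
    exact: lt_le_trans A1.
  apply: (mulr_ge0_le0 W0).
  by clear -c0 h200; lra.
have h : W * (9700 * (w / b + c)) <= W * (9700 * 3 * (w / b + w ^+ 2)).
  by apply: ler_wpM2l => //; have := wX 2%N; clear -c2 al0; clear -c2 al0; lra.
move: (boxes q k k.-1) up lo => B up lo; clearbody W.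
have {}up : B - W <= W * (9700 * 3 * (w / b + w ^+ 2)).
  by apply: le_trans h; rewrite lerBlDl; move: up; rewrite mulrDr mulr1.
have {}lo : - (W * (9700 * 3 * (w / b + w ^+ 2))) <= B - W.
  rewrite lerBrDr addrC; apply: le_trans lo; rewrite mulrBr mulr1; exact: lerB.
by rewrite ler_norml lo up.
Qed.

Lemma err_ge0 w lam k : 0 < w -> 0 <= err w lam k.
Proof.
move=> w0; have b0 : 0 <= k%:R * w ^+ 9 by rewrite mulr_ge0 // exprn_ge0 // ltW.
rewrite /err !addr_ge0 ?sqr_ge0 // ?exprn_ge0 //; last by rewrite divr_ge0 // ltW.
by apply: mulr_ge0 => //; exact: exprn_ge0.
Qed.

Lemma err_le5 w lam k : 0 < w <= 1 / 100 -> `|lam * w| <= 1 -> w <= k%:R * w ^+ 9 <= 1 ->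
  err w lam k <= 5.
Proof.
move=> /andP[w0 w1] mu1 /andP[bw b1]; rewrite /err; set b := _ * _ in bw b1 *.
have b0 : 0 < b by lra.
have h1 : b ^+ 4 <= 1 by apply: exprn_ile1 => //; exact: ltW.
have h2 : `|lam * w| ^+ 3 * b <= 1.
  exact: (mulr_ile1 (exprn_ge0 _ (normr_ge0 _)) (ltW b0) (exprn_ile1 _ (normr_ge0 _) mu1) b1).
have h3 : w / b <= 1 by rewrite ler_pdivrMr // mul1r.
have h4 : w ^+ 2 <= 1 by apply: exprn_ile1 => //; lra.
lra.
Qed.

Lemma point_asymp : exists2 C : R, 0 < C & forall w lam n k (v : 'I_n),
  0 < w <= 1 / 100 -> `|lam * w| <= 1 -> n%:R * w ^+ 12 = 1 -> (0 < k)%N ->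
  w <= k%:R * w ^+ 9 <= 1 ->
  `|gnp_prob (n%:R^-1 + lam * w ^+ 16) (fun G => comp_size G v == k) - point_main w lam n k|
    <= point_main w lam n k * (C * err w lam k).
Proof.
have D0 : 0 <= 9700 * 3 :> R by lra.
have BR := boxes_relative; move: BR D0; move: (9700 * 3 : R) => D BR D0.
exists (31 * expR (31 * 5) * (16 * (1 + 5 * D)) + 3 * (1 + 5 * D) + D).
  apply: ltr_wpDr => //; apply: addr_gt0; last lra.
  by apply: mulr_gt0; [rewrite mulr_gt0 ?expR_gt0|lra].
move=> w lam n k v hw mu1 nw k0 hb.
have E0 : 0 <= err w lam k by case/andP: hw => w0 _; exact: err_ge0.
have E5 := err_le5 w lam k hw mu1 hb.
have := point_exponent w lam n k hw mu1 nw k0 hb.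
have := tau_expand w lam n hw mu1 nw.
cbv zeta; set p := n%:R^-1 + _; set tau := - ln (1 - p).
move=> [/andP[p0 p1] tau0 [th /andP[th0 th1] tE]] hL.
have [w0 w1] := andP hw; have [bw b1] := andP hb.
have n0 : n%:R != 0 :> R.
  by apply/eqP => e; move: nw; rewrite e mul0r => /eqP; rewrite eq_sym oner_eq0.
have NR : 0 < n%:R :> R by rewrite lt_neqAle eq_sym n0 /=.
have KR : 0 < k%:R :> R by rewrite ltr0n.
have wX m : 0 < w ^+ m by rewrite exprn_gt0.
have wle m l : (l <= m)%N -> w ^+ m <= w ^+ l.
  by move=> lm; apply: ler_wiXn2l => //; clear -w0 bw b1; lra.
have kn : (k <= n)%N.
  rewrite -(ler_nat R) -(ler_pM2r (wX 12%N)) nw.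
  apply: le_trans b1; rewrite ler_pM2l //; exact: wle.
have qE : 1 - p = expR (- tau) by rewrite opprK lnK // posrE; clear -p1; lra.
set t := n%:R * tau in tE.
have tauE : tau = w ^+ 12 * t by rewrite /t mulrA [w ^+ 12 * _]mulrC nw mul1r.
set u := w ^+ 3 * (lam * w + th * w ^+ 9) in tE.
have w2 : w ^+ 2 <= 1 / 100 by exact: le_trans (wle 2%N 1%N isT) w1.
have uE : `|u| <= 1 / 100 * (`|lam * w| + 2 * w ^+ 2).
  rewrite /u normrM; apply: ler_pM => //.
    by rewrite ger0_norm ?(ltW (wX _)) //; exact: le_trans (wle 3%N 1%N isT) w1.
  apply: le_trans (ler_normD _ _) _; rewrite lerD2l normrM ger0_norm // ger0_norm ?(ltW (wX _)) //.
  by apply: ler_pM => //; [exact: ltW|exact: wle].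
have {}uE : `|u| <= 1 / 100 * (2 * err w lam k).
  apply: le_trans uE _; rewrite ler_pM2l; last (clear -R; lra).
  have b0 : 0 < k%:R * w ^+ 9 by clear -w0 bw; lra.
  rewrite /err.
  have h1 : 0 <= (k%:R * w ^+ 9) ^+ 4 by rewrite exprn_ge0 // ltW.
  have h2 : 0 <= `|lam * w| ^+ 3 * (k%:R * w ^+ 9).
    by rewrite mulr_ge0 // ?exprn_ge0 // ltW.
  have h3 : 0 <= w / (k%:R * w ^+ 9) by rewrite divr_ge0 // ltW.
  have h4 := normr_ge0 (lam * w).
  clear -h1 h2 h3 h4; lra.
have u1 : `|u| <= 2 / 100.
  have : 0 < w ^+ 2 := wX 2%N.
  rewrite /u normrM ger0_norm ?(ltW (wX _)) // => _.
  have h1 : w ^+ 3 <= 1 / 100 by exact: le_trans (wle 3%N 1%N isT) w1.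
  have h2 : `|lam * w + th * w ^+ 9| <= 2.
    apply: le_trans (ler_normD _ _) _; rewrite [`|th * _|]ger0_norm; last by rewrite mulr_ge0 // ltW.
    have : th * w ^+ 9 <= 2 * (1 / 100).
      apply: ler_pM => //; first exact: ltW.
      exact: le_trans (wle 9%N 1%N isT) w1.
    clear -mu1; lra.
  have : w ^+ 3 * `|lam * w + th * w ^+ 9| <= 1 / 100 * 2.
    by apply: ler_pM => //; exact: ltW.
  clear -R; lra.
have tt : 98 / 100 <= t <= 102 / 100.
  by move: u1; rewrite ler_norml tE => /andP[? ?]; apply/andP; split; lra.
have ty : `|t ^+ 2 - 1| <= 3 * err w lam k.
  have -> : t ^+ 2 - 1 = u * (2 + u) by rewrite tE; ring.
  rewrite normrM; have : `|2 + u| <= 3.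
    apply: le_trans (ler_normD _ _) _; rewrite ger0_norm; clear -u1; lra.
  move=> h; have := ler_pM (normr_ge0 u) (normr_ge0 (2 + u)) uE h.
  clear -E0; lra.
have := BR w t tau k hw tt k0 hb tauE.
rewrite /= -qE.
set S := (1 - (1 - p) ^+ k) ^+ k.-1; set B := boxes _ _ _; set W := S * _ => hB.
have S0 : 0 < 1 - (1 - p) ^+ k by apply: one_sub_expr_gt0 => //; rewrite qE; exact: expRN_tau01.
have W0 : 0 < W by rewrite /W mulr_gt0 ?exprn_gt0 // divr_gt0 ?exprn_gt0 // mulr_gt0.
pose y := (B - W) / W.
have BE : B = W * (1 + y) by rewrite /y; field; rewrite gt_eqF.
have hy : `|y| <= D * err w lam k.
  rewrite /y normrM [`|W^-1|]ger0_norm ?invr_ge0 ?(ltW W0) // ler_pdivrMr //.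
  apply: le_trans hB _; rewrite mulrC ler_pM2r //; apply: ler_wpM2l => //.
  rewrite /err.
  have b0 : 0 < k%:R * w ^+ 9 by clear -w0 bw; lra.
  have h1 : 0 <= (k%:R * w ^+ 9) ^+ 4 by rewrite exprn_ge0 // ltW.
  have h2 : 0 <= `|lam * w| ^+ 3 * (k%:R * w ^+ 9).
    by rewrite mulr_ge0 // ?exprn_ge0 // ltW.
  have h4 := normr_ge0 (lam * w).
  clear -h1 h2 h4; lra.
rewrite comp_size_law // -/B BE /W.
set L := _ + (k%:R - 1) * _ in hL; set M := - ln k%:R / 2 - _ - _ in hL.
pose e := L - M.
have he : `|e| <= 31 * err w lam k.
  apply: le_trans hL _; rewrite ler_pM2l; last (clear -R; lra).
  have h3 : 0 <= w / (k%:R * w ^+ 9) by rewrite divr_ge0 // ltW //; clear -w0 bw; lra.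
  by rewrite /err; clear -h3; lra.
have kE : k.-1%:R = k%:R - 1 :> R by rewrite -subn1 natrB.
have CE : 0 < ('C(n.-1, k.-1))%:R :> R.
  by rewrite ltr0n bin_gt0 -ltnS !prednK // (leq_trans k0).
have qkE : (1 - p) ^+ k = expR (- (k%:R * tau)) by rewrite qE -expRM_natl mulrN.
have LE : ('C(n.-1, k.-1))%:R * (1 - p) ^+ (k * (n - k)) * S = expR L.
  rewrite /L !expRD lnK ?posrE //; congr (_ * _ * _).
    rewrite {1}qE -expRM_natr natrM natrB //; congr expR; ring.
  by rewrite -qkE -kE expRM_natl lnK ?posrE.
have ME : expR M = (Num.sqrt k%:R * Num.sqrt (2 * pi))^-1 * expR (- Glam lam (k%:R * w ^+ 8)).
  have -> : M = - (ln k%:R / 2 + ln (2 * pi) / 2) + - Glam lam (k%:R * w ^+ 8) by rewrite /M; field.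
  rewrite expRD; congr (_ * _); rewrite expRN expRD !expR_half_ln //.
  by rewrite mulr_gt0 // pi_gt0.
(* [t = n * tau] carries the deviation of [(k tau) ^ 2 / 2] from [k ^ 2 / (2 n ^ 2)]; dividing
   [k ^ 2] by the [sqrt k] of Stirling's formula gives the power 3/2. *)
have PE : 'C(n.-1, k.-1)%:R * (1 - p) ^+ (k * (n - k)) *
    (S * ((k%:R * tau) ^+ 2 / 2) * (1 + y)) =
   point_main w lam n k * (expR e * (t ^+ 2 * (1 + y))).
  have -> : expR e = expR L / expR M by rewrite /e expRD expRN.
  have M0 := expR_gt0 M.
  have -> : point_main w lam n k = k%:R ^+ 2 / (2 * n%:R ^+ 2) * expR M.
    rewrite ME /point_main.
    have -> : Num.sqrt (8 * pi) = 2 * Num.sqrt (2 * pi) :> R.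
      have -> : 8 * pi = 2 ^+ 2 * (2 * pi) :> R by ring.
      by rewrite sqrtrM ?sqrtr_sqr ?ger0_norm // sqr_ge0.
    have s0 : 0 < Num.sqrt (2 * pi) :> R by rewrite sqrtr_gt0 mulr_gt0 // pi_gt0.
    have r0 : 0 < Num.sqrt k%:R :> R by rewrite sqrtr_gt0.
    move: s0; set P := Num.sqrt (2 * pi) => s0.
    have -> : k%:R ^+ 2 = k%:R * Num.sqrt k%:R * Num.sqrt k%:R :> R.
      by rewrite -mulrA -expr2 sqr_sqrtr ?ltW // expr2.
    move: r0; set Q := Num.sqrt _ => r0.
    by field; rewrite !gt_eqF.
  rewrite -LE /t; field.
  by rewrite n0 gt_eqF.
rewrite PE.
have g0 : 0 <= point_main w lam n k.
  by rewrite /point_main !mulr_ge0 ?expR_ge0 ?sqrtr_ge0 // invr_ge0 mulr_ge0 ?sqrtr_ge0 ?sqr_ge0.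
rewrite -[X in _ - X]mulr1 -mulrBr normrM ger0_norm //.
apply: ler_wpM2l => //; apply: relative_error => //.
by rewrite E0 E5.
Qed.

End PointAsymptotics.

(** * Summation along the tangent line of the exponent *)

Section Summation.
Context {R : realType}.
Implicit Types (x y a lam th rho D : R) (m M i k n : nat).

(** From [1 + x <= m (1 + x / m) <= m expR (x / m)]. It lets part of an exponential decay absorb
    polynomial factors. *)
Lemma pow1D_le_expR x m : 0 <= x -> (0 < m)%N -> (1 + x) ^+ m <= m%:R ^+ m * expR x.
Proof.
move=> x0 m0; have mR : 0 < m%:R :> R by rewrite ltr0n.
have m1 : 1 <= m%:R :> R by rewrite ler1n.
have -> : expR x = expR (x / m%:R) ^+ m by rewrite -expRM_natl mulrC divfK // gt_eqF.
rewrite -exprMn; apply: lerXn2r; rewrite ?nnegrE ?mulr_ge0 ?expR_ge0 //; first lra.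
have h := expR_ge1Dx (x / m%:R).
apply: le_trans (_ : m%:R * (1 + x / m%:R) <= _); last by rewrite ler_pM2l.
rewrite mulrDr mulr1 mulrCA mulfV ?mulr1 ?gt_eqF //; lra.
Qed.

Lemma geometric_sum th M :
  (1 - expR (- th)) * \sum_(0 <= i < M) expR (- (th * i%:R)) = 1 - expR (- (th * M%:R)).
Proof.
elim: M => [|M IH]; first by rewrite big_geq // mulr0 mulr0 oppr0 expR0 subrr.
rewrite big_nat_recr //= mulrDr IH.
have -> : - (th * M.+1%:R) = - th + - (th * M%:R) by rewrite -natr1; ring.
by rewrite expRD; ring.
Qed.

(** Uses [1 - expR (- th) >= th / (1 + th)]. With [geometric_sum_ge], the sum is [1 / th] up to an
    additive 1 and the truncation. *)
Lemma geometric_sum_le th M : 0 < th ->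
  \sum_(0 <= i < M) expR (- (th * i%:R)) <= 1 + th^-1.
Proof.
move=> th0; have h := geometric_sum th M.
have e0 := expR_gt0 (- (th * M%:R)).
have h1 : th / (1 + th) <= 1 - expR (- th).
  have h2 := expR_ge1Dx th.
  have h3 : expR (- th) <= (1 + th)^-1 by rewrite expRN lef_pV2 ?posrE ?expR_gt0 //; lra.
  have -> : th / (1 + th) = 1 - (1 + th)^-1 by field; rewrite gt_eqF //; lra.
  lra.
have d0 : 0 < th / (1 + th) by rewrite divr_gt0 //; lra.
set S := \sum_(_ <= _ < _) _ in h *.
have S0 : 0 <= S by apply: sumr_ge0 => i _; exact: expR_ge0.
have h4 : th / (1 + th) * S <= 1.
  by apply: le_trans (_ : (1 - expR (- th)) * S <= _); [apply: ler_wpM2r|lra].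
have -> : 1 + th^-1 = 1 / (th / (1 + th)) by field; rewrite !gt_eqF //; lra.
by rewrite ler_pdivlMr // mulrC.
Qed.

Lemma geometric_sum_ge th M : 0 < th ->
  (1 - expR (- (th * M%:R))) / th <= \sum_(0 <= i < M) expR (- (th * i%:R)).
Proof.
move=> th0; rewrite -geometric_sum ler_pdivrMr // mulrC.
apply: ler_wpM2l; first by apply: sumr_ge0 => i _; exact: expR_ge0.
by have := expR_ge1Dx (- th); lra.
Qed.

(** [dGlam lam a = (3 a - 2 lam) (a - 2 lam) / 8] vanishes at [a = 2 lam]; the condition
    [3 lam <= a] keeps a fixed relative distance from that zero. *)
Lemma dGlam_ge a lam : 0 <= a -> 3 * lam <= a -> (a + `|lam|) ^+ 2 / 25 <= dGlam lam a.
Proof.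
move=> a0 la; rewrite /dGlam; have [l0|l0] := leP 0 lam.
  by rewrite ger0_norm //; nra.
by rewrite ltr0_norm //; nra.
Qed.

Lemma dGlam_le a lam : 0 <= a -> dGlam lam a <= (a + `|lam|) ^+ 2.
Proof.
move=> a0; rewrite /dGlam; have [l0|l0] := leP 0 lam.
  by rewrite ger0_norm //; nra.
by rewrite ltr0_norm //; nra.
Qed.

Lemma Glam_shift a lam y :
  Glam lam (a + y) = Glam lam a + (dGlam lam a * y + ((3 * a / 8 - lam / 2) * y ^+ 2 + y ^+ 3 / 8)).
Proof. by rewrite /Glam /dGlam; field. Qed.

(** [2 x] is the linear increase of [Glam] over the shift [y]. The remainder is nonnegative because
    [3 a / 8 - lam / 2 >= 0], and small because [dGlam_ge] forces [y] to be of order at most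
    [x / (a + |lam|) ^ 2]. *)
Lemma shift_remainder a lam y x : 1 <= a -> 3 * lam <= a -> 0 <= x ->
  dGlam lam a * y = 2 * x ->
  0 <= (3 * a / 8 - lam / 2) * y ^+ 2 + y ^+ 3 / 8 <= (50 ^+ 2 + 50 ^+ 3) * (1 + x) ^+ 3 / a.
Proof.
move=> a1 la x0 yE; set s := a + `|lam|; have := normr_ge0 lam => l0.
have s1 : 1 <= s by rewrite /s; lra.
have s0 : 0 < s by lra.
have G0 : 0 < s ^+ 2 / 25 by rewrite divr_gt0 // exprn_gt0.
have hG : s ^+ 2 / 25 <= dGlam lam a by apply: dGlam_ge => //; lra.
have G1 : 0 < dGlam lam a by exact: lt_le_trans hG.
have y0 : 0 <= y by rewrite -(pmulr_rge0 _ G1) yE mulr_ge0.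
have yle : y <= 50 * (x / s ^+ 2).
  have : s ^+ 2 / 25 * y <= 2 * x by rewrite -yE ler_wpM2r.
  move=> h; rewrite mulrA ler_pdivlMr ?exprn_gt0 //; lra.
have c0 : 0 <= 3 * a / 8 - lam / 2 <= s.
  apply/andP; rewrite /s; have := ler_norm lam; have := ler_norm (- lam); rewrite normrN.
  by split; lra.
have [c1 c2] := andP c0.
have xs : 0 <= 50 * (x / s ^+ 2) by rewrite mulr_ge0 // divr_ge0 // exprn_ge0 // ltW.
have y2 : y ^+ 2 <= (50 * (x / s ^+ 2)) ^+ 2 by apply: lerXn2r.
have y3 : y ^+ 3 <= (50 * (x / s ^+ 2)) ^+ 3 by apply: lerXn2r.
have sa m : (0 < m)%N -> (s ^+ m)^-1 <= a^-1.
  move=> m0; rewrite lef_pV2 ?posrE ?exprn_gt0 //; last (clear -a1; lra).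
  apply: le_trans (_ : s <= _); first by rewrite /s; clear -l0; lra.
  exact: ler_eXnr.
apply/andP; split.
  by apply: addr_ge0; [apply: mulr_ge0 => //; exact: exprn_ge0|apply: divr_ge0 => //; exact: exprn_ge0].
rewrite -[leRHS]mulrA [leRHS]mulrDl; apply: lerD.
  apply: le_trans (_ : s * (50 * (x / s ^+ 2)) ^+ 2 <= _).
    by apply: ler_pM => //; exact: exprn_ge0.
  have -> : s * (50 * (x / s ^+ 2)) ^+ 2 = 50 ^+ 2 * (x ^+ 2 * (s ^+ 3)^-1).
    by field; rewrite gt_eqF.
  apply: ler_wpM2l; first exact: exprn_ge0.
  apply: ler_pM; rewrite ?exprn_ge0 ?invr_ge0 ?exprn_ge0 ?(ltW s0) //; last exact: sa.
  apply: le_trans (_ : (1 + x) ^+ 2 <= _); first by apply: lerXn2r; rewrite ?nnegrE //; clear -x0; lra.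
  by apply: ler_weXn2l => //; clear -x0; lra.
apply: le_trans (_ : y ^+ 3 <= _).
  by have : 0 <= y ^+ 3 by [exact: exprn_ge0]; clear -R; lra.
apply: le_trans y3 _.
have -> : (50 * (x / s ^+ 2)) ^+ 3 = 50 ^+ 3 * (x ^+ 3 * (s ^+ 6)^-1).
  by field; rewrite gt_eqF.
apply: ler_wpM2l; first exact: exprn_ge0.
apply: ler_pM; rewrite ?exprn_ge0 ?invr_ge0 ?exprn_ge0 ?(ltW s0) //; last exact: sa.
by apply: lerXn2r; rewrite ?nnegrE //; clear -x0; lra.
Qed.

(** [r] is the ratio of the main terms at [k + i] and [k], with [rho = i / k]. Of the decay
    [expR (- (2 * x))], one factor [expR (- x)] absorbs polynomials in [x] and the other stays
    summable. The last bound pays for the growth of [err] along the sum. *)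
Lemma tilted_ratio (C1 : R) : 0 <= C1 -> exists2 C : R, 0 < C &
  forall x a rho D, 0 <= x -> 1 <= a -> 0 <= rho -> rho <= 50 * x / a ->
   0 <= D <= C1 * (1 + x) ^+ 3 / a ->
   let r := (1 + rho) * Num.sqrt (1 + rho) * expR (- (2 * x + D)) in
   [/\ 0 <= r, `|r - expR (- (2 * x))| <= C / a * expR (- x) &
       r * (1 + rho) ^+ 4 <= C * expR (- x)].
Proof.
move=> C10.
have c60 : 0 < 50 ^+ 6 * 6%:R ^+ 6 :> R by apply: mulr_gt0; exact: exprn_gt0.
have c20 : 0 <= 50 ^+ 2 * 2%:R ^+ 2 :> R by apply: mulr_ge0; exact: exprn_ge0.
have c30 : 0 <= C1 * 3%:R ^+ 3 by apply: mulr_ge0 => //; exact: exprn_ge0.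
exists (50 ^+ 2 * 2%:R ^+ 2 + C1 * 3%:R ^+ 3 + 50 ^+ 6 * 6%:R ^+ 6).
  by apply: ltr_wpDl => //; exact: addr_ge0.
move: c60; set c6 : R := 50 ^+ 6 * _ => c60.
have c6E : c6 = 50 ^+ 6 * 6%:R ^+ 6 by [].
move: c20; set c2 : R := 50 ^+ 2 * _ => c20.
have c2E : c2 = 50 ^+ 2 * 2%:R ^+ 2 by [].
move: c30; set c3 : R := C1 * _ => c30.
have c3E : c3 = C1 * 3%:R ^+ 3 by [].
clearbody c2 c3 c6.
move=> x a rho D x0 a1 r0 rle /andP[D0 D1]; cbv zeta.
set r := _ * expR _.
have a0 : 0 < a by lra.
have av : 0 < a^-1 by rewrite invr_gt0.
have av1 : a^-1 <= 1 by rewrite invf_le1.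
have sq1 : 1 <= Num.sqrt (1 + rho).
  by rewrite -[leLHS]sqrtr1 ler_sqrt; clear -r0; lra.
have sq2 : Num.sqrt (1 + rho) <= 1 + rho.
  have -> : 1 + rho = Num.sqrt (1 + rho) ^+ 2 by rewrite sqr_sqrtr //; lra.
  by rewrite sqrtr_sqr ger0_norm; [rewrite expr2 ler_peMr//; lra|lra].
have m1 : 1 <= (1 + rho) * Num.sqrt (1 + rho).
  by rewrite -[leLHS]mulr1; apply: ler_pM => //; lra.
have m2 : (1 + rho) * Num.sqrt (1 + rho) <= (1 + rho) ^+ 2.
  by rewrite expr2 ler_pM2l //; lra.
have E2 : expR (- (2 * x)) = expR (- x) * expR (- x) by rewrite -expRD; congr expR; ring.
have Exx : expR (- x) * expR x = 1 by rewrite mulrC expRxMexpNx_1.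
have e0 := expR_gt0 (- x).
have p6 := pow1D_le_expR x 6 x0 isT.
have p2 := pow1D_le_expR x 2 x0 isT.
have p3 := pow1D_le_expR x 3 x0 isT.
have rx : rho <= 50 * x.
  by apply: le_trans rle _; rewrite ler_pdivrMr // ler_peMr // mulr_ge0.
have eD : expR (- (2 * x + D)) <= expR (- (2 * x)) by rewrite ler_expR; clear -D0; lra.
have eD' : expR (- (2 * x)) * (1 - D) <= expR (- (2 * x + D)).
  by rewrite opprD expRD ler_pM2l ?expR_gt0 // expR_ge1Dx.
have rge0 : 0 <= r by rewrite /r mulr_ge0 ?expR_ge0 //; clear -m1; lra.
have big0 : 0 <= c2 + c3 by exact: addr_ge0.
split => //.
- rewrite ler_norml; apply/andP; split.
    have h1 : expR (- (2 * x)) * (1 - D) <= r.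
      by apply: le_trans eD' _; rewrite /r ler_peMl // expR_ge0.
    have h2 : expR (- (2 * x)) * D <= c3 / a * expR (- x).
      apply: le_trans (_ : expR (- (2 * x)) * (C1 * (3%:R ^+ 3 * expR x) / a) <= _).
        rewrite ler_pM2l ?expR_gt0 //; apply: le_trans D1 _.
        by rewrite ler_pM2r //; apply: ler_wpM2l.
      rewrite E2 [leLHS](_ : _ = C1 * 3%:R ^+ 3 / a * expR (- x) * (expR (- x) * expR x)); last by ring.
      by rewrite Exx mulr1 c3E.
    have h3 : c3 / a * expR (- x) <= (c2 + c3 + c6) / a * expR (- x).
      by rewrite ler_pM2r // ler_pM2r //; clear -c6E c2E; lra.
    clear -h1 h2 h3; lra.
  have h1 : r <= (1 + rho) ^+ 2 * expR (- (2 * x)).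
    by rewrite /r; apply: ler_pM; rewrite ?expR_ge0 //; clear -m1; lra.
  have h2 : (1 + rho) ^+ 2 <= 1 + 50 ^+ 2 * (1 + x) ^+ 2 / a.
    have h21 : 2 * rho <= 100 * x / a by clear -rle; lra.
    have h22 : rho ^+ 2 <= 50 * x * (50 * x / a).
      by rewrite expr2; apply: ler_pM.
    have -> : (1 + rho) ^+ 2 = 1 + (2 * rho + rho ^+ 2) by ring.
    rewrite lerD2l; apply: le_trans (_ : (100 * x + 50 ^+ 2 * x ^+ 2) / a <= _).
      by rewrite [leRHS](_ : _ = 100 * x / a + 50 * x * (50 * x / a)); [(clear -h21 h22; lra)|ring].
    rewrite ler_pM2r //; have : 0 <= x ^+ 2 by exact: sqr_ge0.
    by have -> : (1 + x) ^+ 2 = 1 + 2 * x + x ^+ 2 by [ring]; clear -sq1 sq2 rx; lra.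
  have h3 : r - expR (- (2 * x)) <= 50 ^+ 2 * (1 + x) ^+ 2 / a * expR (- (2 * x)).
    rewrite lerBlDl; apply: le_trans h1 _.
    by have := ler_wpM2r (expR_ge0 (- (2 * x))) h2; rewrite [leRHS]mulrDl mul1r.
  have h4 : 50 ^+ 2 * (1 + x) ^+ 2 / a * expR (- (2 * x)) <= c2 / a * expR (- x).
    apply: le_trans (_ : 50 ^+ 2 * (2%:R ^+ 2 * expR x) / a * expR (- (2 * x)) <= _).
      by rewrite ler_pM2r ?expR_gt0 // ler_pM2r // ler_pM2l ?exprn_gt0.
    rewrite E2 [leLHS](_ : _ = 50 ^+ 2 * 2%:R ^+ 2 / a * expR (- x) * (expR (- x) * expR x)); last by ring.
    by rewrite Exx mulr1 c2E.
  have h5 : c2 / a * expR (- x) <= (c2 + c3 + c6) / a * expR (- x).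
    by rewrite ler_pM2r // ler_pM2r // -addrA lerDl; apply: addr_ge0 => //; exact: ltW.
  clear -h3 h4 h5; lra.
- have h1 : r <= (1 + rho) ^+ 2 * expR (- (2 * x)).
    by rewrite /r; apply: ler_pM; rewrite ?expR_ge0 //; clear -m1; lra.
  have h2 : r * (1 + rho) ^+ 4 <= (1 + rho) ^+ 6 * expR (- (2 * x)).
    have -> : (1 + rho) ^+ 6 * expR (- (2 * x)) = (1 + rho) ^+ 2 * expR (- (2 * x)) * (1 + rho) ^+ 4 by ring.
    by apply: ler_wpM2r => //; apply: exprn_ge0; clear -sq1 sq2; lra.
  have h3 : (1 + rho) ^+ 6 <= c6 * expR x.
    apply: le_trans (_ : (50 * (1 + x)) ^+ 6 <= _).
      by apply: lerXn2r; rewrite ?nnegrE; clear -sq1 sq2 rx; lra.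
    by rewrite exprMn c6E -mulrA ler_pM2l ?exprn_gt0.
  have h4 : (1 + rho) ^+ 6 * expR (- (2 * x)) <= c6 * expR (- x).
    apply: le_trans (_ : c6 * expR x * expR (- (2 * x)) <= _); first by rewrite ler_pM2r ?expR_gt0.
    rewrite E2 [leLHS](_ : _ = c6 * expR (- x) * (expR (- x) * expR x)); last by ring.
    by rewrite Exx mulr1.
  apply: le_trans h2 _; apply: le_trans h4 _; rewrite ler_pM2r //; clear -big0; lra.
Qed.

End Summation.

(** * Summation of the point probabilities up to [n^(3/4)] *)

Section PartialSum.
Context {R : realType}.
Implicit Types (x y a lam th rho D w : R) (m M i k n : nat).

Definition excess a lam y : R := (3 * a / 8 - lam / 2) * y ^+ 2 + y ^+ 3 / 8.

Lemma point_main_shift w lam n k i : 0 < w -> (0 < k)%N ->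
  let a := k%:R * w ^+ 8 in let th := w ^+ 8 * dGlam lam a in
  let rho := i%:R / k%:R in
  point_main w lam n (k + i) = point_main w lam n k *
    ((1 + rho) * Num.sqrt (1 + rho) *
     expR (- (2 * (th * i%:R / 2) + excess a lam (i%:R * w ^+ 8)))).
Proof.
move=> w0 k0; cbv zeta.
have KR : 0 < k%:R :> R by rewrite ltr0n.
have iE : k%:R + i%:R = k%:R * (1 + i%:R / k%:R) :> R by field; rewrite gt_eqF.
rewrite /point_main natrD [(_ + _) * w ^+ 8]mulrDl Glam_shift -/(excess _ _ _).
set G := Glam _ _; set D := excess _ _ _; set T := dGlam _ _.
have -> : - (G + (T * (i%:R * w ^+ 8) + D)) = - G + - (2 * (w ^+ 8 * T * i%:R / 2) + D).
  by field.
rewrite expRD iE.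
have r0 : 0 <= i%:R / k%:R :> R by exact: divr_ge0.
move: (i%:R / k%:R) r0 => rho r0.
rewrite sqrtrM ?ltW //.
set E1 := expR _; set E2 := expR _; ring.
Qed.

(** Only the term [b ^ 4] grows as fast as the fourth power, and [w / b] decreases. *)
Lemma err_shift w lam k i : 0 < w -> (0 < k)%N ->
  err w lam (k + i) <= err w lam k * (1 + i%:R / k%:R) ^+ 4.
Proof.
move=> w0 k0; have KR : 0 < k%:R :> R by rewrite ltr0n.
have r0 : 0 <= i%:R / k%:R :> R by exact: divr_ge0.
rewrite /err natrD.
have -> : k%:R + i%:R = k%:R * (1 + i%:R / k%:R) :> R by field; rewrite gt_eqF.
move: (i%:R / k%:R) r0 => rho r0.
rewrite [k%:R * (1 + rho) * w ^+ 9](_ : _ = k%:R * w ^+ 9 * (1 + rho)); last by ring.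
have b0 : 0 < k%:R * w ^+ 9 by rewrite mulr_gt0 // exprn_gt0.
move: (k%:R * w ^+ 9) b0 => b b0; have mu0 := normr_ge0 (lam * w).
move: (`|lam * w|) mu0 => mu mu0; rewrite !mulrDl.
have q1 : 1 <= 1 + rho by lra.
have q4 : 1 <= (1 + rho) ^+ 4 by apply: exprn_ege1.
have q41 : 1 + rho <= (1 + rho) ^+ 4 by exact: ler_eXnr.
have q0 : 0 < 1 + rho by lra.
apply: lerD; [apply: lerD; [apply: lerD; [apply: lerD|]|]|].
- by rewrite exprMn.
- exact: ler_peMr.
- by rewrite mulrA ler_wpM2l // mulr_ge0 ?exprn_ge0 // ltW.
- apply: le_trans (_ : w / b <= _).
    rewrite ler_pM2l // lef_pV2 ?posrE ?mulr_gt0 // ler_peMr // ltW //.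
  by rewrite ler_peMr // divr_ge0 // ltW.
- by rewrite ler_peMr // exprn_ge0 // ltW.
Qed.

Lemma point_main_ge0 w lam n k : 0 <= point_main w lam n k.
Proof.
by rewrite /point_main !mulr_ge0 ?expR_ge0 ?sqrtr_ge0 // invr_ge0 mulr_ge0 ?sqrtr_ge0 ?sqr_ge0.
Qed.

(** Consecutive terms have ratio about [exp (- th)] with [th = O(n^(-1/6))], so the additive 1 of a
    geometric sum is small against [1 / th]. *)
Lemma rate_le w lam a : 0 < w <= 1 / 100 -> `|lam * w| <= 1 -> 0 <= a -> a * w <= 1 ->
  w ^+ 8 * dGlam lam a <= 4 * w ^+ 2.
Proof.
move=> /andP[w0 w1] mu1 a0 aw.
apply: le_trans (_ : w ^+ 8 * (a + `|lam|) ^+ 2 <= _).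
  by apply: ler_wpM2l; [rewrite exprn_ge0 // ltW|exact: dGlam_le].
have -> : w ^+ 8 * (a + `|lam|) ^+ 2 = (a * w + `|lam * w|) ^+ 2 * w ^+ 6.
  by rewrite normrM [`|w|]ger0_norm ?(ltW w0) //; ring.
apply: ler_pM.
- exact: sqr_ge0.
- by rewrite exprn_ge0 // ltW.
- have h : 0 <= a * w by rewrite mulr_ge0 // ltW.
  have -> : 4 = 2 ^+ 2 :> R by ring.
  have h2 := normr_ge0 (lam * w).
  by apply: lerXn2r; rewrite ?nnegrE; lra.
- by apply: ler_wiXn2l => //; lra.
Qed.

(** Each term is compared with [m * expR (- (th * i))], with an error that still decays at half the
    rate; the geometric sums then give [m / th] up to truncation at [M]. *)
Lemma partial_sum : exists2 C : R, 0 < C & forall w lam n k M (v : 'I_n),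
  0 < w <= 1 / 100 -> `|lam * w| <= 1 -> n%:R * w ^+ 12 = 1 -> (0 < k)%N ->
  1 <= k%:R * w ^+ 8 -> 3 * lam <= k%:R * w ^+ 8 -> k%:R * w ^+ 9 <= 1 ->
  (forall i, (i < M)%N -> (k + i)%:R * w ^+ 9 <= 1) ->
  let th := w ^+ 8 * dGlam lam (k%:R * w ^+ 8) in
  let P j := gnp_prob (n%:R^-1 + lam * w ^+ 16) (fun G => comp_size G v == j) in
  [/\ 0 < th & `|\sum_(0 <= i < M) P (k + i)%N - point_main w lam n k / th|
    <= point_main w lam n k / th * (C * err w lam k + expR (- (th * M%:R)))].
Proof.
have [C0 C00 hC0] := @point_asymp R.
have C10 : 0 <= 50 ^+ 2 + 50 ^+ 3 :> R by rewrite addr_ge0 // exprn_ge0.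
have [C2 C20 hC2] := tilted_ratio _ C10.
have SR := @shift_remainder R.
move: (50 ^+ 2 + 50 ^+ 3) C10 hC2 SR => C1 C10 hC2 SR.
exists (3 * (C2 * (C0 + 1)) + 4).
  by rewrite addr_gt0 // mulr_gt0 // mulr_gt0 // addr_gt0.
move=> w lam n k M v hw mu1 nw k0 a1 la bk hM; cbv zeta.
set a := k%:R * w ^+ 8 in a1 la *; set th := w ^+ 8 * _.
have [w0 w1] := andP hw.
have KR : 0 < k%:R :> R by rewrite ltr0n.
have a0 : 0 < a by clear -a1; lra.
have aw : a * w = k%:R * w ^+ 9 by rewrite /a; ring.
have W8 : 0 < w ^+ 8 by rewrite exprn_gt0.
have G25 : 1 <= 25 * dGlam lam a.
  have := dGlam_ge a lam (ltW a0) la; have : 1 <= (a + `|lam|) ^+ 2.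
    by apply: exprn_ege1; have := normr_ge0 lam; clear -a1; lra.
  clear -R; lra.
have th0 : 0 < th by rewrite mulr_gt0 //; clear -G25; lra.
have th4 : th <= 4 * w ^+ 2 by apply: rate_le => //; [exact: ltW|rewrite aw].
have w2 : w ^+ 2 <= 1 / 100.
  by apply: le_trans w1; apply: ler_iXnr => //; clear -w0 hw; lra.
have th1 : th <= 1 by clear -th4 w2; lra.
set E := err w lam k.
have b0 : 0 < k%:R * w ^+ 9 by rewrite mulr_gt0 // exprn_gt0.
have aE : a^-1 = w / (k%:R * w ^+ 9) by rewrite /a; field; rewrite !gt_eqF.
have [aE1 wE1] : a^-1 <= E /\ w ^+ 2 <= E.
  have h1 : 0 <= (k%:R * w ^+ 9) ^+ 4 by rewrite exprn_ge0 // ltW.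
  have h2 := normr_ge0 (lam * w).
  have h3 : 0 <= `|lam * w| ^+ 3 * (k%:R * w ^+ 9) by rewrite mulr_ge0 ?exprn_ge0 // ltW.
  have h4 : 0 < a^-1 by rewrite invr_gt0.
  have h5 : 0 <= w ^+ 2 by exact: sqr_ge0.
  by rewrite /E /err -aE; split; clear -h1 h2 h3 h5 h4; lra.
have E0 : 0 <= E by exact: err_ge0.
set m := point_main w lam n k.
have m0 : 0 <= m := point_main_ge0 w lam n k.
split=> //.
pose P j := gnp_prob (n%:R^-1 + lam * w ^+ 16) (fun G => comp_size G v == j).
rewrite -/(P _).
have term i : (i < M)%N ->
  `|P (k + i)%N - m * expR (- (th * i%:R))| <= m * E * (C2 * (C0 + 1)) * expR (- (th / 2 * i%:R)).
  move=> iM; set x := th * i%:R / 2.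
  have x0 : 0 <= x by rewrite divr_ge0 // mulr_ge0 // ltW.
  have rho0 : 0 <= i%:R / k%:R :> R by exact: divr_ge0.
  have rhox : i%:R / k%:R <= 50 * x / a.
    have -> : 50 * x / a = 25 * dGlam lam a * (i%:R / k%:R).
      by rewrite /x /th; move: (dGlam lam a) => G; rewrite /a; field; rewrite !gt_eqF.
    by rewrite ler_peMl.
  have yE : dGlam lam a * (i%:R * w ^+ 8) = 2 * x by rewrite /x /th; field.
  have hD := SR a lam (i%:R * w ^+ 8) x a1 la x0 yE.
  have [r0 r1 r2] := hC2 x a _ _ x0 a1 rho0 rhox hD.
  have mS := point_main_shift w lam n k i w0 k0.
  move: r0 r1 r2 mS; cbv zeta; rewrite -/a -/th -/x -/m -/(excess _ _ _).
  set r := _ * expR _ => r0 r1 r2 mS; clearbody r.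
  have ex2 : expR (- (2 * x)) = expR (- (th * i%:R)) by congr expR; rewrite /x; field.
  have ex1 : expR (- x) = expR (- (th / 2 * i%:R)) by congr expR; rewrite /x; field.
  rewrite -ex2 -ex1.
  have ki0 : (0 < k + i)%N by rewrite addn_gt0 k0.
  have bi : w <= (k + i)%:R * w ^+ 9 <= 1.
    apply/andP; split; last exact: hM.
    apply: le_trans (_ : k%:R * w ^+ 9 <= _); first by rewrite -aw ler_peMl // ltW.
    by rewrite ler_wpM2r ?exprn_ge0 ?(ltW w0) // ler_nat leq_addr.
  have hP := hC0 w lam n (k + i)%N v hw mu1 nw ki0 bi.
  rewrite -/(P _) mS in hP.
  have hE := err_shift w lam k i w0 k0.
  rewrite -/E in hE.
  have h1 : m * r * (C0 * err w lam (k + i)) <= m * E * (C2 * C0) * expR (- x).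
    apply: le_trans (_ : m * r * (C0 * (E * (1 + i%:R / k%:R) ^+ 4)) <= _).
      by apply: ler_wpM2l; [exact: mulr_ge0|rewrite ler_pM2l].
    rewrite [leLHS](_ : _ = m * E * C0 * (r * (1 + i%:R / k%:R) ^+ 4)); last by ring.
    rewrite [leRHS](_ : _ = m * E * C0 * (C2 * expR (- x))); last by ring.
    by apply: ler_wpM2l => //; rewrite mulr_ge0 ?mulr_ge0 // ltW.
  have h2 : `|m * r - m * expR (- (2 * x))| <= m * E * C2 * expR (- x).
    rewrite -mulrBr normrM ger0_norm // [leRHS](_ : _ = m * (E * C2 * expR (- x))); last by ring.
    apply: ler_wpM2l => //; apply: le_trans r1 _.
    by rewrite ler_pM2r ?expR_gt0 // mulrC ler_pM2r.
  have -> : P (k + i)%N - m * expR (- (2 * x)) =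
    (P (k + i)%N - m * r) + (m * r - m * expR (- (2 * x))) by ring.
  apply: le_trans (ler_normD _ _) _.
  have -> : m * E * (C2 * (C0 + 1)) * expR (- x) =
    m * E * (C2 * C0) * expR (- x) + m * E * C2 * expR (- x) by ring.
  by apply: lerD => //; exact: le_trans hP h1.
set S := \sum_(0 <= i < M) expR (- (th * i%:R)).
have hS1 : `|\sum_(0 <= i < M) P (k + i)%N - m * S| <= m / th * (3 * (C2 * (C0 + 1)) * E).
  rewrite /S mulr_sumr -sumrB; apply: le_trans (ler_norm_sum _ _ _) _.
  apply: le_trans (_ : \sum_(0 <= i < M) m * E * (C2 * (C0 + 1)) * expR (- (th / 2 * i%:R)) <= _).
    rewrite !big_mkord; apply: ler_sum => i _; exact: term.
  rewrite -mulr_sumr.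
  have th2 : 0 < th / 2 by rewrite divr_gt0.
  have K0 : 0 <= m * E * (C2 * (C0 + 1)).
    by rewrite mulr_ge0 ?mulr_ge0 // ?addr_ge0 // ltW.
  have h : 1 + (th / 2)^-1 <= 3 / th.
    rewrite ler_pdivlMr // mulrDl mul1r invf_div divfK ?gt_eqF //; clear -th1; lra.
  apply: le_trans (_ : m * E * (C2 * (C0 + 1)) * (3 / th) <= _).
    by apply: ler_wpM2l => //; apply: le_trans h; exact: geometric_sum_le.
  by rewrite [leRHS](_ : _ = m * E * (C2 * (C0 + 1)) * (3 / th)) //; ring.
have hS2 : `|m * S - m / th| <= m / th * (4 * E + expR (- (th * M%:R))).
  have -> : m * S - m / th = m * (S - th^-1) by ring.
  rewrite normrM ger0_norm // -[leRHS]mulrA; apply: ler_wpM2l => //.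
  have e0 := expR_gt0 (- (th * M%:R)).
  have hl := geometric_sum_le th M th0; have hg := geometric_sum_ge th M th0.
  rewrite -/S in hl hg.
  have tv : 0 < th^-1 by rewrite invr_gt0.
  (* The additive 1 is absorbed here: [th <= 4 w ^ 2], and [w ^ 2] is one of the terms of [err]. *)
  have h4 : 1 <= th^-1 * (4 * E) by rewrite mulrC ler_pdivlMr //; clear -th4 wE1; lra.
  have h5 : 0 < th^-1 * expR (- (th * M%:R)) by exact: mulr_gt0.
  have h6 : (1 - expR (- (th * M%:R))) / th = th^-1 - th^-1 * expR (- (th * M%:R)) by ring.
  rewrite h6 in hg; rewrite mulrDr.
  by move: (th^-1 * (4 * E)) (th^-1 * expR _) h4 h5 hg => A B h4 h5 hg;
     rewrite ler_norml; apply/andP; split; clear -h4 hg hl h5; lra.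
have -> : \sum_(0 <= i < M) P (k + i)%N - m / th =
  (\sum_(0 <= i < M) P (k + i)%N - m * S) + (m * S - m / th) by ring.
apply: le_trans (ler_normD _ _) _; apply: le_trans (lerD hS1 hS2) _.
by rewrite -mulrDr; apply: ler_wpM2l; [rewrite divr_ge0 // ltW|rewrite [leLHS]addrA -mulrDl].
Qed.

End PartialSum.

(** * Components larger than n^(3/4) *)

Section Tail.
Context {R : realType}.
Implicit Types (x y a lam th w s u : R) (m M i j k l n : nat).

(** One term of the expansion of [(1 - z + z s) ^ m]: Chernoff's bound for a single value. *)
Lemma binomial_term_le (z s : R) m l : (l <= m)%N -> 0 <= z <= 1 -> 0 <= s ->
  ('C(m, l))%:R * (1 - z) ^+ (m - l) * z ^+ l * s ^+ l <= (1 - z + z * s) ^+ m.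
Proof.
move=> lm /andP[z0 z1] s0; rewrite [leRHS]exprDn.
rewrite (bigD1 (Ordinal (lm : l < m.+1)%N)) //=.
set S := \sum_(_ | _) _.
have -> : 'C(m, l)%:R * (1 - z) ^+ (m - l) * z ^+ l * s ^+ l =
  ((1 - z) ^+ (m - l) * (z * s) ^+ l) *+ 'C(m, l) by rewrite exprMn -mulr_natl; ring.
rewrite lerDl.
apply: sumr_ge0 => i _; rewrite mulrn_wge0 // mulr_ge0 ?exprn_ge0 //; first lra.
exact: mulr_ge0.
Qed.

Lemma expR_le3 y : 0 <= y <= 1 / 5 -> expR y <= 1 + y + y ^+ 2 / 2 + y ^+ 3 / 4.
Proof.
move=> /andP[y0 y1].
have h := expRN_ge y y0; have e0 := expR_gt0 y.
have h1 : expR y * (1 - y + y ^+ 2 / 2 - y ^+ 3 / 6) <= 1.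
  by rewrite -[leRHS](expRxMexpNx_1 y) ler_pM2l.
have c0 : 0 < 1 - y + y ^+ 2 / 2 - y ^+ 3 / 6.
  have : y ^+ 3 <= y ^+ 2 by apply: ler_wiXn2l => //; lra.
  have := sqr_ge0 y; lra.
rewrite -(ler_pM2r c0); apply: le_trans h1 _; rewrite -subr_ge0.
have -> : (1 + y + y ^+ 2 / 2 + y ^+ 3 / 4) * (1 - y + y ^+ 2 / 2 - y ^+ 3 / 6) - 1 =
  y ^+ 3 * (1 / 12 - y / 6 + y ^+ 2 * (1 - y) / 24) by field.
apply: mulr_ge0; first exact: exprn_ge0.
have : 0 <= y ^+ 2 * (1 - y) by apply: mulr_ge0; [exact: sqr_ge0|lra].
lra.
Qed.

(** Here [u = j / n]. As [lam <= n^(1/12) / 5] and [u >= n^(-1/4)], [j * tau] is at most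
    [u + 21/100 * u ^ 2]; the coefficient 29/100 is [1/2 - 21/100]. *)
Lemma extinction_gap u : 0 < u <= 1 ->
  1 - expR (- (u + 21 / 100 * u ^+ 2)) <= u - u ^+ 2 * (29 / 100 - 9 / 100 * u).
Proof.
move=> /andP[u0 u1]; set y := u + _.
have u2 : 0 <= u ^+ 2 by exact: sqr_ge0.
have y0 : 0 <= y by rewrite /y; lra.
have h := expRN_ge y y0.
apply: le_trans (_ : y - y ^+ 2 / 2 + y ^+ 3 / 6 <= _); first lra.
set v := 1 + 21 / 100 * u; have yE : y = u * v by rewrite /y /v; ring.
have v0 : 0 <= v by rewrite /v; lra.
have v1 : v <= 121 / 100 by rewrite /v; lra.
have v2 : v ^+ 2 <= 147 / 100.
  by rewrite expr2; have := ler_pM v0 v0 v1 v1; lra.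
have v3 : v ^+ 3 <= 9 / 5.
  by rewrite exprSr; have := ler_pM (sqr_ge0 v) v0 v2 v1; lra.
have v2' : 1 + 42 / 100 * u <= v ^+ 2.
  by have -> : v ^+ 2 = 1 + 42 / 100 * u + (21 / 100 * u) ^+ 2 by [rewrite /v; field]; rewrite lerDl sqr_ge0.
have u3 : 0 <= u ^+ 3 by rewrite exprn_ge0 // ltW.
rewrite yE !exprMn.
have h2 := ler_wpM2l u2 v2'; have h3 := ler_wpM2l u3 v3.
have -> : u * v = u + 21 / 100 * u ^+ 2 by rewrite /v; ring.
have u3E : u ^+ 2 * u = u ^+ 3 by ring.
rewrite mulrDr mulr1 mulrCA u3E in h2.
rewrite [u ^+ 2 * (29 / 100 - _)](_ : _ = 29 / 100 * u ^+ 2 - 9 / 100 * u ^+ 3); last by ring.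
move: (u ^+ 2 * v ^+ 2) (u ^+ 3 * v ^+ 3) h2 h3 => A B h2 h3; clear -h2 h3; lra.
Qed.

(** The Chernoff exponent. For small [u] its coefficient of [u ^ 3] is [1/50 - 29/500]; [-1/60] is
    valid on all of [(0, 1]], and a constant above 1/80 is what [E2] asks for. *)
Lemma tail_exponent (N u z s : R) : 0 <= N -> 0 < u <= 1 -> 0 <= z ->
  z <= u - u ^+ 2 * (29 / 100 - 9 / 100 * u) -> s <= 1 + u / 5 + (u / 5) ^+ 2 / 2 + (u / 5) ^+ 3 / 4 ->
  1 <= s ->
  N * z * (s - 1) - u / 5 * (N * u) <= - (N * u ^+ 3 / 60).
Proof.
move=> N0 /andP[u0 u1] z0 hz hs s1.
have -> : N * z * (s - 1) - u / 5 * (N * u) = N * (z * (s - 1) - u ^+ 2 / 5) by ring.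
have -> : - (N * u ^+ 3 / 60) = N * (- (u ^+ 3 / 60)) by ring.
apply: ler_wpM2l => //.
set d := 29 / 100 - 9 / 100 * u in hz.
have d0 : 20 / 100 <= d by rewrite /d; lra.
have hs1 : s - 1 <= u / 5 + (u / 5) ^+ 2 / 2 + (u / 5) ^+ 3 / 4 by lra.
have zs := ler_pM z0 _ hz hs1.
apply: le_trans (lerB (zs _) (lexx _)) _; first lra.
have -> : (u - u ^+ 2 * d) * (u / 5 + (u / 5) ^+ 2 / 2 + (u / 5) ^+ 3 / 4) - u ^+ 2 / 5 =
  u ^+ 3 * (1 / 50 + u / 500 - d / 5 - d * (u / 50 + u ^+ 2 / 500)) by field.
have -> : - (u ^+ 3 / 60) = u ^+ 3 * (- (1 / 60)) by ring.
rewrite ler_pM2l ?exprn_gt0 //.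
have : 0 <= d * (u / 50 + u ^+ 2 / 500).
  by apply: mulr_ge0; [(clear -d0; lra)|have := sqr_ge0 u; (clear -u0; lra)].
rewrite /d; lra.
Qed.

(* Dropping the queue constraint bounds the probability by that of the event
   Bin(n - 1, 1 - q ^ j) = j - 1; Chernoff with parameter [u / 5], [u = j / n]. *)
Lemma tail_point w lam n j (v : 'I_n) : 0 < w <= 1 / 100 -> -1 <= lam * w <= 1 / 5 ->
  n%:R * w ^+ 12 = 1 -> (0 < j <= n)%N -> 1 <= j%:R * w ^+ 9 ->
  gnp_prob (n%:R^-1 + lam * w ^+ 16) (fun G => comp_size G v == j) <=
    expR (1 / 5) * expR (- ((w ^+ 3)^-1 / 60)).
Proof.
move=> hw /andP[mu0 mu1] nw /andP[j0 jn] bj; have [w0 w1] := andP hw.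
have mun : `|lam * w| <= 1 by rewrite ler_norml; apply/andP; split; lra.
have := tau_expand w lam n hw mun nw.
cbv zeta; set p := n%:R^-1 + _; set tau := - ln (1 - p).
move=> [/andP[p0 p1] tau0 [th /andP[th0 th1] tE]].
have n0 : n%:R != 0 :> R.
  by apply/eqP => e; move: nw; rewrite e mul0r => /eqP; rewrite eq_sym oner_eq0.
have NR : 0 < n%:R :> R by rewrite lt_neqAle eq_sym n0 /=.
have JR : 0 < j%:R :> R by rewrite ltr0n.
have W m : 0 < w ^+ m by rewrite exprn_gt0.
have qE : 1 - p = expR (- tau) by rewrite opprK lnK // posrE; clear -p1; lra.
clearbody tau.
pose u := j%:R * w ^+ 12.
have u0 : 0 < u by rewrite mulr_gt0.
have u1 : u <= 1 by rewrite -nw ler_pM2r // ler_nat.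
have uw : w ^+ 3 <= u.
  have -> : u = j%:R * w ^+ 9 * w ^+ 3 by rewrite /u; ring.
  by rewrite ler_peMl // ltW.
have q01 : 0 < 1 - p < 1 by apply/andP; split; clear -p1 p0; lra.
set z := 1 - (1 - p) ^+ j.
have z0 : 0 < z := one_sub_expr_gt0 _ q01 j j0.
have z1 : z <= 1 by rewrite lerBlDr lerDl exprn_ge0 // ltW //; case/andP: q01.
have zE : 1 - z = (1 - p) ^+ j by rewrite /z; ring.
have hz : z <= u - u ^+ 2 * (29 / 100 - 9 / 100 * u).
  apply: le_trans (extinction_gap u _); last by rewrite u0 u1.
  rewrite /z lerD2l lerN2 qE -expRM_natl ler_expR mulrN lerN2.
  have -> : j%:R * tau = u * (n%:R * tau).
    rewrite -[LHS]mulr1 -nw /u; ring.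
  have -> : u + 21 / 100 * u ^+ 2 = u * (1 + u * (21 / 100)) by ring.
  rewrite ler_pM2l // tE lerD2l.
  (* The bound [lam * w <= 1/5] leaves 1/100 for the second-order term [th * w ^ 9]. *)
  apply: le_trans (_ : w ^+ 3 * (21 / 100) <= _); last by rewrite ler_pM2r.
  rewrite ler_pM2l //.
  have w9 : w ^+ 9 <= 1 / 100 * (1 / 100).
    apply: le_trans (_ : w ^+ 2 <= _); first by apply: ler_wiXn2l => //; clear -w0 w1; lra.
    by rewrite expr2; apply: ler_pM; clear -w0 w1; lra.
  have := W 9%N; have : th * w ^+ 9 <= 2 * (1 / 100 * (1 / 100)).
    by apply: ler_pM => //; exact: ltW.
  clear -mu1; lra.
have th5 : 0 <= u / 5 <= 1 / 5 by apply/andP; split; clear -u0 u1; lra.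
have hs := expR_le3 (u / 5) th5.
have s1 : 1 <= expR (u / 5) by rewrite -[leLHS]expR0 ler_expR; clear -th5; lra.
have hex := tail_exponent n%:R u z _ (ler0n _ n) _ (ltW z0) hz hs s1.
move: hex; rewrite u0 u1 => /(_ isT) hex.
rewrite comp_size_law //.
have hbox : boxes (1 - p) j j.-1 <= z ^+ j.-1.
  have := boxes_le_lin _ q01 0 j j.-1 _ (leq_pred j).
  rewrite mul0r subr0; apply=> N N0; rewrite mulr0 mul0r.
  by rewrite ltW // one_sub_expr_gt0.
have lm : (j.-1 <= n.-1)%N by rewrite -ltnS !prednK // (leq_trans j0).
have hb := binomial_term_le z (expR (u / 5)) n.-1 j.-1 lm _ (expR_ge0 _).
move: hb; rewrite (ltW z0) z1 => /(_ isT) hb.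
have nj : (n.-1 - j.-1 = n - j)%N by case: j j0 {jn bj JR u u0 u1 uw z z0 z1 zE hz th5 hs s1 hex hbox lm hb} => // j _; case: n {v nw tE p p0 p1 qE n0 NR q01} => //.
rewrite nj zE in hb.
apply: le_trans (_ : ('C(n.-1, j.-1))%:R * (1 - p) ^+ (j * (n - j)) * z ^+ j.-1 <= _).
  apply: ler_wpM2l => //; rewrite mulr_ge0 ?exprn_ge0 //; clear -q01; lra.
rewrite exprM.
have hm : (1 - z + z * expR (u / 5)) ^+ n.-1 <= expR (n%:R * z * (expR (u / 5) - 1)).
  have -> : 1 - z + z * expR (u / 5) = 1 + z * (expR (u / 5) - 1) by ring.
  have y0 : 0 <= z * (expR (u / 5) - 1) by apply: mulr_ge0; [exact: ltW|(clear -s1; lra)].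
  apply: le_trans (_ : expR (z * (expR (u / 5) - 1)) ^+ n.-1 <= _).
    apply: lerXn2r; rewrite ?nnegrE ?expR_ge0 ?expR_ge1Dx //; clear -y0; lra.
  rewrite -expRM_natl ler_expR -mulrA; apply: ler_wpM2r => //.
  by rewrite ler_nat leq_pred.
rewrite zE in hm.
set B := _ * z ^+ j.-1 in hb *.
have S0 : 0 < expR (u / 5) ^+ j.-1 by rewrite exprn_gt0 // expR_gt0.
rewrite -(ler_pM2r S0); apply: le_trans hb _; apply: le_trans hm _.
rewrite -expRM_natl -!expRD ler_expR.
have jE : j.-1%:R = j%:R - 1 :> R by rewrite -subn1 natrB.
have Nu : n%:R * u = j%:R by rewrite /u mulrCA nw mulr1.
rewrite Nu in hex.
have Nu3 : (w ^+ 3)^-1 <= n%:R * u ^+ 3.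
  have -> : (w ^+ 3)^-1 = n%:R * (w ^+ 3) ^+ 3.
    have -> : n%:R = (w ^+ 12)^-1 by apply: (mulIf (lt0r_neq0 (W 12%N))); rewrite nw mulVf // lt0r_neq0.
    by field; rewrite gt_eqF.
  by rewrite ler_pM2l //; apply: lerXn2r; rewrite ?nnegrE ?(ltW u0) ?(ltW (W _)).
rewrite jE; clear -th5 hex Nu3; lra.
Qed.

(** Since [1/60 - 1/80 = 1/240], a spare [expR (- (y / 240))] absorbs the powers of [y]. At
    [y = n^(1/4)] the left side is [n] times the decay of one tail term, and [y * expR (- (y / 80))]
    is [E2]. *)
Lemma pow_exp_absorb : exists2 C : R, 0 < C & forall y, 1 <= y ->
  y ^+ 4 * expR (- (y / 60)) <= C * (y * expR (- (y / 80))).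
Proof.
exists (240 ^+ 4 * 4%:R ^+ 4); first by rewrite mulr_gt0 ?exprn_gt0.
move=> y y1; have x0 : 0 <= y / 240 by lra.
have h := pow1D_le_expR (y / 240) 4 x0 isT.
have yx : y ^+ 4 <= 240 ^+ 4 * (4%:R ^+ 4 * expR (y / 240)).
  apply: le_trans (_ : 240 ^+ 4 * (1 + y / 240) ^+ 4 <= _); last by rewrite ler_pM2l ?exprn_gt0.
  by rewrite -exprMn; apply: lerXn2r; rewrite ?nnegrE; lra.
have e : expR (- (y / 60)) = expR (- (y / 240)) * expR (- (y / 80)).
  by rewrite -expRD; congr expR; field.
apply: le_trans (ler_wpM2r (expR_ge0 _) yx) _; rewrite e.
have e1 : expR (y / 240) * expR (- (y / 240)) = 1 by exact: expRxMexpNx_1.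
move: (240 ^+ 4 : R) (exprn_ge0 4 (ler0n R 240)) => A A0.
move: (4%:R ^+ 4 : R) (exprn_ge0 4 (ler0n R 4)) => B B0.
rewrite [leLHS](_ : _ = A * B * expR (- (y / 80)) * (expR (y / 240) * expR (- (y / 240)))); last by ring.
rewrite e1 mulr1; apply: ler_wpM2l; first exact: mulr_ge0.
by rewrite ler_peMl // expR_ge0.
Qed.

End Tail.

(** * The tail probability *)

Section ComponentTail.
Context {R : realType}.
Implicit Types (x y a lam th w s u : R) (m M i j k l n : nat).

Lemma comp_size_le n (G : {set 'I_n * 'I_n}) v : (comp_size G v <= n)%N.
Proof. by rewrite /comp_size -[leqRHS]card_ord max_card. Qed.

Lemma gnp_prob_ge (p : R) n k (v : 'I_n) :
  gnp_prob p (fun G => (k <= comp_size G v)%N) =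
  \sum_(k <= j < n.+1) gnp_prob p (fun G => comp_size G v == j).
Proof.
rewrite /gnp_prob big_mkcondr /=.
under [RHS]eq_bigr do rewrite big_mkcondr /=.
rewrite exchange_big /=; apply: eq_bigr => G _.
rewrite -big_mkcond /=.
under eq_bigl do rewrite eq_sym.
by rewrite big_nat1_eq ltnS comp_size_le andbT.
Qed.

(** For [X = n^(1/12)] and [a] within 1 of the end [X] of its range, [a - 2 lam >= 59/100 * X],
    which makes the main term itself as small as [E2]. *)
Lemma Glam_ge (X a lam : R) : 100 <= X -> lam <= X / 5 -> X - 1 <= a -> X ^+ 3 / 60 <= Glam lam a.
Proof.
move=> X100 lX h1.
have b1 : X * (99 / 100) <= a by lra.
have b2 : X * (59 / 100) <= a - 2 * lam by lra.
have X0 : 0 <= X by lra.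
rewrite /Glam; have b3 : (X * (59 / 100)) ^+ 2 <= (a - 2 * lam) ^+ 2.
  by apply: lerXn2r; rewrite ?nnegrE; lra.
have c1 : 0 <= X * (99 / 100) / 8 by lra.
have b4 : X * (99 / 100) / 8 <= a / 8 by lra.
apply: le_trans (ler_pM c1 (sqr_ge0 _) b4 b3).
have X3 : 0 <= X ^+ 3 by exact: exprn_ge0.
have -> : X * (99 / 100) / 8 * (X * (59 / 100)) ^+ 2 = X ^+ 3 * (99 / 100 / 8 * (59 / 100) ^+ 2) by ring.
rewrite ler_wpM2l //; lra.
Qed.

Lemma component_tail : exists2 C : R, 0 < C & forall w lam n k (v : 'I_n),
  0 < w <= 1 / 100 -> -1 <= lam * w <= 1 / 5 -> n%:R * w ^+ 12 = 1 -> (0 < k)%N ->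
  1 <= k%:R * w ^+ 8 -> 3 * lam <= k%:R * w ^+ 8 -> k%:R * w ^+ 9 <= 1 ->
  let g := point_main w lam n k / (w ^+ 8 * dGlam lam (k%:R * w ^+ 8)) in
  `|gnp_prob (n%:R^-1 + lam * w ^+ 16) (fun G => (k <= comp_size G v)%N) - g| <=
     C * g * err w lam k + C * ((w ^+ 3)^-1 * expR (- ((w ^+ 3)^-1 / 80))).
Proof.
have [C1 C10 hC1] := @partial_sum R.
have [C2 C20 hC2] := @pow_exp_absorb R.
exists (C1 + 25 + 25 * C2 + expR (1 / 5) * C2).
  by rewrite !addr_gt0 // mulr_gt0 // expR_gt0.
move=> w lam n k v hw hmu nw k0 a1 la bk; cbv zeta.
have [w0 w1] := andP hw; have [mu0 mu1] := andP hmu.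
have mun : `|lam * w| <= 1 by rewrite ler_norml; apply/andP; split; clear -mu0 mu1; lra.
have W m : 0 < w ^+ m by rewrite exprn_gt0.
have n0 : n%:R != 0 :> R.
  by apply/eqP => e; move: nw; rewrite e mul0r => /eqP; rewrite eq_sym oner_eq0.
have NR : 0 < n%:R :> R by rewrite lt_neqAle eq_sym n0 /=.
have KR : 0 < k%:R :> R by rewrite ltr0n.
pose X9 := (w ^+ 9)^-1.
have X9k : k%:R <= X9 by rewrite /X9 -[leRHS]mul1r ler_pdivlMr.
have X9n : X9 <= n%:R.
  rewrite /X9 -[leLHS]mul1r ler_pdivrMr // -[leLHS]nw ler_pM2l //.
  by apply: ler_wiXn2l => //; clear -w0 w1; lra.
(* [k + M] is the first size strictly above [n^(3/4)], which is [X9]. *)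
pose M := (Num.truncn (X9 - k%:R)).+1.
have dk : 0 <= X9 - k%:R by rewrite subr_ge0.
have [M1 M2] : (M.-1%:R <= X9 - k%:R) /\ X9 - k%:R < M%:R by apply/andP; exact: truncn_itv.
have hM i : (i < M)%N -> (k + i)%:R * w ^+ 9 <= 1.
  move=> iM; rewrite -ler_pdivlMr // mul1r natrD -lerBrDl.
  by apply: le_trans M1; rewrite ler_nat -ltnS.
have [th0 hS] := hC1 w lam n k M v hw mun nw k0 a1 la bk hM.
move: th0 hS; cbv zeta; set a := k%:R * w ^+ 8 in a1 la *.
set th := w ^+ 8 * _; set m := point_main w lam n k; set E := err w lam k => th0 hS.
have m0 : 0 <= m := point_main_ge0 w lam n k.
have E0 : 0 <= E by exact: err_ge0.
set Y := (w ^+ 3)^-1; set T := Y * expR _.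
have Y1 : 1 <= Y by rewrite /Y invf_ge1 // exprn_ile1 //; clear -w0 w1; lra.
have YW : Y ^+ 4 = n%:R.
  by apply: (mulIf (lt0r_neq0 (W 12%N))); rewrite nw /Y; field; rewrite gt_eqF.
have kMn : (k + M <= n.+1)%N.
  rewrite -(ler_nat R) -[n.+1%:R]natr1 natrD.
  have -> : M%:R = M.-1%:R + 1 :> R by rewrite natr1.
  clear -X9n M1; lra.
set P := fun j => gnp_prob (n%:R^-1 + lam * w ^+ 16) (fun G => comp_size G v == j).
rewrite gnp_prob_ge (big_cat_nat (leq_addr M k) kMn) /= -/(P _).
set S2 := \sum_(k + M <= j < n.+1) _.
have -> : \sum_(k <= j < k + M) P j = \sum_(0 <= i < M) P (k + i)%N.
  by rewrite -{1}[k]add0n big_addn addKn; apply: eq_bigr => i _; rewrite addnC.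
have hS2 : `|S2| <= expR (1 / 5) * C2 * T.
  apply: le_trans (ler_norm_sum _ _ _) _.
  have P0 j : (k + M <= j < n.+1)%N -> `|P j| <= expR (1 / 5) * expR (- (Y / 60)).
    move=> /andP[kMj jn]; have j0 : (0 < j)%N by apply: leq_trans kMj; rewrite addn_gt0 k0.
    have bj : 1 <= j%:R * w ^+ 9.
      rewrite -ler_pdivrMr // mul1r; have : (k + M)%:R <= j%:R :> R by rewrite ler_nat.
      rewrite natrD -/X9; clear -M2; lra.
    have jn' : (0 < j <= n)%N by rewrite j0.
    rewrite ger0_norm; first exact: (tail_point w lam n j v hw hmu nw jn' bj).
    have [p0 _ _] := tau_expand w lam n hw mun nw; have [p0' p1'] := andP p0.
    have q01 : 0 < 1 - (n%:R^-1 + lam * w ^+ 16) < 1 by apply/andP; split; clear -p1' p0'; lra.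
    rewrite /P comp_size_law // mulr_ge0 ?boxes_ge0 // mulr_ge0 ?exprn_ge0 //; clear -q01; lra.
  apply: le_trans (_ : \sum_(k + M <= j < n.+1) (expR (1 / 5) * expR (- (Y / 60))) <= _).
    rewrite big_nat_cond [leRHS]big_nat_cond; apply: ler_sum => j /andP[jj _]; exact: P0.
  rewrite sumr_const_nat -[leLHS]mulr_natr.
  apply: le_trans (_ : expR (1 / 5) * expR (- (Y / 60)) * n%:R <= _).
    apply: ler_wpM2l; first by rewrite mulr_ge0 // expR_ge0.
    by rewrite ler_nat leq_subLR -addSnnS addSn ltnS (leq_trans _ (leq_addl _ _)) //= addn_gt0.
  rewrite -YW -!mulrA ler_pM2l ?expR_gt0 // mulrC; exact: hC2.
have G0 : 0 < dGlam lam a by rewrite -(pmulr_rgt0 _ (W 8%N)).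
have G25 : a ^+ 2 <= 25 * dGlam lam a.
  have := dGlam_ge a lam (le_trans ler01 a1) la; have : a ^+ 2 <= (a + `|lam|) ^+ 2.
    by apply: lerXn2r; rewrite ?nnegrE; have := normr_ge0 lam; clear -a1; lra.
  clear -R; lra.
have g0 : 0 <= m / th by rewrite divr_ge0 // ltW.
have eM : m / th * expR (- (th * M%:R)) <= 25 * (m / th) * E + 25 * C2 * T.
  have T0 : 0 <= T by rewrite /T mulr_ge0 ?expR_ge0 //; clear -Y1; lra.
  have thM : dGlam lam a * (w^-1 - a) <= th * M%:R.
    rewrite /th [leRHS](_ : _ = dGlam lam a * (w ^+ 8 * M%:R)); last by ring.
    rewrite ler_pM2l //; apply: le_trans (_ : w ^+ 8 * (X9 - k%:R) <= _); last by rewrite ler_pM2l // ltW.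
    by rewrite [leRHS](_ : _ = w^-1 - a) // /X9 /a; field; rewrite gt_eqF.
  (* The truncation error. If [a] is at distance 1 from [n^(1/12)], then
     [expR (- dGlam) <= 1 / dGlam <= 25 / a], which [err] covers; otherwise [Glam_ge] makes the
     whole main term [O(E2)]. *)
  have [h1|h1] := leP 1 (w^-1 - a).
    have aE : a^-1 <= E.
      have b0 : 0 < k%:R * w ^+ 9 by rewrite mulr_gt0.
      have -> : a^-1 = w / (k%:R * w ^+ 9) by rewrite /a; field; rewrite !gt_eqF.
      have h2 : 0 <= (k%:R * w ^+ 9) ^+ 4 by rewrite exprn_ge0 // ltW.
      have h3 := normr_ge0 (lam * w).
      have h4 : 0 <= `|lam * w| ^+ 3 * (k%:R * w ^+ 9) by rewrite mulr_ge0 ?exprn_ge0 // ltW.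
      by have := W 2%N; rewrite /E /err; clear -h2 h3 h4; lra.
    have e1 : expR (- (th * M%:R)) <= 25 * a^-1.
      apply: le_trans (_ : expR (- dGlam lam a) <= _).
        rewrite ler_expR lerN2; apply: le_trans thM; rewrite ler_peMr // ltW //.
      rewrite expRN; apply: le_trans (_ : (dGlam lam a)^-1 <= _).
        rewrite lef_pV2 ?posrE ?expR_gt0 //; have := expR_ge1Dx (dGlam lam a); clear -R; lra.
      have -> : 25 * a^-1 = (a / 25)^-1 by rewrite invf_div mulrC.
      rewrite lef_pV2 ?posrE //; last by apply: divr_gt0 => //; clear -a1; lra.
      rewrite ler_pdivrMr // mulrC; apply: le_trans G25; rewrite expr2 ler_peMl //; clear -a1; lra.
    apply: le_trans (_ : m / th * (25 * E) <= _).
      by apply: ler_wpM2l => //; apply: le_trans e1 _; rewrite ler_pM2l.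
    rewrite [leLHS](_ : _ = 25 * (m / th) * E); last by ring.
    by rewrite lerDl mulr_ge0 // mulr_ge0 // ltW.
  have e1 : expR (- (th * M%:R)) <= 1.
    by rewrite -[leRHS]expR0 ler_expR oppr_le0 mulr_ge0 // ltW.
  apply: le_trans (_ : m / th <= _); first by rewrite ler_piMr.
  apply: le_trans (_ : 25 * C2 * T <= _); last first.
    by rewrite lerDr mulr_ge0 // mulr_ge0.
  have Gam : Y / 60 <= Glam lam a.
    set X := w^-1 in h1; have X100 : 100 <= X.
      by rewrite /X -[leRHS]mul1r ler_pdivlMr //; clear -w1; lra.
    have lX : lam <= X / 5.
      by rewrite /X mulrC ler_pdivlMr //; clear -mu1; lra.
    have -> : Y = X ^+ 3 by rewrite /Y /X exprVn.
    by apply: Glam_ge => //; rewrite lerBlDl -lerBlDr ltW.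
  (* Crude bounds suffice: the prefactor of [m] is at most 1 and [1 / th <= 25 * n], where
     [n = Y ^ 4]. *)
  have gle : m / th <= 25 * (Y ^+ 4 * expR (- (Y / 60))).
    have mle : m <= expR (- (Y / 60)).
      rewrite /m /point_main -/a -[leRHS]mul1r; apply: ler_pM.
      - by rewrite divr_ge0 // ?mulr_ge0 ?sqrtr_ge0 // sqr_ge0.
      - exact: expR_ge0.
      - have s1 : 1 <= Num.sqrt (8 * pi) :> R.
          by rewrite -[leLHS]sqrtr1 ler_sqrt; have := pi_ge2 R; clear -R; lra.
        have kn : k%:R <= n%:R :> R by clear -X9n dk; lra.
        have sk : Num.sqrt k%:R <= k%:R :> R.
          rewrite -[leRHS](ger0_norm (ler0n _ _)) -sqrtr_sqr ler_sqrt ?sqr_ge0 //.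
          by rewrite expr2 ler_peMr // ler1n.
        have D0 : 0 < Num.sqrt (8 * pi) * n%:R ^+ 2 :> R.
          by apply: mulr_gt0; [exact: lt_le_trans s1|exact: exprn_gt0].
        rewrite ler_pdivrMr // mul1r.
        apply: le_trans (_ : n%:R ^+ 2 <= _); last by rewrite ler_peMl // sqr_ge0.
        by rewrite expr2; exact: (ler_pM (ler0n _ _) (sqrtr_ge0 _) kn (le_trans sk kn)).
      - by rewrite ler_expR lerN2.
    have thv : th^-1 <= 25 * Y ^+ 4.
      have -> : 25 * Y ^+ 4 = (w ^+ 12 / 25)^-1.
        by rewrite /Y; field; rewrite gt_eqF.
      rewrite lef_pV2 ?posrE ?divr_gt0 //.
      apply: le_trans (_ : w ^+ 8 / 25 <= _).
        by rewrite ler_pM2r ?invr_gt0 //; apply: ler_wiXn2l => //; clear -w0 w1; lra.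
      rewrite /th ler_pM2l //.
      have : 1 <= a ^+ 2 by exact: exprn_ege1.
      clear -G25; lra.
    rewrite mulrA [leRHS]mulrC; apply: ler_pM => //.
    by rewrite invr_ge0 ltW.
  apply: le_trans gle _; rewrite -[leRHS]mulrA ler_pM2l //; exact: hC2.
rewrite [_ + S2 - _](_ : _ = (\sum_(0 <= i < M) P (k + i)%N - m / th) + S2); last by ring.
apply: le_trans (ler_normD _ _) _.
apply: le_trans (lerD hS hS2) _; rewrite mulrDr.
rewrite [leRHS](_ : _ = (m / th * (C1 * E) + (25 * (m / th) * E + 25 * C2 * T) + expR (1 / 5) * C2 * T)
  + ((25 * C2 + expR (1 / 5) * C2) * (m / th) * E + (C1 + 25) * T)); last by ring.
have T0 : 0 <= T by rewrite /T mulr_ge0 ?expR_ge0 //; clear -Y1; lra.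
apply: ler_wpDr; last by apply: lerD => //; exact: lerD.
apply: addr_ge0.
  by rewrite mulr_ge0 // mulr_ge0 // addr_ge0 // mulr_ge0 ?expR_ge0 // ltW.
by rewrite mulr_ge0 // addr_ge0 // ltW.
Qed.

End ComponentTail.

(** * Back to powers of n *)

Section Scaling.
Context {R : realType}.
Implicit Types (w lam a : R) (n k : nat).

Lemma powR_3_2 a : 0 <= a -> a `^ (3 / 2) = a * Num.sqrt a.
Proof.
move=> a0; have -> : 3 / 2 = 1 + 2^-1 :> R by field.
rewrite powRD; first by rewrite powRr1 // powR12_sqrt.
by apply/implyP => /eqP h; have : 1 + 2^-1 != 0 :> R by []; rewrite h eqxx.
Qed.

(** The threshold [100 ^ 12] is what makes [w = n^(-1/12)] at most 1/100; the last bound is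
    [n^(-1/6) <= n^(-1/10)]. *)
Lemma scale_spec n : (0 < n)%N -> (100 ^+ 12 : R) <= n%:R ->
  let w : R := (n%:R `^ (1 / 12))^-1 in
  [/\ 0 < w <= 1 / 100, n%:R * w ^+ 12 = 1,
    forall m, n%:R `^ (1 / 12 * m%:R) = (w ^+ m)^-1,
    n%:R `^ (- (4 / 3)) = w ^+ 16 & w ^+ 2 <= 1 / n%:R `^ (1 / 10)].
Proof.
move=> n0 nN; cbv zeta; set X := n%:R `^ (1 / 12).
have NR : 0 < n%:R :> R by rewrite ltr0n.
have X0 : 0 < X by exact: powR_gt0.
have Xm m : n%:R `^ (1 / 12 * m%:R) = X ^+ m by rewrite powRrM powR_mulrn // ltW.
have X12 : X ^+ 12 = n%:R.
  by rewrite -Xm [1 / 12 * _](_ : _ = 1); [rewrite powRr1 // ltW|field].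
have X100 : 100 <= X.
  rewrite leNgt; apply/negP => h; move: nN; rewrite leNgt -X12 => /negP; apply.
  by apply: ltrXn2r => //; exact: ltW.
split.
- rewrite invr_gt0 X0 /= div1r lef_pV2 ?posrE //; lra.
- by rewrite -X12 -exprMn mulfV ?expr1n // gt_eqF.
- by move=> m; rewrite Xm exprVn invrK.
- by rewrite powRN [4 / 3](_ : _ = 1 / 12 * 16%:R); [rewrite Xm exprVn|field].
- rewrite div1r exprVn lef_pV2 ?posrE ?exprn_gt0 ?powR_gt0 // -Xm.
  apply: ler_powR; first by rewrite ler1n.
  lra.
Qed.

(** Four terms coincide after rescaling; only [w ^ 2] is replaced by the larger [n^(-1/10)]. *)
Lemma err_le_E1 w lam n k : 0 < w -> n%:R * w ^+ 12 = 1 -> (0 < k)%N ->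
  n%:R `^ (1 / 12) = w^-1 -> n%:R `^ (2 / 3) = (w ^+ 8)^-1 ->
  w ^+ 2 <= 1 / n%:R `^ (1 / 10) -> err w lam k <= E1 k n lam.
Proof.
move=> w0 nw k0 h1 h2; rewrite /err /E1 h1 h2.
move: (n%:R `^ (1 / 10)) => Z h3.
have KR : 0 < k%:R :> R by rewrite ltr0n.
have nE : n%:R = (w ^+ 12)^-1.
  by apply: (mulIf (lt0r_neq0 (exprn_gt0 12 w0))); rewrite nw mulVf // lt0r_neq0 // exprn_gt0.
rewrite nE invrK normrM [`|w|]ger0_norm ?(ltW w0) //.
apply: lerD => //.
have -> : (k%:R * w ^+ 9) ^+ 4 = k%:R ^+ 4 / (w ^+ 12)^-1 ^+ 3 by field; rewrite gt_eqF.
have -> : (`|lam| * w) ^+ 3 * (k%:R * w ^+ 9) = `|lam| ^+ 3 * k%:R / (w ^+ 12)^-1.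
  by field; rewrite gt_eqF.
by have -> : w / (k%:R * w ^+ 9) = (w ^+ 8)^-1 / k%:R by field; rewrite !gt_eqF.
Qed.

(** The factor [n^(2/3) / dGlam] of the geometric sum turns [k^(3/2) / n ^ 2] into
    [a^(3/2) / (n^(1/3) dGlam)]. *)
Lemma point_main_scale w lam n k : 0 < w -> n%:R * w ^+ 12 = 1 ->
  dGlam lam (k%:R * w ^+ 8) != 0 ->
  point_main w lam n k / (w ^+ 8 * dGlam lam (k%:R * w ^+ 8)) =
  k%:R * w ^+ 8 * Num.sqrt (k%:R * w ^+ 8) /
    (Num.sqrt (8 * pi) * (w ^+ 4)^-1 * dGlam lam (k%:R * w ^+ 8)) *
    expR (- Glam lam (k%:R * w ^+ 8)).
Proof.
move=> w0 nw D0; have -> : Num.sqrt (k%:R * w ^+ 8) = Num.sqrt k%:R * w ^+ 4.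
  rewrite sqrtrM //; have -> : w ^+ 8 = (w ^+ 4) ^+ 2 by ring.
  by rewrite sqrtr_sqr ger0_norm // exprn_ge0 // ltW.
have nE : n%:R = (w ^+ 12)^-1.
  by apply: (mulIf (lt0r_neq0 (exprn_gt0 12 w0))); rewrite nw mulVf // lt0r_neq0 // exprn_gt0.
have P0 : Num.sqrt (8 * pi) != 0 :> R.
  by rewrite gt_eqF // sqrtr_gt0 mulr_gt0 // pi_gt0.
rewrite /point_main nE; move: D0 P0.
move: (dGlam _ _) (Glam _ _) (Num.sqrt (8 * pi)) => D G P D0 P0.
by field; rewrite D0 P0 gt_eqF.
Qed.

End Scaling.

Theorem theorem2p2 (R : realType) :
  (exists C : R, exists N : nat, forall n : nat, (N <= n)%N ->
     forall (lam : R) (k : nat) (v : 'I_n),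
     `|lam| <= (n%:R : R) `^ (1 / 12) ->
     (n%:R : R) `^ (2 / 3) <= (k%:R : R) <= (n%:R : R) `^ (3 / 4) ->
     let a := (k%:R : R) / (n%:R : R) `^ (2 / 3) in
     let P := gnp_prob (p_nl n lam) (fun G => comp_size G v == k) in
     let g := (k%:R : R) `^ (3 / 2) / (Num.sqrt (8 * (pi : R)) * (n%:R : R) ^+ 2)
              * expR (- Glam lam a) in
     `|P - g| <= C * `|g| * E1 k n lam)
  /\
  (exists C : R, exists N : nat, forall n : nat, (N <= n)%N ->
     forall (lam : R) (k : nat) (v : 'I_n),
     - (n%:R : R) `^ (1 / 12) <= lam <= (n%:R : R) `^ (1 / 12) / 5 ->
     Num.max (3 * lam) 1 * (n%:R : R) `^ (2 / 3) <= (k%:R : R) <= (n%:R : R) `^ (3 / 4) ->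
     let a := (k%:R : R) / (n%:R : R) `^ (2 / 3) in
     let P := gnp_prob (p_nl n lam) (fun G => (k <= comp_size G v)%N) in
     let g := a `^ (3 / 2) / (Num.sqrt (8 * (pi : R)) * (n%:R : R) `^ (1 / 3) * dGlam lam a)
              * expR (- Glam lam a) in
     `|P - g| <= C * `|g| * E1 k n lam + C * E2 R n).
Proof.
pose N := (Num.truncn (100 ^+ 12 : R)).+1.
have scale n : (N <= n)%N -> (0 < n)%N /\ (100 ^+ 12 : R) <= n%:R.
  move=> Nn; split; first exact: leq_trans Nn.
  by apply: le_trans (ltW (truncnS_gt _)) _; rewrite ler_nat.
have e23 : 2 / 3 = 1 / 12 * 8%:R :> R by field.
have e34 : 3 / 4 = 1 / 12 * 9%:R :> R by field.
have e13 : 1 / 3 = 1 / 12 * 4%:R :> R by field.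
have e14 : 1 / 4 = 1 / 12 * 3%:R :> R by field.
split.
  have [C C0 hC] := @point_asymp R; exists C, N => n /scale [n0 nN] lam k v.
  have := scale_spec n n0 nN; cbv zeta; rewrite /p_nl /E1.
  have XE : n%:R `^ (1 / 12) = ((n%:R `^ (1 / 12))^-1)^-1 :> R by rewrite invrK.
  move: XE; set w := (n%:R `^ (1 / 12))^-1 => XE [hw nw hm h43 h10].
  have [w0 w1] := andP hw; have W m : 0 < w ^+ m by rewrite exprn_gt0.
  have h23 : n%:R `^ (2 / 3) = (w ^+ 8)^-1 by rewrite e23.
  have h34 : n%:R `^ (3 / 4) = (w ^+ 9)^-1 by rewrite e34.
  rewrite -/(E1 k n lam) h23 h34 h43 XE => hlam /andP[k1 k2].
  have KR : 0 < k%:R :> R by apply: lt_le_trans k1; rewrite invr_gt0.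
  have k0 : (0 < k)%N by rewrite -(ltr0n R).
  have mu1 : `|lam * w| <= 1.
    by rewrite normrM [`|w|]gtr0_norm // -ler_pdivlMr // mul1r.
  have b1 : w <= k%:R * w ^+ 9 <= 1.
    apply/andP; split; last by rewrite -ler_pdivlMr // mul1r.
    have -> : k%:R * w ^+ 9 = k%:R * w ^+ 8 * w by ring.
    by rewrite ler_peMl ?(ltW w0) // -ler_pdivrMr // mul1r.
  have hE := err_le_E1 w lam n k w0 nw k0 XE h23 h10.
  rewrite invrK powR_3_2 ?ler0n // -/(point_main w lam n k).
  have g0 : 0 <= point_main w lam n k := point_main_ge0 w lam n k.
  rewrite (ger0_norm g0); apply: le_trans (hC w lam n k v hw mu1 nw k0 b1) _.
  by rewrite mulrCA -mulrA ler_pM2l //; exact: ler_wpM2l.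
have [C C0 hC] := @component_tail R; exists C, N => n /scale [n0 nN] lam k v.
have := scale_spec n n0 nN; cbv zeta; rewrite /p_nl /E1 /E2.
have XE : n%:R `^ (1 / 12) = ((n%:R `^ (1 / 12))^-1)^-1 :> R by rewrite invrK.
move: XE; set w := (n%:R `^ (1 / 12))^-1 => XE [hw nw hm h43 h10].
have [w0 w1] := andP hw; have W m : 0 < w ^+ m by rewrite exprn_gt0.
have h23 : n%:R `^ (2 / 3) = (w ^+ 8)^-1 by rewrite e23.
have h34 : n%:R `^ (3 / 4) = (w ^+ 9)^-1 by rewrite e34.
have h13 : n%:R `^ (1 / 3) = (w ^+ 4)^-1 by rewrite e13.
have h14 : n%:R `^ (1 / 4) = (w ^+ 3)^-1 by rewrite e14.
rewrite -/(E1 k n lam) h23 h34 h13 h14 h43 XE => /andP[l1 l2] /andP[k1 k2].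
have a1 : Num.max (3 * lam) 1 <= k%:R * w ^+ 8 by rewrite -ler_pdivrMr.
move: a1; rewrite ge_max => /andP[la a1].
have KR : 0 < k%:R :> R by rewrite -(pmulr_lgt0 _ (W 8%N)); clear -a1; lra.
have k0 : (0 < k)%N by rewrite -(ltr0n R).
have mu1 : -1 <= lam * w <= 1 / 5.
  apply/andP; split; first by rewrite -ler_pdivrMr // mulN1r.
  by rewrite -ler_pdivlMr // mul1r mulrC.
have b1 : k%:R * w ^+ 9 <= 1 by rewrite -ler_pdivlMr // mul1r.
have hE := err_le_E1 w lam n k w0 nw k0 XE h23 h10.
have D0 : 0 < dGlam lam (k%:R * w ^+ 8).
  have := dGlam_ge (k%:R * w ^+ 8) lam (le_trans ler01 a1) la.
  apply: lt_le_trans; rewrite divr_gt0 // exprn_gt0 //.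
  by have := normr_ge0 lam; clear -a1; lra.
rewrite invrK powR_3_2 ?(le_trans ler01 a1) //.
rewrite -(point_main_scale w lam n k w0 nw (lt0r_neq0 D0)) mulNr.
have := hC w lam n k v hw mu1 nw k0 a1 la b1; cbv zeta.
have g0 : 0 <= point_main w lam n k / (w ^+ 8 * dGlam lam (k%:R * w ^+ 8)).
  by rewrite divr_ge0 ?point_main_ge0 // mulr_ge0 // ltW.
rewrite (ger0_norm g0) => h; apply: le_trans h _.
by rewrite lerD2r; apply: ler_wpM2l => //; rewrite mulr_ge0 // ltW.
Qed.
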